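(* Let $\mathcal{U}=\{f\in L^2(\mathbb{R}):\hat f\in L^1(\mathbb{R})\}$ and let $f\in\mathcal{U}$. Then $f$ belongs to a sampling space $V(\varphi)$ with $\varphi\in\mathcal{U}$ if and only if $f$ satisfies all of the following: a) the sequence $\{f(k)\}_{k\in\mathbb{Z}}$ belongs to $\ell^2(\mathbb{Z})$; b) there exist $A,B>0$ such that $$A\,|Z_f(0,\omega)|^2\le G_f(\omega)\le B\,|Z_f(0,\omega)|^2\quad\text{for a.e. }\omega\in\mathbb{R};$$ c) $$\int_{[0,1]\cap E_f}\frac{\sum_{k\in\mathbb{Z}}|\hat f(\omega+k)|}{|Z_f(0,\omega)|}\,d\omega<+\infty;$$ d) there exists $L>0$ such that $$\int_{[0,1]\cap E_f}\left|\frac{Z_{\hat f}(\omega,-x)}{Z_f(0,\omega)}\right|^2d\omega<L<+\infty\quad\text{for all }x\in\mathbb{R}.$$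
   Context: Fourier transform: $\hat f(\omega)=\int_{-\infty}^{+\infty} f(x)e^{-2\pi i x\omega}\,dx$ (extended to $L^2(\mathbb{R})$). For $f\in L^2(\mathbb{R})$, $S(f)$ is the closure in $L^2(\mathbb{R})$ of the linear span of $\{f(\cdot-k):k\in\mathbb{Z}\}$. One writes $V(\varphi)$ for $S(\varphi)$ when $\{\varphi(\cdot-k)\}_{k\in\mathbb{Z}}$ is a frame of $S(\varphi)$. Grammian: $G_f(\omega)=\sum_{k\in\mathbb{Z}}|\hat f(\omega+k)|^2$, and $E_f=\{\omega\in\mathbb{R}: G_f(\omega)>0\}$. Zak transform: $Z_f(x,\omega)=\sum_{k\in\mathbb{Z}}f(x+k)e^{-2\pi i k\omega}$. Thus $Z_f(0,\omega)=\sum_k f(k)e^{-2\pi i k\omega}$ (understood in $L^2[0,1]$ when $\{f(k)\}\in\ell^2(\mathbb{Z})$), and $Z_{\hat f}(\omega,-x)=\sum_{k\in\mathbb{Z}}\hat f(\omega+k)e^{2\pi i k x}$, which converges absolutely for a.e. $\omega$ when $\hat f\in L^1(\mathbb{R})$. Sampling space: a closed subspace $V(\varphi)$ of $L^2(\mathbb{R})$ is a sampling space if there is a function $s$ such that (1) the translates $\{s(\cdot-k)\}_{k\in\mathbb{Z}}$ are a frame for $V(\varphi)$; (2) for every $\{c_k\}\in\ell^2(\mathbb{Z})$ the series $\sum_{k}c_k s(\cdot-k)$ converges pointwise to a continuous function; (3) for every $g\in V(\varphi)$, $g(x)=\sum_{k\in\mathbb{Z}}g(k)s(x-k)$, with convergence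 in $L^2(\mathbb{R})$ and uniformly on $\mathbb{R}$. Functions in $\mathcal{U}$ and functions in sampling spaces are identified with their continuous representatives, so point values make sense. *)

(* Defs.v *)
From mathcomp Require Import all_boot all_order all_algebra.
From mathcomp Require Import complex.
From mathcomp Require Import all_classical all_reals all_analysis.

Set Implicit Arguments.
Unset Strict Implicit.
Unset Printing Implicit Defensive.

Import Order.TTheory GRing.Theory Num.Theory.
Import ComplexField.Normc.
Import numFieldNormedType.Exports.

Local Open Scope classical_set_scope.
Local Open Scope ring_scope.
Local Open Scope complex_scope.

Section Definitions.
Context {R : realType}.
Implicit Types (f g h s psi : R -> R[i]) (u c : int -> R[i]) (D : set R).
Implicit Types V : set (R -> R[i]).

Local Notation mu := (@lebesgue_measure R).

(* [e2pi t] is $e^{2\pi i t}$. *)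
Definition e2pi (t : R) : R[i] := cos (2 * pi * t) +i* sin (2 * pi * t).

Definition cmeasurable f :=
  measurable_fun [set: R] (fun x => complex.Re (f x)) /\
  measurable_fun [set: R] (fun x => complex.Im (f x)).

Definition cintegral D f : R[i] :=
  Rintegral mu D (fun x => complex.Re (f x)) +i* Rintegral mu D (fun x => complex.Im (f x)).

Definition sqnorm D f : \bar R := (\int[mu]_(x in D) (normc (f x) ^+ 2)%:E)%E.

Definition inner f g : R[i] := cintegral [set: R] (fun x => f x * conjc (g x)).

Definition memL1 f :=
  cmeasurable f /\ (\int[mu]_x (normc (f x))%:E < +oo)%E.

Definition memL2 f := cmeasurable f /\ (sqnorm [set: R] f < +oo)%E.

Definition memell2 c := (\esum_(k in [set: int]) (normc (c k) ^+ 2)%:E < +oo)%E.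

(* The topology of [R[i]] is the one of the regular module [R[i]^o]. *)
Definition ccontinuous f := continuous (f : R -> R[i]^o).

(* Bilateral partial sums $\sum_{k=-p.1}^{p.2-1} u_k$ ([Negz k] is $-(k+1)$);
   a series over the integers is the limit as both ends go to infinity
   independently. *)
Definition bilateral_psum u (p : nat * nat) : R[i] :=
  \sum_(k < p.1) u (Negz k) + \sum_(k < p.2) u (Posz k).

Definition bilateral_cvg u (l : R[i]) :=
  (bilateral_psum u p : R[i]^o) @[p --> (\oo, \oo)] --> (l : R[i]^o).

Definition bilateral_sum u : R[i] := lim ((bilateral_psum u p : R[i]^o) @[p --> (\oo, \oo)]).

Definition translate f (k : int) : R -> R[i] := fun x => f (x - k%:~R).

Definition fourierL1 f : R -> R[i] :=
  fun w => cintegral [set: R] (fun x => f x * e2pi (- (x * w))).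

(* The graph of the Fourier transform on $L^2$ is the $L^2$-closure of its graph
   on $L^1 \cap L^2$. *)
Definition is_fourier f g := memL2 g /\
  exists h : nat -> R -> R[i],
    [/\ forall n, memL1 (h n) /\ memL2 (h n),
        sqnorm [set: R] (fun x => h n x - f x) @[n --> \oo] --> 0%E &
        sqnorm [set: R] (fun w => fourierL1 (h n) w - g w) @[n --> \oo] --> 0%E].

(* A representative of the a.e. class of $\hat f$, for f in $L^2$. *)
Definition fourier f : R -> R[i] := xget (cst 0) [set g | is_fourier f g].

(* An element of this class is its (unique) continuous representative. *)
Definition classU f := [/\ ccontinuous f, memL2 f & memL1 (fourier f)].

(* S(f), as a set of functions closed under a.e. equality. *)
Definition shift_span f : set (R -> R[i]) := [set g | memL2 g /\
  forall e : R, 0 < e -> exists (r : seq int) (c : int -> R[i]),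
    (sqnorm [set: R] (fun x => g x - \sum_(k <- r) c k * translate f k x)%R < e%:E)%E].

Definition is_frame psi V := (forall k, V (translate psi k)) /\
  exists A B : R, [/\ 0 < A, 0 < B & forall g, V g ->
    (A%:E * sqnorm [set: R] g
       <= \esum_(k in [set: int]) (normc (inner g (translate psi k)) ^+ 2)%:E)%E /\
    (\esum_(k in [set: int]) (normc (inner g (translate psi k)) ^+ 2)%:E
       <= B%:E * sqnorm [set: R] g)%E].

(* [g0] is the continuous representative of [g], through which the samples of
   [g] are taken. *)
Definition sampling_space V := exists s,
  [/\ is_frame s V,
      forall c, memell2 c -> exists2 h, ccontinuous h &
        forall x, bilateral_cvg (fun k => c k * translate s k x) (h x) &
      forall g, V g -> exists g0,
        let S_ p x := bilateral_psum (fun k => g0 k%:~R * translate s k x) p in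
        [/\ ccontinuous g0,
            {ae mu, forall x, g x = g0 x},
            sqnorm [set: R] (fun x => S_ p x - g0 x) @[p --> (\oo, \oo)] --> 0%E &
            forall e : R, 0 < e -> \forall p \near (\oo, \oo),
              forall x, normc (S_ p x - g0 x) < e]].

Definition gram f (w : R) : \bar R :=
  (\esum_(k in [set: int]) (normc (fourier f (w + k%:~R)) ^+ 2)%:E)%E.

Definition gram_supp f : set R := [set w | (0 < gram f w)%E].

Definition zak f (x w : R) : R[i] :=
  bilateral_sum (fun k => f (x + k%:~R) * e2pi (- (k%:~R * w))).

(* The 1-periodic z is the sum of $\sum_k u_k e^{-2\pi i k\omega}$ in
   $L^2[0,1]$. *)
Definition is_fourier_series u (z : R -> R[i]) :=
  [/\ cmeasurable z, forall w, z (w + 1) = z w &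
      sqnorm `[0, 1] (fun w => bilateral_psum (fun k => u k * e2pi (- (k%:~R * w))) p - z w)
        @[p --> (\oo, \oo)] --> 0%E].

(* $Z_f(0,\cdot)$, which is only an $L^2[0,1]$ sum; it is meaningful when
   $(f(k))_k$ is in $\ell^2$. *)
Definition zak0 f : R -> R[i] :=
  xget (cst 0) [set z | is_fourier_series (fun k => f k%:~R) z].

End Definitions.

(* Main.v *)
Require Import Defs.
From mathcomp Require Import all_boot all_order all_algebra.
From mathcomp Require Import complex.
From mathcomp Require Import ring lra.
From mathcomp Require Import all_classical all_reals all_analysis.
From mathcomp Require Import measurable_realfun.
Import Order.TTheory GRing.Theory Num.Theory.
Import ComplexField.Normc.
Import numFieldNormedType.Exports.
Set Implicit Arguments.
Unset Strict Implicit.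
Unset Printing Implicit Defensive.
Local Open Scope classical_set_scope.
Local Open Scope ring_scope.
Local Open Scope complex_scope.

(** For $s \in L^2(\mathbb{R})$ consider the fiber norms
    $G_s(\omega)=\sum_k|\hat s(\omega+k)|^2$ and their support $E_s$. On the Fourier
    side a combination of translates of $s$ is $P\hat s$ with a trigonometric
    polynomial $P$, and its squared norm is $\int_0^1|P|^2G_s$, while the sum of its
    squared inner products with the translates is $\int_0^1|P|^2G_s^2$. Hence the
    translates are a frame exactly when $A \le G_s \le B$ on $E_s$ ([frame_bracket],
    [bracket_frame]), and then the members of $S(s)$ are the functions with transform
    $C\hat s$, where $C \in L^2[0,1]$ is periodic and vanishes off $E_s$
    ([shift_span_multiplier], [series_L2_cvg]). The link with samples is Poisson
    summation: for $g \in \mathcal{U}$ the value $g(n)$ is the $n$-th Fourier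
    coefficient of the periodization of $\hat g$ ([sample_coef0]), so that
    $Z_g(0,\cdot)$ is this periodization when the samples are square summable
    ([zak0_perz]); shifting by $x$ and using Parseval,
    $\sum_n|g(x+n)|^2=\int_0^1|Z_{\hat g}(\omega,-x)|^2d\omega$ ([sample_sq]).

    Necessity. Let $s$ generate the sampling space. The sampling formula for $s$ itself
    says that $Z_s(0,\cdot)$ is $1$ on $E_s$ ([generator_zak]), and $\hat f=C\hat s$
    then gives $Z_f(0,\cdot)=C$. This is a), it turns the frame bounds of $s$ into b),
    and it makes the quotients in c) and d) those of $\hat s$. Thus c) is the
    integrability of $\hat s$, which is a bounded multiple of $\hat\varphi$
    ([L1_fourier_generator]), and d) is a bound on $\sum_k|s(x+k)|^2$. The latter comes
    from two applications of the uniform boundedness principle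
    ([l2_uniform_boundedness]): convergence of $\sum_k c_ks(x-k)$ for all
    $c \in \ell^2$ makes $(s(x-k))_k$ square summable, and continuity of the sum on
    $[0,1]$ bounds its norm in $x$.

    Sufficiency. Define $s$ by $\hat s=\hat f/Z_f(0,\cdot)$. Condition b) is the frame
    bracket for $s$, c) puts $\hat s$ in $L^1$, and d) bounds $\sum_k|s(x+k)|^2$, so that
    the series $\sum_kc_ks(\cdot-k)$ converge uniformly ([translate_series]). The
    periodization of $\hat s$ is the indicator of $E_s$, so the sample at $n$ of the
    function with transform $C\hat s$ is the $n$-th Fourier coefficient of $C$
    ([interpolation]), which is the sampling formula.

    The Fourier transform on $L^2(\mathbb{R})$ is reached through the circle. Fourier
    coefficients determine an integrable function because trigonometric polynomials
    approximate the indicators of arcs ([trig_positive], [fcoef_eq0]); Parseval follows,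
    and Plancherel is Parseval used twice, once in each variable of
    $\sum_nh(x+n)e^{-2\pi i(x+n)\omega}$ ([plancherel_L1]). *)

(** * Complex arithmetic and measurability *)
Section ComplexArith.
Context {R : realType}.
Implicit Types (z w : R[i]) (f g : R -> R[i]).

Lemma normc2E z : normc z ^+ 2 = complex.Re z ^+ 2 + complex.Im z ^+ 2.
Proof. by case: z => a b; rewrite /normc sqr_sqrtr// addr_ge0// sqr_ge0. Qed.

Lemma normc_ge0 z : 0 <= normc z.
Proof. by case: z => a b; exact: sqrtr_ge0. Qed.

Lemma normc_eq0 z : (normc z == 0) = (z == 0).
Proof. by apply/eqP/eqP => [/eq0_normc//|->]; exact: normc0. Qed.

Lemma normc_conj z : normc (conjc z) = normc z.
Proof. by case: z => a b; rewrite /normc /= sqrrN. Qed.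

Lemma Re_le_normc z : `|complex.Re z| <= normc z.
Proof.
case: z => a b; rewrite /normc/= -sqrtr_sqr ler_wsqrtr// lerDl; exact: sqr_ge0.
Qed.

Lemma Im_le_normc z : `|complex.Im z| <= normc z.
Proof.
case: z => a b; rewrite /normc/= -sqrtr_sqr ler_wsqrtr// lerDr; exact: sqr_ge0.
Qed.

Lemma normc_le_ReIm z : normc z <= `|complex.Re z| + `|complex.Im z|.
Proof.
rewrite -(@ler_pXn2r _ 2)// ?nnegrE ?normc_ge0 ?addr_ge0// normc2E sqrrD !real_normK ?num_real//.
by rewrite -addrA lerD2l lerDr mulrn_wge0// mulr_ge0.
Qed.

Lemma ReD z w : complex.Re (z + w) = complex.Re z + complex.Re w.
Proof. by case: z w => [a b] [c d]. Qed.
Lemma ImD z w : complex.Im (z + w) = complex.Im z + complex.Im w.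
Proof. by case: z w => [a b] [c d]. Qed.
Lemma ReN z : complex.Re (- z) = - complex.Re z.
Proof. by case: z. Qed.
Lemma ImN z : complex.Im (- z) = - complex.Im z.
Proof. by case: z. Qed.
Lemma Re_mulc z w : complex.Re (z * w) =
  complex.Re z * complex.Re w - complex.Im z * complex.Im w.
Proof. by case: z w => [a b] [c d]. Qed.
Lemma Im_mulc z w : complex.Im (z * w) =
  complex.Re z * complex.Im w + complex.Im z * complex.Re w.
Proof. by case: z w => [a b] [c d]. Qed.
Lemma Reconj z : complex.Re (conjc z) = complex.Re z. Proof. by case: z. Qed.
Lemma Imconj z : complex.Im (conjc z) = - complex.Im z. Proof. by case: z. Qed.

Lemma complex_eqP z w : complex.Re z = complex.Re w ->
  complex.Im z = complex.Im w -> z = w.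
Proof. by case: z w => [a b] [c d] /= -> ->. Qed.

Lemma conjcM z w : conjc (z * w) = conjc z * conjc w.
Proof. by apply: complex_eqP; rewrite ?(Reconj, Imconj, Re_mulc, Im_mulc); ring. Qed.

Definition ReImE := (ReD, ImD, ReN, ImN, Re_mulc, Im_mulc, Reconj, Imconj).

Lemma mul_conjc z : z * conjc z = (normc z ^+ 2)%:C.
Proof. by apply: complex_eqP; rewrite ReImE/= ?normc2E ?Imconj ?Reconj; ring. Qed.

Lemma invcE z : z^-1 = conjc z * ((normc z ^+ 2)^-1)%:C.
Proof.
have [->|z0] := eqVneq z 0; first by rewrite invr0 conjc0 mul0r.
apply: (mulfI z0); rewrite mulfV// mulrA mul_conjc -rmorphM/= mulfV//.
by rewrite sqrf_eq0 normc_eq0.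
Qed.

Lemma normc_real (x : R) : normc x%:C = `|x|.
Proof. by rewrite /normc /= expr0n/= addr0 sqrtr_sqr. Qed.

Lemma normcB_sym z w : normc (z - w) = normc (w - z).
Proof. by rewrite -opprB normcN. Qed.

Lemma normc_sum (I : Type) (r : seq I) (P : pred I) (F : I -> R[i]) :
  normc (\sum_(i <- r | P i) F i) <= \sum_(i <- r | P i) normc (F i).
Proof.
elim/big_ind2 : _ => //; first by rewrite normc0.
by move=> x1 x2 y1 y2 h1 h2; rewrite (le_trans (le_normcD _ _))// lerD.
Qed.

Lemma normc_sqD z w (t : R) : 0 < t ->
  normc (z + w) ^+ 2 <= (1 + t) * normc z ^+ 2 + (1 + t^-1) * normc w ^+ 2.
Proof.
move=> t0; rewrite !normc2E !ReImE.
have H (a b : R) : (a + b) ^+ 2 <= (1 + t) * a ^+ 2 + (1 + t^-1) * b ^+ 2.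
  rewrite -subr_ge0 (_ : _ - _ = (t * a - b) ^+ 2 * t^-1).
    by rewrite mulr_ge0 ?sqr_ge0// invr_ge0 ltW.
  by field; rewrite gt_eqF.
by rewrite (le_trans (lerD (H _ _) (H _ _)))// le_eqVlt; apply/orP; left; apply/eqP; ring.
Qed.

Lemma normcM_le z w (t : R) : 0 < t ->
  normc (z * w) *+ 2 <= t * normc z ^+ 2 + t^-1 * normc w ^+ 2.
Proof.
move=> t0; rewrite normcM -subr_ge0.
rewrite (_ : _ - _ = (t * normc z - normc w) ^+ 2 * t^-1).
  by rewrite mulr_ge0 ?sqr_ge0// invr_ge0 ltW.
by rewrite -mulr_natr; field; rewrite gt_eqF.
Qed.

Lemma e2piD (s t : R) : e2pi (s + t) = e2pi s * e2pi t.
Proof.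
by apply: complex_eqP; rewrite !ReImE/= mulrDr ?cosD ?sinD//; ring.
Qed.

Lemma e2piN (t : R) : e2pi (- t) = conjc (e2pi t).
Proof. by apply: complex_eqP; rewrite /= mulrN ?cosN ?sinN. Qed.

Lemma e2pi0 : e2pi (0 : R) = 1.
Proof. by rewrite /e2pi mulr0 cos0 sin0. Qed.

Lemma normc_e2pi (t : R) : normc (e2pi t) = 1.
Proof. by rewrite /normc /e2pi cos2Dsin2 sqrtr1. Qed.

Lemma e2pi1 : e2pi (1 : R) = 1.
Proof. by rewrite /e2pi mulr1 mulr_natl cos2pi sin2pi. Qed.

Lemma e2pi_nat (n : nat) : e2pi (n%:R : R) = 1.
Proof.
by elim: n => [|n IH]; [exact: e2pi0|rewrite -natr1 e2piD IH e2pi1 mul1r].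
Qed.

Lemma e2pi_int (k : int) : e2pi (k%:~R : R) = 1.
Proof.
case: k => n; first exact: e2pi_nat.
by rewrite NegzE mulrNz e2piN -pmulrn e2pi_nat conjc1.
Qed.

Lemma cmeasurable_cst z : cmeasurable (fun _ : R => z).
Proof. by split; exact: measurable_cst. Qed.

Lemma cmeasurableD f g : cmeasurable f -> cmeasurable g ->
  cmeasurable (fun x => f x + g x).
Proof.
move=> [f1 f2] [g1 g2]; split.
  by under eq_fun do rewrite ReD; exact: measurable_funD.
by under eq_fun do rewrite ImD; exact: measurable_funD.
Qed.

Lemma cmeasurableN f : cmeasurable f -> cmeasurable (fun x => - f x).
Proof.
move=> [f1 f2]; split.
  by under eq_fun do rewrite ReN; exact: measurableT_comp.
by under eq_fun do rewrite ImN; exact: measurableT_comp.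
Qed.

Lemma cmeasurableM f g : cmeasurable f -> cmeasurable g ->
  cmeasurable (fun x => f x * g x).
Proof.
move=> [f1 f2] [g1 g2]; split.
  by under eq_fun do rewrite Re_mulc; apply: measurable_funB; exact: measurable_funM.
by under eq_fun do rewrite Im_mulc; apply: measurable_funD; exact: measurable_funM.
Qed.

Lemma cmeasurable_conj f : cmeasurable f -> cmeasurable (fun x => conjc (f x)).
Proof.
move=> [f1 f2]; split; first by under eq_fun do rewrite Reconj.
by under eq_fun do rewrite Imconj; exact: measurableT_comp.
Qed.

Lemma cmeasurable_real (h : R -> R) : measurable_fun setT h ->
  cmeasurable (fun x => (h x)%:C).
Proof. by move=> mh; split => //; exact: measurable_cst. Qed.

Lemma cmeasurable_comp f (h : R -> R) : cmeasurable f -> measurable_fun setT h ->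
  cmeasurable (fun x => f (h x)).
Proof.
move=> [f1 f2] mh.
by split; [exact: (measurableT_comp f1)|exact: (measurableT_comp f2)].
Qed.

Lemma measurable_normc2 f : cmeasurable f ->
  measurable_fun setT (fun x => normc (f x) ^+ 2).
Proof.
move=> [f1 f2]; under eq_fun do rewrite normc2E.
by apply: measurable_funD; exact: measurable_funX.
Qed.

Lemma measurable_normc f : cmeasurable f ->
  measurable_fun setT (fun x => normc (f x)).
Proof.
move=> mf; rewrite (_ : (fun x => _) = (@powR R ^~ 2^-1) \o (fun x => normc (f x) ^+ 2)).
  exact: (measurableT_comp (measurable_powR _) (measurable_normc2 mf)).
apply/funext => x /=; rewrite powR12_sqrt ?sqr_ge0//.
by rewrite sqrtr_sqr ger0_norm// normc_ge0.
Qed.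

Lemma cmeasurableV f : cmeasurable f -> cmeasurable (fun x => (f x)^-1).
Proof.
move=> mf; under eq_fun do rewrite invcE.
apply: cmeasurableM; first exact: cmeasurable_conj.
apply: cmeasurable_real.
rewrite (_ : (fun x => _) = (@powR R ^~ (-1)) \o (fun x => normc (f x) ^+ 2)).
  exact: (measurableT_comp (measurable_powR _) (measurable_normc2 mf)).
by apply/funext => x /=; rewrite powR_inv1 ?sqr_ge0.
Qed.

Lemma cmeasurable_e2pi : cmeasurable (@e2pi R).
Proof.
split; rewrite /e2pi/=.
  apply: (measurableT_comp (continuous_measurable_fun (@continuous_cos R))).
  exact: mulrl_measurable.
apply: (measurableT_comp (continuous_measurable_fun (@continuous_sin R))).
exact: mulrl_measurable.
Qed.

Lemma cmeasurable_e2pi_comp (h : R -> R) : measurable_fun setT h ->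
  cmeasurable (fun x => e2pi (h x)).
Proof. exact: cmeasurable_comp cmeasurable_e2pi. Qed.

Lemma cmeasurable_sum (I : Type) (r : seq I) (F : I -> R -> R[i]) :
  (forall i, cmeasurable (F i)) -> cmeasurable (fun x => \sum_(i <- r) F i x).
Proof.
move=> mF; elim: r => [|i r IH].
  by under eq_fun do rewrite big_nil; exact: cmeasurable_cst.
by under eq_fun do rewrite big_cons; exact: cmeasurableD.
Qed.

Lemma enormc_ge0 z : (0 <= (normc z)%:E :> \bar R)%E.
Proof. by rewrite lee_fin normc_ge0. Qed.

Lemma enormc2_ge0 z : (0 <= (normc z ^+ 2)%:E :> \bar R)%E.
Proof. by rewrite lee_fin sqr_ge0. Qed.

End ComplexArith.
#[export] Hint Resolve normc_ge0 enormc_ge0 enormc2_ge0 : core.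

(** * Integrals of complex functions *)
Section ComplexIntegral.
Context {R : realType}.
Local Notation mu := (@lebesgue_measure R).
Implicit Types (D : set R) (f g : R -> R[i]).

Lemma aeS (P Q : R -> Prop) : {ae mu, forall x, P x} ->
  (forall x, P x -> Q x) -> {ae mu, forall x, Q x}.
Proof. by move=> aP PQ; apply: negligibleS aP => x /= nQ /PQ. Qed.

Lemma aeI (P Q : R -> Prop) : {ae mu, forall x, P x} -> {ae mu, forall x, Q x} ->
  {ae mu, forall x, P x /\ Q x}.
Proof.
move=> aP aQ; apply: negligibleS (negligibleU aP aQ) => x /= /not_andP.
by case; [left|right].
Qed.

Lemma aeT (P : R -> Prop) : (forall x, P x) -> {ae mu, forall x, P x}.
Proof.
move=> aP; apply: negligibleS (negligible_set0 _) => x /=; exact.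
Qed.

(** The predicates [memL1] and [memL2] are convertible to the case [D = setT]. *)
Definition L1 D f :=
  cmeasurable f /\ (\int[mu]_(x in D) (normc (f x))%:E < +oo)%E.

Definition L2 D f := cmeasurable f /\ (sqnorm D f < +oo)%E.

Lemma emeasurable_normc D f : cmeasurable f ->
  measurable_fun D (fun x => (normc (f x))%:E).
Proof.
by move=> mf; apply/measurable_EFinP/measurable_funTS; exact: measurable_normc.
Qed.

Lemma emeasurable_normc2 D f : cmeasurable f ->
  measurable_fun D (fun x => (normc (f x) ^+ 2)%:E).
Proof.
by move=> mf; apply/measurable_EFinP/measurable_funTS; exact: measurable_normc2.
Qed.

Lemma L1_Re D f : measurable D -> L1 D f ->
  mu.-integrable D (EFin \o (fun x => complex.Re (f x))).
Proof.
move=> mD [[f1 f2] fi]; apply/integrableP; split.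
  by apply/measurable_EFinP; exact: measurable_funTS.
apply: le_lt_trans fi; apply: ge0_le_integral => //.
- do 2 (apply: measurableT_comp => //).
  by apply: measurable_funTS.
- exact: emeasurable_normc.
- by move=> x _ /=; rewrite lee_fin Re_le_normc.
Qed.

Lemma L1_Im D f : measurable D -> L1 D f ->
  mu.-integrable D (EFin \o (fun x => complex.Im (f x))).
Proof.
move=> mD [[f1 f2] fi]; apply/integrableP; split.
  by apply/measurable_EFinP; exact: measurable_funTS.
apply: le_lt_trans fi; apply: ge0_le_integral => //.
- do 2 (apply: measurableT_comp => //).
  by apply: measurable_funTS.
- exact: emeasurable_normc.
- by move=> x _ /=; rewrite lee_fin Im_le_normc.
Qed.

Lemma L1_normc D f : measurable D -> L1 D f ->
  mu.-integrable D (fun x => (normc (f x))%:E).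
Proof.
move=> mD [mf fi]; apply/integrableP; split; first exact: emeasurable_normc.
by under eq_integral do rewrite gee0_abs ?lee_fin ?normc_ge0//.
Qed.

Lemma L1_sub D D' f : measurable D -> measurable D' -> D `<=` D' ->
  L1 D' f -> L1 D f.
Proof.
move=> mD mD' DD' [mf fi]; split=> //; apply: le_lt_trans fi.
by apply: ge0_subset_integral => //; exact: emeasurable_normc.
Qed.

Lemma L1D D f g : measurable D -> L1 D f -> L1 D g -> L1 D (fun x => f x + g x).
Proof.
move=> mD [mf fi] [mg gi]; split; first exact: cmeasurableD.
apply: (@le_lt_trans _ _ (\int[mu]_(x in D) ((normc (f x))%:E + (normc (g x))%:E))%E).
  apply: ge0_le_integral => //.
    - by apply: emeasurable_normc; exact: cmeasurableD.
  - by apply: emeasurable_funD; exact: emeasurable_normc.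
  - by move=> x _; rewrite -EFinD lee_fin le_normcD.
rewrite ge0_integralD//; first exact: lte_add_pinfty.
- exact: emeasurable_normc.
- exact: emeasurable_normc.
Qed.

Lemma L1M_bnd D f g (M : R) : measurable D -> L1 D f -> cmeasurable g ->
  (forall x, D x -> normc (g x) <= M) -> L1 D (fun x => g x * f x).
Proof.
move=> mD [mf fi] mg gM; split; first exact: cmeasurableM.
pose K := `|M|.
apply: (@le_lt_trans _ _ (\int[mu]_(x in D) (K%:E * (normc (f x))%:E))%E).
  apply: ge0_le_integral => //.
    - by apply: emeasurable_normc; exact: cmeasurableM.
  - by apply: emeasurable_funM => //; exact: emeasurable_normc.
  - move=> x Dx; rewrite -EFinM lee_fin normcM ler_wpM2r ?normc_ge0//.
    by rewrite (le_trans (gM x Dx))// ler_norm.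
rewrite ge0_integralZl ?lee_fin ?/K//; last exact: emeasurable_normc.
by rewrite lte_mul_pinfty// lee_fin.
Qed.

Lemma L1Z D f (a : R[i]) : measurable D -> L1 D f -> L1 D (fun x => a * f x).
Proof.
by move=> mD fi; apply: (L1M_bnd (M := normc a)) => //; exact: cmeasurable_cst.
Qed.

Lemma L1e2pi D f (h : R -> R) : measurable D -> measurable_fun setT h ->
  L1 D f -> L1 D (fun x => f x * e2pi (h x)).
Proof.
move=> mD mh fi; under eq_fun do rewrite mulrC; apply: (L1M_bnd (M := 1)) => //.
  exact: cmeasurable_e2pi_comp.
by move=> x _; rewrite normc_e2pi.
Qed.

Lemma L1N D f : measurable D -> L1 D f -> L1 D (fun x => - f x).
Proof. by move=> mD; under eq_fun do rewrite -mulN1r; exact: L1Z. Qed.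

Lemma L1B D f g : measurable D -> L1 D f -> L1 D g -> L1 D (fun x => f x - g x).
Proof. by move=> mD fi gi; apply: L1D => //; exact: L1N. Qed.

Lemma L10 D : L1 D (fun _ => 0).
Proof.
split; first exact: cmeasurable_cst.
by rewrite integral0_eq ?ltry// => x _; rewrite normc0.
Qed.

Lemma L1_sum (I : Type) (r : seq I) (F : I -> R -> R[i]) D : measurable D ->
  (forall i, L1 D (F i)) -> L1 D (fun x => \sum_(i <- r) F i x).
Proof.
move=> mD mF; elim: r => [|i r IH].
  by under eq_fun do rewrite big_nil; exact: L10.
by under eq_fun do rewrite big_cons; exact: L1D.
Qed.

Lemma L1_conj D f : L1 D f -> L1 D (fun x => conjc (f x)).
Proof.
move=> [mf fi]; split; first exact: cmeasurable_conj.
by under eq_integral do rewrite normc_conj.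
Qed.

Lemma Re_cintegral D f :
  complex.Re (cintegral D f) = Rintegral mu D (fun x => complex.Re (f x)).
Proof. by []. Qed.
Lemma Im_cintegral D f :
  complex.Im (cintegral D f) = Rintegral mu D (fun x => complex.Im (f x)).
Proof. by []. Qed.

Lemma eq_cintegral D f g : (forall x, D x -> f x = g x) ->
  cintegral D f = cintegral D g.
Proof.
move=> fg; rewrite /cintegral; congr (_ +i* _); apply: eq_Rintegral => x;
  by rewrite inE => /fg ->.
Qed.

Lemma cintegralD D f g : measurable D -> L1 D f -> L1 D g ->
  cintegral D (fun x => f x + g x) = cintegral D f + cintegral D g.
Proof.
move=> mD fi gi; apply: complex_eqP; rewrite ReImE/=.
  under [LHS]eq_Rintegral do rewrite ReD.
  by rewrite RintegralD//; exact: L1_Re.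
under [LHS]eq_Rintegral do rewrite ImD.
by rewrite RintegralD//; exact: L1_Im.
Qed.

Lemma cintegralZ D f (a : R[i]) : measurable D -> L1 D f ->
  cintegral D (fun x => a * f x) = a * cintegral D f.
Proof.
move=> mD fi; have fr := L1_Re mD fi; have fim := L1_Im mD fi.
have iZ (b : R) (h : R -> R) : mu.-integrable D (EFin \o h) ->
    mu.-integrable D (EFin \o (fun x => b * h x)).
  by move=> hi; rewrite (_ : EFin \o _ = fun x => (b%:E * (h x)%:E)%E)//; exact: integrableZl.
apply: complex_eqP; rewrite ReImE !(Re_cintegral, Im_cintegral).
  under [LHS]eq_Rintegral do rewrite Re_mulc.
  by rewrite RintegralB// ?RintegralZl//; exact: iZ.
under [LHS]eq_Rintegral do rewrite Im_mulc.
by rewrite RintegralD// ?RintegralZl//; exact: iZ.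
Qed.

Lemma cintegralN D f : measurable D -> L1 D f ->
  cintegral D (fun x => - f x) = - cintegral D f.
Proof.
move=> mD fi; rewrite -mulN1r -cintegralZ//.
by apply: eq_cintegral => x _; rewrite mulN1r.
Qed.

Lemma cintegralB D f g : measurable D -> L1 D f -> L1 D g ->
  cintegral D (fun x => f x - g x) = cintegral D f - cintegral D g.
Proof. by move=> mD fi gi; rewrite cintegralD ?cintegralN//; exact: L1N. Qed.

Lemma cintegral0 D : cintegral D (fun _ => 0 : R[i]) = 0.
Proof. by apply: complex_eqP; rewrite /= /Rintegral integral0_eq. Qed.

Lemma cintegral_sum (I : Type) (r : seq I) (F : I -> R -> R[i]) D : measurable D ->
  (forall i, L1 D (F i)) ->
  cintegral D (fun x => \sum_(i <- r) F i x) = \sum_(i <- r) cintegral D (F i).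
Proof.
move=> mD mF; elim: r => [|i r IH].
  by under eq_fun do rewrite big_nil; rewrite big_nil cintegral0.
under eq_fun do rewrite big_cons.
by rewrite big_cons cintegralD ?IH//; exact: L1_sum.
Qed.

Lemma cintegral_conj D f : measurable D -> L1 D f ->
  cintegral D (fun x => conjc (f x)) = conjc (cintegral D f).
Proof.
move=> mD fi; have fim := L1_Im mD fi; apply: complex_eqP; rewrite ReImE/=.
  by apply: eq_Rintegral => x _; rewrite Reconj.
under [LHS]eq_Rintegral do rewrite Imconj -mulN1r.
by rewrite RintegralZl// mulN1r.
Qed.

(** Rotating the integral onto the positive axis reduces the bound to the real
    one. *)
Lemma le_normc_cintegral D f : measurable D -> L1 D f ->
  ((normc (cintegral D f))%:E <= \int[mu]_(x in D) (normc (f x))%:E)%E.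
Proof.
move=> mD fi; set z := cintegral D f.
have [->|z0] := eqVneq z 0.
  by rewrite normc0; apply: integral_ge0 => x _; rewrite lee_fin normc_ge0.
have nz : 0 < normc z by rewrite lt_neqAle normc_ge0 eq_sym normc_eq0 z0.
have fi' : L1 D (fun x => conjc z * f x) by exact: L1Z.
have E : (normc z ^+ 2)%:E = (\int[mu]_(x in D) (complex.Re (conjc z * f x))%:E)%E.
  transitivity ((complex.Re (cintegral D (fun x => conjc z * f x)))%:E).
    by rewrite cintegralZ// -/z mulrC mul_conjc.
  rewrite Re_cintegral /Rintegral fineK//.
  by apply: integrable_fin_num => //; exact: (L1_Re mD fi').
have : ((normc z ^+ 2)%:E <= \int[mu]_(x in D) ((normc z)%:E * (normc (f x))%:E))%E.
  rewrite E; apply: le_integral => //.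
  - exact: (L1_Re mD fi').
  - by apply: integrableZl => //; exact: L1_normc.
  move=> x _; rewrite -EFinM lee_fin -(normc_conj z) -normcM.
  by rewrite (le_trans (ler_norm _))// Re_le_normc.
rewrite ge0_integralZl//; last by apply: emeasurable_normc; case: fi.
by rewrite expr2 EFinM lee_pmul2l.
Qed.

Lemma cintegral_ae D f g : measurable D -> cmeasurable f -> cmeasurable g ->
  {ae mu, forall x, D x -> f x = g x} -> cintegral D f = cintegral D g.
Proof.
move=> mD [f1 f2] [g1 g2] fg; rewrite /cintegral /Rintegral; congr (fine _ +i* fine _).
  apply: ae_eq_integral => //; try by apply/measurable_EFinP/measurable_funTS.
  by apply: (aeS fg) => x h /h ->.
apply: ae_eq_integral => //; try by apply/measurable_EFinP/measurable_funTS.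
by apply: (aeS fg) => x h /h ->.
Qed.

Lemma L1_ae D f g : measurable D -> cmeasurable g ->
  {ae mu, forall x, D x -> f x = g x} -> L1 D f -> L1 D g.
Proof.
move=> mD mg fg [mf fi]; split=> //; apply: le_lt_trans fi.
rewrite le_eqVlt; apply/orP; left; apply/eqP; apply: ge0_ae_eq_integral => //.
- exact: emeasurable_normc.
- exact: emeasurable_normc.
- by apply: (aeS fg) => x h /h ->.
Qed.

End ComplexIntegral.

(** * Convergence to zero *)
Section Convergence.
Context {R : realType}.

Lemma cvge0P (T : Type) (F : set_system T) (FF : Filter F) (u : T -> \bar R) :
  (forall p, (0 <= u p)%E) ->
  (u @ F --> 0%E) <-> (forall e : R, 0 < e -> \forall p \near F, (u p < e%:E)%E).
Proof.
move=> u0; split=> [ucv e e0|H].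
  have : nbhs (0%E : \bar R) [set x | (x < e%:E)%E].
    by apply: open_nbhs_nbhs; split; [exact: open_ereal_lt_ereal|rewrite /= lte_fin].
  by move=> /ucv.
apply/fine_cvgP; split.
  apply: filterS (H 1 ltr01) => p up.
  by rewrite ge0_fin_numE// (lt_trans up)// ltry.
apply/cvgrPdist_lt => e e0; near=> p.
have up : (u p < e%:E)%E by near: p; exact: H.
have fp : u p \is a fin_num by rewrite ge0_fin_numE// (lt_trans up)// ltry.
rewrite sub0r normrN /= ger0_norm ?fine_ge0//.
by rewrite -lte_fin fineK.
Unshelve. all: by end_near. Qed.

(** The form in which the quadratic triangle inequality [sqnormD_le2] is passed to
    limits. *)
Lemma cvge0_lin (T : Type) (F : set_system T) (FF : Filter F)
    (u v w : T -> \bar R) (a b : R) :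
  (forall p, 0 <= u p)%E -> (forall p, 0 <= v p)%E -> (forall p, 0 <= w p)%E ->
  0 <= a -> 0 <= b ->
  (forall p, w p <= a%:E * u p + b%:E * v p)%E ->
  u @ F --> 0%E -> v @ F --> 0%E -> w @ F --> 0%E.
Proof.
move=> u0 v0 w0 a0 b0 wuv /(cvge0P FF u0) cu /(cvge0P FF v0) cv.
apply/cvge0P => // e e0; pose d := e / (a + b + 1).
have ab : 0 < a + b + 1 by rewrite ltr_wpDl// addr_ge0.
have d0 : 0 < d by rewrite divr_gt0.
near=> p.
have up : (u p < d%:E)%E by near: p; exact: cu.
have vp : (v p < d%:E)%E by near: p; exact: cv.
apply: (le_lt_trans (wuv p)).
apply: (@le_lt_trans _ _ ((a * d)%:E + (b * d)%:E)%E).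
  by rewrite !EFinM; apply: leeD; apply: lee_wpmul2l; rewrite ?lee_fin// ltW.
rewrite -EFinD lte_fin -mulrDl /d mulrCA gtr_pMr//.
by rewrite ltr_pdivrMr// mul1r ltrDl.
Unshelve. all: by end_near. Qed.

Lemma cvgr0P (T : Type) (F : set_system T) (FF : Filter F) (u : T -> R) :
  (forall p, 0 <= u p) ->
  (u @ F --> (0 : R)) <-> (forall e : R, 0 < e -> \forall p \near F, u p < e).
Proof.
move=> u0; split=> [/cvgrPdist_lt ucv e e0|H].
  by apply: filterS (ucv e e0) => p; rewrite sub0r normrN ger0_norm.
apply/cvgrPdist_lt => e e0; apply: filterS (H e e0) => p.
by rewrite sub0r normrN ger0_norm.
Qed.

Lemma cvge0_fin (T : Type) (F : set_system T) (FF : Filter F) (u : T -> R) :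
  u @ F --> (0 : R) -> (u p)%:E @[p --> F] --> 0%E.
Proof. by move=> ?; apply: cvg_EFin => //; exact: nearW. Qed.

Lemma cvgcP (T : Type) (F : set_system T) (FF : Filter F) (u : T -> R[i]) (l : R[i]) :
  ((u p : R[i]^o) @[p --> F] --> (l : R[i]^o)) <->
  (forall e : R, 0 < e -> \forall p \near F, normc (u p - l) < e).
Proof.
split=> [/(@cvgrPdist_lt _ R[i]^o) H e e0|H].
  have := H e%:C; rewrite ltcR => /(_ e0); apply: filterS => p.
  by rewrite /= normcB_sym ltcR.
apply/(@cvgrPdist_lt _ R[i]^o) => -[er ei]; rewrite ltcE /= => /andP[/eqP -> er0].
by apply: filterS (H _ er0) => p; rewrite normcB_sym ltcR.
Qed.

End Convergence.

Section DominatedConvergence.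
Context {R : realType}.
Local Notation mu := (@lebesgue_measure R).
Implicit Types (D : set R) (f g : R -> R[i]).

Lemma dct0 D (h_ : nat -> R -> R) (g : R -> R) : measurable D ->
  (forall n, measurable_fun D (h_ n)) ->
  (forall n x, D x -> 0 <= h_ n x) ->
  mu.-integrable D (EFin \o g) ->
  {ae mu, forall x, D x -> h_ ^~ x @ \oo --> (0 : R)} ->
  {ae mu, forall x, D x -> forall n, h_ n x <= g x} ->
  (\int[mu]_(x in D) (h_ n x)%:E)%E @[n --> \oo] --> 0%E.
Proof.
move=> mD mh h0 ig hcv hg.
have := @dominated_convergence _ _ _ mu D mD (fun n x => (h_ n x)%:E) (cst 0%E)
  (EFin \o g).
have mh' n : measurable_fun D (fun x => (h_ n x)%:E) by exact/measurable_EFinP.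
case.
- exact: mh'.
- exact: measurable_cst.
- by apply: (aeS hcv) => x H Dx; apply: cvge0_fin; exact: H.
- by [].
- by apply: (aeS hg) => x H n Dx; rewrite /= lee_fin ger0_norm ?h0//; exact: H.
by move=> _ _; rewrite integral0_eq.
Qed.

Lemma dct_cintegral D (f_ : nat -> R -> R[i]) f (g : R -> R) : measurable D ->
  (forall n, cmeasurable (f_ n)) -> cmeasurable f ->
  mu.-integrable D (EFin \o g) ->
  {ae mu, forall x, D x -> (fun n => normc (f_ n x - f x)) @ \oo --> (0 : R)} ->
  {ae mu, forall x, D x -> forall n, normc (f_ n x) <= g x} ->
  [/\ L1 D f, forall n, L1 D (f_ n) &
    (fun n => normc (cintegral D (f_ n) - cintegral D f)) @ \oo --> (0 : R)].
Proof.
move=> mD mf_ mf ig fcv fg.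
have L1g h : cmeasurable h -> {ae mu, forall x, D x -> normc (h x) <= g x} -> L1 D h.
  move=> mh hg; split => //.
  have /integrableP[mg ] := ig; apply: le_lt_trans.
  apply: ae_ge0_le_integral => //; first exact: emeasurable_normc.
    by apply: measurableT_comp.
  by apply: (aeS hg) => x H Dx /=; rewrite lee_fin (le_trans (H Dx))// ler_norm.
have fgx : {ae mu, forall x, D x -> normc (f x) <= g x}.
  apply: (aeS (aeI fcv fg)) => x [H1 H2] Dx.
  have {}H1 := H1 Dx; have {}H2 := H2 Dx.
  apply/ler_addgt0Pr => e e0.
  have /cvgr0P H3 := H1.
  have [N _ /(_ N (leqnn N)) /= HN] := H3 (fun _ => normc_ge0 _) e e0.
  rewrite (_ : f x = f_ N x - (f_ N x - f x)); last by rewrite opprB addrC subrK.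
  by rewrite (le_trans (le_normcD _ _))// lerD// normcN ltW.
have fi : L1 D f by exact: L1g.
have fi_ n : L1 D (f_ n) by apply: L1g => //; apply: (aeS fg) => x H /H.
split=> //.
have : (\int[mu]_(x in D) (normc (f_ n x - f x))%:E)%E @[n --> \oo] --> 0%E.
  apply: (dct0 (g := fun x => g x + g x)) => //.
  - move=> n; apply: measurable_funTS; apply: measurable_normc.
    by apply: cmeasurableD => //; exact: cmeasurableN.
  - by move=> *; exact: normc_ge0.
  - rewrite (_ : _ \o _ = (EFin \o g) \+ (EFin \o g))%E//; exact: integrableD.
  - apply: (aeS (aeI fgx fg)) => x [H1 H2] Dx n.
    by rewrite (le_trans (le_normcD _ _))// normcN lerD ?H1 ?H2.
move=> /cvge0P - /(_ (fun n => integral_ge0 _ (fun x _ => enormc_ge0 _))) H.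
apply/cvgr0P => [n|e e0]; first exact: normc_ge0.
apply: filterS (H e e0) => n.
rewrite -cintegralB// => Hn; rewrite -lte_fin; apply: le_lt_trans Hn.
by apply: le_normc_cintegral => //; exact: L1B.
Qed.

End DominatedConvergence.

(** * Square-integrable functions *)
Section SquareIntegrable.
Context {R : realType}.
Local Notation mu := (@lebesgue_measure R).
Implicit Types (D : set R) (f g : R -> R[i]).

Lemma sqnorm_ge0 D f : (0 <= sqnorm D f)%E.
Proof. exact: integral_ge0. Qed.

Lemma sqnorm_ae D f g : measurable D -> cmeasurable f -> cmeasurable g ->
  {ae mu, forall x, D x -> f x = g x} -> sqnorm D f = sqnorm D g.
Proof.
move=> mD mf mg fg; apply: ge0_ae_eq_integral => //.
- exact: emeasurable_normc2.
- exact: emeasurable_normc2.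
- by apply: (aeS fg) => x h /h ->.
Qed.

Lemma eq_sqnorm D f g : (forall x, D x -> normc (f x) = normc (g x)) ->
  sqnorm D f = sqnorm D g.
Proof. by move=> fg; apply: eq_integral => x; rewrite inE => /fg ->. Qed.

Lemma sqnorm_le D f g : measurable D -> cmeasurable f -> cmeasurable g ->
  (forall x, D x -> normc (f x) <= normc (g x)) -> (sqnorm D f <= sqnorm D g)%E.
Proof.
move=> mD mf mg fg; apply: ge0_le_integral => //.
- exact: emeasurable_normc2.
- exact: emeasurable_normc2.
- by move=> x /fg ?; rewrite lee_fin ler_pXn2r// nnegrE normc_ge0.
Qed.

Lemma sqnorm0 D : sqnorm D (fun _ => 0 : R[i]) = 0%E.
Proof. by rewrite /sqnorm integral0_eq// => x _; rewrite normc0 expr0n. Qed.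

Lemma sqnorm0_ae D f : measurable D -> cmeasurable f -> sqnorm D f = 0%E ->
  {ae mu, forall x, D x -> f x = 0}.
Proof.
move=> mD mf H.
have /(ae_eq_integral_abs mu mD) : measurable_fun D (fun x => (normc (f x) ^+ 2)%:E).
  exact: emeasurable_normc2.
case=> + _; case; first by rewrite -[RHS]H; apply: eq_integral => x _; rewrite gee0_abs.
move=> N [mN N0 Nsub]; exists N; split => // x /= nf; apply: Nsub => /= h.
apply: nf => Dx; have := h Dx => -[] /eqP; rewrite sqrf_eq0 normc_eq0.
by move/eqP.
Qed.

(** The weighted inequality replaces that of Minkowski: with small [t] the first
    constant is as close to $1$ as desired. *)
Lemma sqnormD_le D f g (t : R) : measurable D -> 0 < t ->
  cmeasurable f -> cmeasurable g ->
  (sqnorm D (fun x => f x + g x)%R <=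
   (1 + t)%:E * sqnorm D f + (1 + t^-1)%:E * sqnorm D g)%E.
Proof.
move=> mD t0 mf mg.
have t1 : 0 <= 1 + t by rewrite addr_ge0// ltW.
have t2 : 0 <= 1 + t^-1 by rewrite addr_ge0// invr_ge0 ltW.
rewrite /sqnorm -ge0_integralZl ?lee_fin//; last exact: emeasurable_normc2.
rewrite -ge0_integralZl ?lee_fin//; last exact: emeasurable_normc2.
rewrite -ge0_integralD//; first last.
- by apply: emeasurable_funM => //; exact: emeasurable_normc2.
- by move=> x _; rewrite -EFinM lee_fin mulr_ge0// sqr_ge0.
- by apply: emeasurable_funM => //; exact: emeasurable_normc2.
- by move=> x _; rewrite -EFinM lee_fin mulr_ge0// sqr_ge0.
apply: ge0_le_integral => //.
- by apply: emeasurable_normc2; exact: cmeasurableD.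
- by apply: emeasurable_funD; apply: emeasurable_funM => //; exact: emeasurable_normc2.
- by move=> x _; rewrite -!EFinM -EFinD lee_fin normc_sqD.
Qed.

Lemma sqnormD_le2 D f g : measurable D -> cmeasurable f -> cmeasurable g ->
  (sqnorm D (fun x => f x + g x)%R <= 2%:E * sqnorm D f + 2%:E * sqnorm D g)%E.
Proof.
move=> mD mf mg; have := sqnormD_le mD ltr01 mf mg.
by rewrite invr1 (_ : 1 + 1 = 2 :> R).
Qed.

Lemma sqnormM_bnd D f g (M : R) : measurable D -> cmeasurable f -> cmeasurable g ->
  (forall x, D x -> normc (g x) ^+ 2 <= M) -> 0 <= M ->
  (sqnorm D (fun x => g x * f x)%R <= M%:E * sqnorm D f)%E.
Proof.
move=> mD mf mg gM M0; rewrite /sqnorm -ge0_integralZl ?lee_fin//; last exact: emeasurable_normc2.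
apply: ge0_le_integral => //.
- by apply: emeasurable_normc2; exact: cmeasurableM.
- by apply: emeasurable_funM => //; exact: emeasurable_normc2.
- by move=> x Dx; rewrite -EFinM lee_fin normcM exprMn ler_wpM2r ?sqr_ge0// gM.
Qed.

Lemma sqnormZ D f (a : R[i]) : measurable D -> cmeasurable f ->
  sqnorm D (fun x => a * f x)%R = ((normc a ^+ 2)%:E * sqnorm D f)%E.
Proof.
move=> mD mf; rewrite /sqnorm -ge0_integralZl//; last exact: emeasurable_normc2.
by apply: eq_integral => x _; rewrite normcM exprMn EFinM.
Qed.

Lemma sqnormN D f : sqnorm D (fun x => - f x)%R = sqnorm D f.
Proof. by apply: eq_sqnorm => x _; rewrite normcN. Qed.

Lemma sqnormB_sym D f g : sqnorm D (fun x => f x - g x)%R = sqnorm D (fun x => g x - f x)%R.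
Proof. by apply: eq_sqnorm => x _; rewrite normcB_sym. Qed.

Lemma cmeasurableB f g : cmeasurable f -> cmeasurable g ->
  cmeasurable (fun x => f x - g x).
Proof. by move=> mf mg; apply: cmeasurableD => //; exact: cmeasurableN. Qed.

Lemma sqnorm_triangle D f g h : measurable D -> cmeasurable f -> cmeasurable g ->
  cmeasurable h ->
  (sqnorm D (fun x => f x - h x)%R <=
   2%:E * sqnorm D (fun x => f x - g x)%R + 2%:E * sqnorm D (fun x => g x - h x)%R)%E.
Proof.
move=> mD mf mg mh.
rewrite (_ : (fun x => f x - h x) = (fun x => (f x - g x) + (g x - h x))); last first.
  by apply/funext => x; rewrite addrA subrK.
by apply: sqnormD_le2 => //; exact: cmeasurableB.
Qed.

Lemma L2D D f g : measurable D -> L2 D f -> L2 D g -> L2 D (fun x => f x + g x).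
Proof.
move=> mD [mf f2] [mg g2]; split; first exact: cmeasurableD.
apply: (le_lt_trans (sqnormD_le2 mD mf mg)).
by rewrite lte_add_pinfty// lte_mul_pinfty// lee_fin.
Qed.

Lemma L2Z D f (a : R[i]) : measurable D -> L2 D f -> L2 D (fun x => a * f x).
Proof.
move=> mD [mf f2]; split; first by apply: cmeasurableM => //; exact: cmeasurable_cst.
by rewrite sqnormZ// lte_mul_pinfty// lee_fin sqr_ge0.
Qed.

Lemma L2N D f : L2 D f -> L2 D (fun x => - f x).
Proof. by move=> [mf f2]; split; [exact: cmeasurableN|rewrite sqnormN]. Qed.

Lemma L2B D f g : measurable D -> L2 D f -> L2 D g -> L2 D (fun x => f x - g x).
Proof. by move=> mD f2 g2; apply: L2D => //; exact: L2N. Qed.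

Lemma L20 D : L2 D (fun _ => 0).
Proof. by split; [exact: cmeasurable_cst|rewrite sqnorm0 ltry]. Qed.

Lemma L2_sum (I : Type) (r : seq I) (F : I -> R -> R[i]) D : measurable D ->
  (forall i, L2 D (F i)) -> L2 D (fun x => \sum_(i <- r) F i x).
Proof.
move=> mD mF; elim: r => [|i r IH].
  by under eq_fun do rewrite big_nil; exact: L20.
by under eq_fun do rewrite big_cons; exact: L2D.
Qed.

Lemma L2M_bnd D f g (M : R) : measurable D -> L2 D f -> cmeasurable g ->
  (forall x, D x -> normc (g x) <= M) -> L2 D (fun x => g x * f x).
Proof.
move=> mD [mf f2] mg gM; split; first exact: cmeasurableM.
apply: (@le_lt_trans _ _ ((M ^+ 2)%:E * sqnorm D f)%E).
  apply: sqnormM_bnd => //; last exact: sqr_ge0.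
  by move=> x Dx; rewrite ler_pXn2r ?nnegrE ?gM// (le_trans _ (gM x Dx)).
by rewrite lte_mul_pinfty// lee_fin sqr_ge0.
Qed.

Lemma L2_e2pi D f (h : R -> R) : measurable D -> measurable_fun setT h ->
  L2 D f -> L2 D (fun x => f x * e2pi (h x)).
Proof.
move=> mD mh fi; under eq_fun do rewrite mulrC; apply: (L2M_bnd (M := 1)) => //.
  exact: cmeasurable_e2pi_comp.
by move=> x _; rewrite normc_e2pi.
Qed.

Lemma L2_ae D f g : measurable D -> cmeasurable g ->
  {ae mu, forall x, D x -> f x = g x} -> L2 D f -> L2 D g.
Proof. by move=> mD mg fg [mf f2]; split=> //; rewrite -(sqnorm_ae mD mf mg fg). Qed.

Lemma L2_conj D f : L2 D f -> L2 D (fun x => conjc (f x)).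
Proof.
move=> [mf f2]; split; first exact: cmeasurable_conj.
by rewrite (eq_sqnorm (g := f))// => x _; rewrite normc_conj.
Qed.

Lemma L2_sqnormE D f : L2 D f -> sqnorm D f = (fine (sqnorm D f))%:E.
Proof. by move=> [mf f2]; rewrite fineK// ge0_fin_numE// sqnorm_ge0. Qed.

Lemma integral_normcM_le D f g (t : R) : measurable D -> 0 < t ->
  cmeasurable f -> cmeasurable g ->
  (2%:E * \int[mu]_(x in D) (normc (f x * g x))%:E <=
     t%:E * sqnorm D f + t^-1%:E * sqnorm D g)%E.
Proof.
move=> mD t0 mf mg.
have t2 : 0 <= t^-1 by rewrite invr_ge0 ltW.
rewrite -ge0_integralZl ?lee_fin//; last by apply: emeasurable_normc; exact: cmeasurableM.
rewrite /sqnorm -ge0_integralZl ?lee_fin ?(ltW t0)//; last exact: emeasurable_normc2.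
rewrite -ge0_integralZl ?lee_fin//; last exact: emeasurable_normc2.
rewrite -ge0_integralD//; first last.
- by apply: emeasurable_funM => //; exact: emeasurable_normc2.
- by move=> x _; rewrite -EFinM lee_fin mulr_ge0// sqr_ge0.
- by apply: emeasurable_funM => //; exact: emeasurable_normc2.
- by move=> x _; rewrite -EFinM lee_fin mulr_ge0 ?sqr_ge0 ?ltW.
apply: ge0_le_integral => //.
- by move=> x _; rewrite -EFinM lee_fin mulr_ge0// normc_ge0.
- by apply: emeasurable_funM => //; apply: emeasurable_normc; exact: cmeasurableM.
- by apply: emeasurable_funD; apply: emeasurable_funM => //; exact: emeasurable_normc2.
- by move=> x _; rewrite -!EFinM -EFinD lee_fin mulr_natl normcM_le.
Qed.

Lemma L2M D f g : measurable D -> L2 D f -> L2 D g -> L1 D (fun x => f x * g x).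
Proof.
move=> mD [mf f2] [mg g2]; split; first exact: cmeasurableM.
have := integral_normcM_le mD ltr01 mf mg; rewrite invr1 !mul1e => H.
rewrite -(@lte_pmul2l _ 2%:E)// mulry gtr0_sg// mul1e.
by apply: (le_lt_trans H); rewrite lte_add_pinfty.
Qed.

(** Cauchy-Schwarz before optimisation in the weight [t]; this avoids square roots of
    the extended real norms. *)
Lemma normc_cintegralM_le D f g (t : R) : measurable D -> 0 < t ->
  L2 D f -> L2 D g ->
  ((2 * normc (cintegral D (fun x => f x * g x)))%:E <=
     t%:E * sqnorm D f + t^-1%:E * sqnorm D g)%E.
Proof.
move=> mD t0 f2 g2; apply: le_trans (integral_normcM_le mD t0 f2.1 g2.1).
by rewrite EFinM lee_pmul2l//; apply: le_normc_cintegral => //; exact: L2M.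
Qed.

Lemma cvg_cintegralM (T : Type) (F : set_system T) (FF : Filter F) D
    (f_ : T -> R -> R[i]) f g : measurable D ->
  (forall p, L2 D (f_ p)) -> L2 D f -> L2 D g ->
  sqnorm D (fun x => f_ p x - f x)%R @[p --> F] --> 0%E ->
  forall e : R, 0 < e -> \forall p \near F,
    normc (cintegral D (fun x => f_ p x * g x) - cintegral D (fun x => f x * g x)) < e.
Proof.
move=> mD f2_ f2 g2 /cvge0P -/(_ (fun p => sqnorm_ge0 _ _)) H e e0.
have [gE g0] : sqnorm D g = (fine (sqnorm D g))%:E /\ 0 <= fine (sqnorm D g).
  by split; [exact: L2_sqnormE|rewrite fine_ge0// sqnorm_ge0].
set G := fine _ in gE g0; pose t := (G + 1) / e.
have t0 : 0 < t by rewrite divr_gt0// ltr_wpDl.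
near=> p.
have Hp : (sqnorm D (fun x => f_ p x - f x)%R < (e / t)%:E)%E.
  by near: p; apply: H; rewrite divr_gt0.
have fi : L2 D (fun x => f_ p x - f x) by apply: L2B.
rewrite -cintegralB//; [|exact: L2M..].
under eq_cintegral do rewrite -mulrBl.
have := normc_cintegralM_le mD t0 fi g2.
rewrite gE (L2_sqnormE fi) -!EFinM -EFinD lee_fin.
move: Hp; rewrite (L2_sqnormE fi) lte_fin; set a := fine _ => Ha.
have : t * a < e by rewrite mulrC -ltr_pdivlMr.
have : t^-1 * G < e.
  rewrite /t invfM invrK -mulrA ltr_pdivrMl ?ltr_wpDl//.
  by rewrite mulrDl mul1r mulrC ltrDl.
by rewrite /=; lra.
Unshelve. all: by end_near. Qed.

Lemma le_scale_limit (a b : R) : 0 <= b ->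
  (forall t, 0 < t -> a <= (1 + t) ^+ 2 * b) -> a <= b.
Proof.
move=> b0 H; apply/ler_addgt0Pr => e e0.
pose t := Num.min 1 (e / (3 * (b + 1))).
have b1 : 0 < 3 * (b + 1) by lra.
have t0 : 0 < t by rewrite lt_min ltr01 divr_gt0.
have t1 : t <= 1 by rewrite ge_min lexx.
have t2 : t * (3 * (b + 1)) <= e by rewrite -ler_pdivlMr// ge_min lexx orbT.
apply: (le_trans (H t t0)); nra.
Qed.

(** In $\|f\|^2 \le (1+t)\|f_p\|^2 + (1+1/t)\|f-f_p\|^2$, and likewise for $g_p$, first
    $p$ goes to the limit and then $t$ to $0$; the constant [K] is therefore preserved. *)
Lemma sqnorm_le_lim (T : Type) (F : set_system T) (FF : ProperFilter F) D D'
    (f_ g_ : T -> R -> R[i]) f g (K : R) : measurable D -> measurable D' -> 0 <= K ->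
  (forall p, cmeasurable (f_ p)) -> cmeasurable f ->
  (forall p, cmeasurable (g_ p)) -> cmeasurable g ->
  sqnorm D (fun x => f_ p x - f x)%R @[p --> F] --> 0%E ->
  sqnorm D' (fun x => g_ p x - g x)%R @[p --> F] --> 0%E ->
  (forall p, sqnorm D (f_ p) <= K%:E * sqnorm D' (g_ p))%E ->
  (sqnorm D f <= K%:E * sqnorm D' g)%E.
Proof.
move=> mD mD' K0 mf_ mf mg_ mg.
move=> /cvge0P -/(_ (fun p => sqnorm_ge0 _ _)) cf.
move=> /cvge0P -/(_ (fun p => sqnorm_ge0 _ _)) cg fg.
have g0 := sqnorm_ge0 D' g.
have [K00|Kn0] := eqVneq K 0.
  rewrite K00 mul0e; apply/lee_addgt0Pr => e e0; rewrite add0e.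
  have [p /= Hp] := filter_ex (cf (e / 2) (divr_gt0 e0 (ltr0n _ 2))).
  rewrite (_ : f = (fun x => f_ p x + (f x - f_ p x))); last first.
    by apply/funext => x; rewrite addrC subrK.
  apply: (le_trans (sqnormD_le2 mD (mf_ p) (cmeasurableB mf (mf_ p)))).
  have -> : sqnorm D (f_ p) = 0%E.
    by apply/eqP; rewrite eq_le sqnorm_ge0 andbT; have := fg p; rewrite K00 mul0e.
  rewrite mule0 add0e sqnormB_sym -lee_pdivlMl// -EFinM mulrC; exact: ltW.
have Kgt : 0 < K by rewrite lt_neqAle eq_sym Kn0 K0.
have [gfin|ginf] := boolP (sqnorm D' g \is a fin_num); last first.
  have -> : sqnorm D' g = +oo%E by move: ginf; rewrite ge0_fin_numE// -leNgt leye_eq => /eqP.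
  by rewrite gt0_muley ?lte_fin// leey.
have bound t e : 0 < t -> 0 < e ->
    (sqnorm D f <= ((1 + t) ^+ 2 * (K * fine (sqnorm D' g)))%:E + e%:E)%E.
  move=> t0 e0; pose c := (1 + t) * K * (1 + t^-1) + (1 + t^-1).
  have ti : 0 < t^-1 by rewrite invr_gt0.
  have c0 : 0 < c by rewrite addr_gt0 ?mulr_gt0 ?addr_gt0.
  have [p /= [Hf Hg]] := filter_ex (filterI (cf _ (divr_gt0 e0 c0)) (cg _ (divr_gt0 e0 c0))).
  rewrite [in leLHS](_ : f = (fun x => f_ p x + (f x - f_ p x))); last first.
    by apply/funext => x; rewrite addrC subrK.
  apply: (le_trans (sqnormD_le mD t0 (mf_ p) (cmeasurableB mf (mf_ p)))).
  have Hgp : (sqnorm D' (g_ p) <= (1 + t)%:E * sqnorm D' g +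
      (1 + t^-1)%:E * sqnorm D' (fun x => g_ p x - g x)%R)%E.
    rewrite [in leLHS](_ : g_ p = (fun x => g x + (g_ p x - g x))); last first.
      by apply/funext => x; rewrite addrC subrK.
    exact: sqnormD_le (cmeasurableB (mg_ p) mg).
  have df : sqnorm D (fun x => f_ p x - f x)%R \is a fin_num.
    by rewrite ge0_fin_numE ?sqnorm_ge0// (lt_trans Hf)// ltry.
  have dg : sqnorm D' (fun x => g_ p x - g x)%R \is a fin_num.
    by rewrite ge0_fin_numE ?sqnorm_ge0// (lt_trans Hg)// ltry.
  rewrite (sqnormB_sym D f).
  move: Hf Hg Hgp; rewrite -(fineK df) -(fineK dg) -(fineK gfin).
  set x := fine _; set y := fine _; set z := fine _; rewrite !lte_fin => Hx Hy Hgp.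
  have {}Hgp : (sqnorm D (f_ p) <= (K * ((1 + t) * z + (1 + t^-1) * y))%:E)%E.
    by apply: (le_trans (fg p)); rewrite EFinM lee_pmul2l ?lte_fin.
  apply: (@le_trans _ _ ((1 + t)%:E * (K * ((1 + t) * z + (1 + t^-1) * y))%:E +
      (1 + t^-1)%:E * x%:E)%E).
    by apply: leeD => //; rewrite lee_pmul2l ?lte_fin ?addr_gt0.
  rewrite -!EFinM -!EFinD lee_fin.
  have {}Hx : (1 + t^-1) * x <= (1 + t^-1) * (e / c) by rewrite ler_pM2l ?addr_gt0// ltW.
  have {}Hy : ((1 + t) * K * (1 + t^-1)) * y <= ((1 + t) * K * (1 + t^-1)) * (e / c).
    by rewrite ler_pM2l ?mulr_gt0 ?addr_gt0// ltW.
  have E : c * (e / c) = e by rewrite mulrC divfK// gt_eqF.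
  have {}E : (1 + t) * K * (1 + t^-1) * (e / c) + (1 + t^-1) * (e / c) = e.
    by rewrite -mulrDl.
  rewrite /=; move: Hx Hy E; set q := e / c; lra.
have fK : sqnorm D f \is a fin_num.
  by rewrite ge0_fin_numE ?sqnorm_ge0// (le_lt_trans (bound 1 1 _ _))// -EFinD ltry.
rewrite -(fineK fK) -(fineK gfin) -EFinM lee_fin; apply: le_scale_limit.
  by rewrite mulr_ge0// fine_ge0.
move=> t t0; apply/ler_addgt0Pr => e e0.
by have := bound t e t0 e0; rewrite -[in X in X -> _](fineK fK) -EFinD lee_fin.
Qed.

End SquareIntegrable.

(** * Polarization and completeness *)
Section Completeness.
Context {R : realType}.
Local Notation mu := (@lebesgue_measure R).
Implicit Types (D : set R) (f g : R -> R[i]).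

Lemma sqnorm_cintegral D f : measurable D -> L2 D f ->
  sqnorm D f = (complex.Re (cintegral D (fun x => f x * conjc (f x))))%:E.
Proof.
move=> mD f2; have fi := L2M mD f2 (L2_conj f2).
rewrite Re_cintegral /Rintegral fineK; last first.
  by apply: integrable_fin_num => //; exact: (L1_Re mD fi).
by apply: eq_integral => x _; rewrite mul_conjc.
Qed.

Lemma Re_inner D f g : measurable D -> L2 D f -> L2 D g ->
  2 * complex.Re (cintegral D (fun x => f x * conjc (g x))) =
  fine (sqnorm D (fun x => f x + g x)) - fine (sqnorm D f) - fine (sqnorm D g).
Proof.
move=> mD f2 g2; have fg2 := L2D mD f2 g2.
rewrite !sqnorm_cintegral//.
have fE (r : R) : fine r%:E = r by [].
rewrite !fE.
have H u v : L2 D u -> L2 D v -> L1 D (fun x => u x * conjc (v x)).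
  by move=> u2 v2; exact: L2M (L2_conj _).
have -> : cintegral D (fun x => (f x + g x) * conjc (f x + g x)) =
    cintegral D (fun x => f x * conjc (f x)) + cintegral D (fun x => f x * conjc (g x))
    + (cintegral D (fun x => g x * conjc (f x)) + cintegral D (fun x => g x * conjc (g x))).
  have i1 := H _ _ f2 f2; have i2 := H _ _ f2 g2.
  have i3 := H _ _ g2 f2; have i4 := H _ _ g2 g2.
  rewrite -(cintegralD mD i1 i2) -(cintegralD mD i3 i4).
  rewrite -(cintegralD mD (L1D mD i1 i2) (L1D mD i3 i4)).
  by apply: eq_cintegral => x _; rewrite rmorphD/= mulrDl !mulrDr.
have -> : cintegral D (fun x => g x * conjc (f x)) =
    conjc (cintegral D (fun x => f x * conjc (g x))).
  rewrite -cintegral_conj//; last exact: H.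
  by apply: eq_cintegral => x _; rewrite rmorphM/= conjcK mulrC.
rewrite !ReImE; ring.
Qed.

(** By polarization the norms determine the inner product, so a norm preserving
    correspondence, even between different domains, preserves it. *)
Lemma inner_polar D D' f g f' g' : measurable D -> measurable D' ->
  L2 D f -> L2 D g -> L2 D' f' -> L2 D' g' ->
  (forall a : R[i], sqnorm D (fun x => f x + a * g x) = sqnorm D' (fun x => f' x + a * g' x)) ->
  sqnorm D f = sqnorm D' f' -> sqnorm D g = sqnorm D' g' ->
  cintegral D (fun x => f x * conjc (g x)) = cintegral D' (fun x => f' x * conjc (g' x)).
Proof.
move=> mD mD' f2 g2 f2' g2' H Hf Hg.
have key (a : R[i]) :
    complex.Re (conjc a * cintegral D (fun x => f x * conjc (g x))) =
    complex.Re (conjc a * cintegral D' (fun x => f' x * conjc (g' x))).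
  rewrite -!cintegralZ//; [|exact: L2M (L2_conj _)..].
  have E : forall (u v : R -> R[i]), (fun x => conjc a * (u x * conjc (v x))) =
      (fun x => u x * conjc (a * v x)).
    by move=> u v; apply/funext => x; rewrite rmorphM/= mulrCA.
  rewrite !E; apply: (@mulfI _ (2 : R)); first by rewrite pnatr_eq0.
  rewrite !Re_inner//; [|exact: L2Z..].
  by rewrite H Hf !sqnormZ ?Hg//; [exact: g2'.1|exact: g2.1].
apply: complex_eqP; first by have := key 1; rewrite conjc1 !mul1r.
by have := key (0 +i* 1); rewrite !ReImE/= !mul0r !sub0r !mulN1r !opprK.
Qed.

(** The limit of those sequences that have one; an arbitrary total choice. *)
Definition clim (u : nat -> R[i]) : R[i] :=
  limn (fun n => complex.Re (u n)) +i* limn (fun n => complex.Im (u n)).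

Lemma cvg_clim (u : nat -> R[i]) :
  cvgn (fun n => complex.Re (u n)) -> cvgn (fun n => complex.Im (u n)) ->
  (fun n => normc (u n - clim u)) @ \oo --> (0 : R).
Proof.
move=> cr ci; apply/cvgr0P => [n|e e0]; first exact: normc_ge0.
have e2 : 0 < e / 2 by rewrite divr_gt0.
move/cvgrPdist_lt : cr => /(_ _ e2) H1; move/cvgrPdist_lt : ci => /(_ _ e2) H2.
near=> n; apply: (le_lt_trans (normc_le_ReIm _)).
rewrite (splitr e) !ReImE distrC [X in _ + X]distrC; apply: ltrD.
  by near: n; exact: H1.
by near: n; exact: H2.
Unshelve. all: by end_near. Qed.

Lemma series_dist_cvg (u : nat -> R) (b : nat -> R) :
  (forall n, `|u n.+1 - u n| <= b n) -> cvgn (series b) -> cvgn u.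
Proof.
move=> ub cb; have : cvgn (series (fun n => u n.+1 - u n)).
  apply: normed_cvg; apply: (series_le_cvg _ _ ub cb) => n; first exact: normr_ge0.
  exact: le_trans (normr_ge0 _) (ub n).
rewrite (_ : series _ = (fun n => u n - u 0%N)); last first.
  by apply/funext => n; rewrite /series/= telescope_sumr.
move=> /cvg_ex[l H]; apply/cvg_ex; exists (l + u 0%N).
suff : (fun n => u n - u 0%N + u 0%N) @ \oo --> l + u 0%N.
  by under eq_fun do rewrite subrK.
exact: cvgD H (cvg_cst _).
Qed.

Lemma nneseries_EFin (b : nat -> R) : cvgn (series b) ->
  (\sum_(0 <= k <oo) (b k)%:E)%E = (limn (series b))%:E.
Proof.
move=> cb; rewrite -EFin_lim//; congr (limn _); apply/funext => n.
by rewrite /series/= sumEFin.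
Qed.

Lemma is_cvg_half_series : cvgn (series (fun k => 2^-1 ^+ k : R)).
Proof.
have := @is_cvg_geometric_series R 1 2^-1.
rewrite (_ : geometric 1 2^-1 = (fun k => 2^-1 ^+ k)).
  by apply; rewrite ger0_norm// invf_lt1// ltr1n.
by apply/funext => k; rewrite /geometric/= mul1r.
Qed.

Lemma cvg_normc2 (u : nat -> R[i]) (l : R[i]) :
  (fun n => normc (u n - l)) @ \oo --> (0 : R) ->
  (fun n => normc (u n) ^+ 2) @ \oo --> normc l ^+ 2.
Proof.
move=> /cvgr0P -/(_ (fun _ => normc_ge0 _)) H.
suff cn : (fun n => normc (u n)) @ \oo --> normc l.
  by under eq_cvg do rewrite expr2; rewrite expr2; exact: cvgM.
apply/cvgrPdist_lt => e e0; apply: filterS (H e e0) => n; apply: le_lt_trans.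
rewrite ler_norml lerBrDr lerBlDr; apply/andP; split.
  rewrite addrC lerBlDr [leRHS]addrC -[in leLHS](subrK l (u n)).
  exact: le_normcD.
by rewrite -[in leLHS](subrK (u n) l) [in leRHS]normcB_sym le_normcD.
Qed.

Lemma sqnorm_fatou D (u : nat -> R -> R[i]) (v : R -> R[i]) (e : \bar R) :
  measurable D -> (forall j, cmeasurable (u j)) ->
  (forall x, (fun j => normc (u j x - v x)) @ \oo --> (0 : R)) ->
  (forall j, sqnorm D (u j) <= e)%E -> (sqnorm D v <= e)%E.
Proof.
move=> mD mu_ cu ue.
have cv x : (fun j => (normc (u j x) ^+ 2)%:E) @ \oo --> (normc (v x) ^+ 2)%:E.
  by apply: cvg_EFin; [exact: nearW|exact: cvg_normc2].
have -> : sqnorm D v = (\int[mu]_(x in D) limn_einf (fun j => (normc (u j x) ^+ 2)%:E))%E.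
  by apply: eq_integral => x _; rewrite (cvg_limn_einf_sup (cv x)).1.
have mh j : measurable_fun D (fun x => (normc (u j x) ^+ 2)%:E) by exact: emeasurable_normc2.
apply: (le_trans (fatou mu mD mh _)) => //.
rewrite limn_einf_lim; apply: lime_le; first exact: is_cvg_einfs.
apply: nearW => n; apply: (le_trans _ (ue n)); apply: ereal_inf_lbound.
by exists n => //=.
Qed.

Lemma cmeasurable_clim (u : nat -> R -> R[i]) : (forall n, cmeasurable (u n)) ->
  (forall x, cvgn (fun n => complex.Re (u n x))) ->
  (forall x, cvgn (fun n => complex.Im (u n x))) ->
  cmeasurable (fun x => clim (u ^~ x)).
Proof.
move=> mu_ cr ci; split.
  by apply: (@measurable_fun_cvg _ _ _ setT (fun n x => complex.Re (u n x))) =>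
    [n|x _]; [case: (mu_ n)|exact: cr].
by apply: (@measurable_fun_cvg _ _ _ setT (fun n x => complex.Im (u n x))) =>
  [n|x _]; [case: (mu_ n)|exact: ci].
Qed.

(** Riesz-Fischer: a subsequence with summable weighted increments converges almost
    everywhere, and Fatou turns this into convergence in norm. The limit depends on the
    values of the sequence at the same point only, through a fixed [Phi]; hence it
    inherits periodicity. *)
Lemma L2_complete D (f_ : nat -> R -> R[i]) : measurable D ->
  (forall n, L2 D (f_ n)) ->
  (forall e : R, 0 < e -> exists N, forall m n, (N <= m)%N -> (N <= n)%N ->
     (sqnorm D (fun x => f_ m x - f_ n x)%R < e%:E)%E) ->
  exists Phi : (nat -> R[i]) -> R[i],
    let f := fun x => Phi (f_ ^~ x) in
    L2 D f /\ sqnorm D (fun x => f_ n x - f x) @[n --> \oo] --> 0%E.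
Proof.
move=> mD f2 cau.
have /choice[N HN] : forall k : nat, exists N, forall m n, (N <= m)%N -> (N <= n)%N ->
    (sqnorm D (fun x => f_ m x - f_ n x)%R < ((2^-1 ^+ k) ^+ 2)%:E)%E.
  by move=> k; apply: cau; rewrite !exprn_gt0// invr_gt0.
pose s k := (\sum_(i < k.+1) (N i).+1)%N.
have sN k : (N k <= s k)%N by rewrite /s big_ord_recr /= (leq_trans (leqnSn _))// leq_addl.
have sk k : (k <= s k)%N.
  by elim: k => // k IH; rewrite /s big_ord_recr/= addnS ltnS (leq_trans IH)// leq_addr.
have sS k : (s k <= s k.+1)%N by rewrite [s k.+1]/s big_ord_recr /= leq_addr.
pose d k x := f_ (s k.+1) x - f_ (s k) x.
pose S x := (\sum_(0 <= k <oo) ((2 ^+ k) * normc (d k x) ^+ 2)%:E)%E.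
have term0 k x : (0 <= ((2 ^+ k) * normc (d k x) ^+ 2)%:E :> \bar R)%E.
  by rewrite lee_fin mulr_ge0 ?sqr_ge0 ?exprn_ge0.
have mf n : cmeasurable (f_ n) by case: (f2 n).
have md k : cmeasurable (d k) by exact: cmeasurableB.
have mterm k : measurable_fun setT (fun x => ((2 ^+ k) * normc (d k x) ^+ 2)%:E).
  apply/measurable_EFinP; apply: measurable_funM => //.
  exact: measurable_normc2.
have mS : measurable_fun setT S.
  by apply: ge0_emeasurable_sum.
pose A := [set x | (S x < +oo)%E].
have mA : measurable A.
  by rewrite /A -[X in measurable X]setTI; exact: emeasurable_fun_infty_o.
pose a x : R[i] := (\1_A x : R)%:C.
have ma : cmeasurable a by apply: cmeasurable_real; exact: measurable_indic.
have geo := is_cvg_half_series.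
(* $2a \le 2^{-k} + 2^ka^2$ makes the increments summable where [S] is finite *)
have bnd k x : normc (d k x) <= 2^-1 ^+ k + 2 ^+ k * normc (d k x) ^+ 2.
  have := @normcM_le R 1 (d k x) (2^-1 ^+ k); rewrite exprn_gt0 ?invr_gt0// => /(_ isT).
  rewrite mul1r normc1 expr1n mulr1 exprVn invrK -mulr_natr.
  have p1 : 0 <= (2 ^+ k)^-1 :> R by rewrite invr_ge0 exprn_ge0.
  have p2 : 0 <= 2 ^+ k * normc (d k x) ^+ 2 by rewrite mulr_ge0 ?sqr_ge0 ?exprn_ge0.
  have := normc_ge0 (d k x); lra.
have cvA x : A x -> cvgn (series (fun k => 2^-1 ^+ k + 2 ^+ k * normc (d k x) ^+ 2)).
  move=> Ax; rewrite seriesD; apply: is_cvgD => //.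
  apply: nondecreasing_is_cvgn.
    apply/nondecreasing_seqP => n; rewrite seriesSr lerDl -lee_fin; exact: term0.
  exists (fine (S x)) => _ [n _ <-].
  rewrite -lee_fin fineK; last by rewrite ge0_fin_numE//; exact: nneseries_ge0.
  rewrite /series/= -sumEFin; exact: nneseries_lim_ge.
pose g n x := a x * f_ (s n) x.
have aE x : (x \in A -> a x = 1) /\ (x \notin A -> a x = 0).
  by rewrite /a indicE; split=> [->|/negbTE ->].
have cg x : cvgn (fun n => complex.Re (g n x)) /\ cvgn (fun n => complex.Im (g n x)).
  have [xA|xA] := boolP (x \in A); last first.
    rewrite /g ((aE x).2 xA); under eq_fun do rewrite mul0r.
    by under [X in _ /\ cvgn X]eq_fun do rewrite mul0r; split; exact: is_cvg_cst.
  rewrite /g ((aE x).1 xA).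
  have Ax : A x by rewrite inE in xA.
  split; apply: (series_dist_cvg _ (cvA x Ax)) => k; rewrite !mul1r.
    by rewrite -ReN -ReD (le_trans (Re_le_normc _))// bnd.
  by rewrite -ImN -ImD (le_trans (Im_le_normc _))// bnd.
pose Phi (u : nat -> R[i]) : R[i] :=
  let b : R[i] := (((\sum_(0 <= k <oo) ((2 ^+ k) * normc (u (s k.+1) - u (s k)) ^+ 2)%:E) < +oo)%E%:R : R)%:C in
  clim (fun n => b * u (s n)).
pose f x := Phi (f_ ^~ x).
have fE x : f x = clim (g ^~ x).
  rewrite /f /Phi /g; congr clim; apply/funext => n; congr (_ * _).
  rewrite /a indicE; congr (_ %:C); congr (_ %:R); congr nat_of_bool.
  by apply/idP/idP; rewrite inE.
have mff : cmeasurable f.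
  rewrite (_ : f = fun x => clim (g ^~ x)); last exact/funext.
  apply: cmeasurable_clim => [n|x|x]; [exact: cmeasurableM|exact: (cg x).1|exact: (cg x).2].
have fA x : A x -> (fun n => normc (f_ (s n) x - f x)) @ \oo --> (0 : R).
  move=> Ax; rewrite fE; have := cvg_clim (cg x).1 (cg x).2.
  by rewrite /g ((aE x).1 (mem_set Ax)); under eq_fun do rewrite mul1r.
have aeA : {ae mu, forall x, D x -> A x}.
  have iS : (\int[mu]_(x in D) S x < +oo)%E.
    have mtD k : measurable_fun D (fun x => ((2 ^+ k) * normc (d k x) ^+ 2)%:E).
      exact: measurable_funTS (mterm k).
    rewrite integral_nneseries//.
    apply: (@le_lt_trans _ _ (\sum_(0 <= k <oo) (2^-1 ^+ k)%:E)%E).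
      apply: lee_nneseries => [k _ _|k _]; first by apply: integral_ge0.
      under eq_integral do rewrite EFinM.
      rewrite ge0_integralZl ?lee_fin ?exprn_ge0//; last exact: emeasurable_normc2.
      rewrite -/(sqnorm D (d k)).
      have := HN k (s k.+1) (s k) (leq_trans (sN k) (sS k)) (sN k).
      move=> /ltW H; apply: (le_trans (lee_wpmul2l _ H)); first by rewrite lee_fin exprn_ge0.
      by rewrite -EFinM lee_fin expr2 mulrA -exprMn mulfV// expr1n mul1r.
    by rewrite nneseries_EFin// ltry.
  have mSD : measurable_fun D S by exact: measurable_funTS.
  have iSD : mu.-integrable D S.
    apply/integrableP; split => //.
    by under eq_integral do rewrite gee0_abs ?nneseries_ge0//.
  have H : {ae mu, forall x, D x -> S x \is a fin_num} by exact: integrable_ae.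
  apply: (aeS H) => x h Dx; have := h Dx.
  by rewrite /A /= ge0_fin_numE// nneseries_ge0.
have subcv (e : R) : 0 < e -> exists2 k, (forall n, (s k <= n)%N ->
    (sqnorm D (fun x => f_ n x - f x)%R <= e%:E)%E) & True.
  move=> e0; have [N0 HN0] := cau e e0.
  exists N0 => // n skn.
  have -> : sqnorm D (fun x => f_ n x - f x) = sqnorm D (fun x => a x * f_ n x - f x).
    apply: sqnorm_ae => //; [exact: cmeasurableB|apply: cmeasurableB => //; exact: cmeasurableM|].
    by apply: (aeS aeA) => x Ax Dx; rewrite ((aE x).1 (mem_set (Ax Dx))) mul1r.
  apply: (sqnorm_fatou (u := fun j x => a x * f_ n x - g (j + N0)%N x)) => //.
  - by move=> j; apply: cmeasurableB; exact: cmeasurableM.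
  - move=> x; have := cvg_clim (cg x).1 (cg x).2; rewrite -fE.
    rewrite -(cvg_shiftn N0) => H.
    rewrite (_ : (fun j => _) = (fun j => normc (g (j + N0)%N x - f x)))//.
    by apply/funext => j; rewrite [RHS]normcB_sym; congr normc; ring.
  - move=> j; rewrite /g; under eq_fun do rewrite -mulrBr.
    have [Nn Nj] : (N0 <= n)%N /\ (N0 <= s (j + N0))%N.
      by split; [exact: leq_trans skn|rewrite (leq_trans _ (sk _))// leq_addl].
    apply: le_trans (ltW (HN0 _ _ Nn Nj)).
    rewrite -[leRHS]mul1e; apply: sqnormM_bnd => //; first exact: cmeasurableB.
    move=> x _; have [xA|xA] := boolP (x \in A).
      by rewrite ((aE x).1 xA) normc1 expr1n.
    by rewrite ((aE x).2 xA) normc0 expr0n.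
exists Phi; split.
  split => //.
  have [k Hk _] := subcv 1 ltr01.
  apply: (@le_lt_trans _ _ (2%:E * sqnorm D (f_ (s k)) + 2%:E * sqnorm D (fun x => f x - f_ (s k) x)%R)%E).
    rewrite -/f [in leLHS](_ : f = (fun x => f_ (s k) x + (f x - f_ (s k) x))); last first.
      by apply/funext => x; rewrite addrC subrK.
    by apply: sqnormD_le2 => //; exact: cmeasurableB.
  rewrite lte_add_pinfty// lte_mul_pinfty// ?(f2 (s k)).2// sqnormB_sym.
  by rewrite (le_lt_trans (Hk _ (leqnn _)))// ltry.
apply/cvge0P => [n|e e0]; first exact: sqnorm_ge0.
have [k Hk _] := subcv (e / 2) (divr_gt0 e0 (ltr0n _ 2)).
exists (s k) => // n /= skn; apply: (le_lt_trans (Hk n skn)).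
by rewrite lte_fin ltr_pdivrMr// mulr_natr mulr2n ltrDl.
Qed.

End Completeness.

(** * Sums over the integers *)
Section IntSums.
Context {R : realType}.
Implicit Types (u v : int -> R[i]) (a : int -> \bar R).

Lemma esum_int a : (forall k, (0 <= a k)%E) ->
  \esum_(k in [set: int]) a k =
  (\sum_(0 <= n <oo) a (Posz n) + \sum_(0 <= n <oo) a (Negz n))%E.
Proof.
move=> a0; rewrite (esumID (range Posz))//; congr (_ + _)%E.
  rewrite setTI esum_image; last by move=> x y _ _ [].
  by rewrite -nneseries_esumT.
rewrite setTI (_ : ~` range Posz = range Negz); last first.
  apply/seteqP; split => -[n|n]; rewrite /setC/=.
  - by case; exists n.
  - by move=> _; exists n.
  - by move=> [m].
  - by move=> _ [m].
rewrite esum_image; last by move=> x y _ _ [].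
by rewrite -nneseries_esumT.
Qed.

Lemma sum_le_esum a (r : seq int) : (forall k, (0 <= a k)%E) -> uniq r ->
  (\sum_(k <- r) a k <= \esum_(k in [set: int]) a k)%E.
Proof.
move=> a0 ur; apply: ereal_sup_ubound; exists [set` r].
  by split => //; exact: finite_seq.
by rewrite -fsbig_seq.
Qed.

Lemma esum_approx a (e : R) : (forall k, (0 <= a k)%E) ->
  (\esum_(k in [set: int]) a k < +oo)%E -> 0 < e ->
  exists2 r : seq int, uniq r &
    (\esum_(k in [set: int]) a k < \sum_(k <- r) a k + e%:E)%E.
Proof.
move=> a0 afin e0.
have fin : \esum_(k in [set: int]) a k \is a fin_num.
  by rewrite ge0_fin_numE// esum_ge0.
have [_ [A [finA _] <-] H] := ub_ereal_sup_adherent e0 fin.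
exists (finmap.enum_fset (fset_set A)); first exact: finmap.fset_uniq.
by rewrite -fsbig_finite// -lteBlDr.
Qed.

(** The indices of [bilateral_psum u p]. *)
Definition bwin (p : nat * nat) : seq int :=
  [seq Negz k | k <- iota 0 p.1] ++ [seq Posz k | k <- iota 0 p.2].

Lemma bilateral_psumE u p : bilateral_psum u p = \sum_(k <- bwin p) u k.
Proof.
rewrite /bwin big_cat !big_map /bilateral_psum /= -(big_mkord xpredT (u \o Negz)).
by rewrite -(big_mkord xpredT (u \o Posz)) /index_iota !subn0.
Qed.

Lemma mem_bwin p (k : int) :
  (k \in bwin p) = match k with Posz n => (n < p.2)%N | Negz n => (n < p.1)%N end.
Proof.
rewrite mem_cat; case: k => n.
  rewrite (mem_map (can_inj (fun n => erefl n : absz (Posz n) = n))) mem_iota add0n /=.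
  by rewrite orbC; case: ltnP => //= _; apply/negP => /mapP[m].
rewrite (@mem_map _ _ Negz) ?mem_iota ?add0n /=; last by move=> x y [].
by case: ltnP => //= _; apply/negP => /mapP[m].
Qed.

Lemma uniq_bwin p : uniq (bwin p).
Proof.
rewrite cat_uniq !map_inj_uniq ?iota_uniq ?andbT/=; [|by move=> x y []..].
by apply/hasPn => _ /mapP[m _ ->]; apply/negP => /mapP[n].
Qed.

Lemma near_bilateral (P : nat * nat -> Prop) (N : nat) :
  (forall p, (N <= p.1)%N -> (N <= p.2)%N -> P p) -> \forall p \near (\oo, \oo), P p.
Proof.
move=> H; exists ([set n | (N <= n)%N], [set n | (N <= n)%N]).
  by split; exists N.
by move=> [m n] /= [? ?]; exact: H.
Qed.

Lemma bilateral_diag (P : nat * nat -> Prop) :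
  (\forall p \near (\oo, \oo), P p) -> \forall n \near \oo, P (n, n).
Proof.
move=> [[A B] [/= [N1 _ H1] [N2 _ H2]] H]; exists (maxn N1 N2) => // n /=.
by rewrite geq_max => /andP[? ?]; apply: H; split; [exact: H1|exact: H2].
Qed.

Lemma seq_sub_bwin (r : seq int) : \forall p \near (\oo, \oo), {subset r <= bwin p}.
Proof.
elim: r => [|k r IH]; first by apply: (near_bilateral (N := 0)).
have Hk : \forall p \near (\oo, \oo), k \in bwin p.
  case: k => n; apply: (near_bilateral (N := n.+1)) => p h1 h2; rewrite mem_bwin//.
apply: filterS (filterI IH Hk) => p [H1 H2] j; rewrite inE => /orP[/eqP -> //|]; exact: H1.
Qed.

(** A finite set that carries all but [e] of the sum is contained in every large
    window. *)
Lemma esum_tail a (e : R) : (forall k, (0 <= a k)%E) ->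
  (\esum_(k in [set: int]) a k < +oo)%E -> 0 < e ->
  \forall p \near (\oo, \oo), forall r : seq int, uniq r ->
    (forall k, k \in r -> k \notin bwin p) -> (\sum_(k <- r) a k < e%:E)%E.
Proof.
move=> a0 afin e0; have [r0 ur0 Hr0] := esum_approx a0 afin e0.
apply: filterS (seq_sub_bwin r0) => p sub r ur rp.
have sum_fin (r' : seq int) : uniq r' -> \sum_(k <- r') a k \is a fin_num.
  move=> ur'; rewrite ge0_fin_numE; first exact: le_lt_trans (sum_le_esum a0 ur') afin.
  by apply: sume_ge0 => k _.
have ucat : uniq (r ++ r0).
  rewrite cat_uniq ur ur0 andbT /=; apply/hasPn => k kr0; apply/negP => /rp.
  by rewrite sub.
have := le_lt_trans (sum_le_esum a0 ucat) Hr0.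
by rewrite big_cat/= addeC lteD2lE// sum_fin.
Qed.

Definition summable_c u := (\esum_(k in [set: int]) (normc (u k))%:E < +oo)%E.

Lemma cvg_series_nneseries (b : nat -> R) : (forall n, 0 <= b n) ->
  (\sum_(0 <= n <oo) (b n)%:E < +oo)%E -> cvgn (series b).
Proof.
move=> b0 bfin; apply: nondecreasing_is_cvgn.
  by apply/nondecreasing_seqP => n; rewrite seriesSr lerDl.
exists (fine (\sum_(0 <= n <oo) (b n)%:E)%E) => _ [n _ <-].
have b0' k : (0 <= (b k)%:E)%E by rewrite lee_fin.
rewrite -lee_fin fineK; last by rewrite ge0_fin_numE//; exact: nneseries_ge0.
by rewrite /series/= -sumEFin; exact: nneseries_lim_ge.
Qed.

Lemma cvg_series_clim (v : nat -> R[i]) :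
  (\sum_(0 <= n <oo) (normc (v n))%:E < +oo)%E ->
  cvgn (fun n => complex.Re (\sum_(k < n) v k)) /\
  cvgn (fun n => complex.Im (\sum_(k < n) v k)).
Proof.
move=> vfin; have cb := cvg_series_nneseries (fun n => normc_ge0 (v n)) vfin.
split; apply: (series_dist_cvg _ cb) => n; rewrite big_ord_recr/=.
  by rewrite ReD addrC addKr Re_le_normc.
by rewrite ImD addrC addKr Im_le_normc.
Qed.

Lemma summable_cvg u : summable_c u -> exists l, bilateral_cvg u l.
Proof.
rewrite /summable_c esum_int// => us.
have pos : (\sum_(0 <= n <oo) (normc (u (Posz n)))%:E < +oo)%E.
  by apply: le_lt_trans us; rewrite leeDl// nneseries_ge0.
have neg : (\sum_(0 <= n <oo) (normc (u (Negz n)))%:E < +oo)%E.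
  by apply: le_lt_trans us; rewrite leeDr// nneseries_ge0.
have [p1 p2] := cvg_series_clim pos.
have [n1 n2] := cvg_series_clim neg.
have /cvgr0P Hp := cvg_clim p1 p2; have /cvgr0P Hn := cvg_clim n1 n2.
exists (clim (fun n => \sum_(k < n) u (Negz k)) + clim (fun n => \sum_(k < n) u (Posz k))).
apply/cvgcP => e e0; have e2 : 0 < e / 2 by rewrite divr_gt0.
have [N1 _ H1] := Hp (fun n => normc_ge0 _) _ e2.
have [N2 _ H2] := Hn (fun n => normc_ge0 _) _ e2.
apply: (near_bilateral (N := maxn N1 N2)) => p.
rewrite !geq_max => /andP[_ h2] /andP[h1 _].
rewrite /bilateral_psum.
set l2 := clim _ in H2; set l1 := clim _ in H1.
rewrite (_ : _ - _ = (\sum_(k < p.1) u (Negz k) - l2) + (\sum_(k < p.2) u (Posz k) - l1)).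
  apply: (le_lt_trans (le_normcD _ _)); rewrite (splitr e) ltrD//.
    exact: H2.
  exact: H1.
by rewrite opprD addrACA.
Qed.

Lemma bilateral_cvgP u l : bilateral_cvg u l <->
  (forall e : R, 0 < e -> \forall p \near (\oo, \oo), normc (bilateral_psum u p - l) < e).
Proof. exact: cvgcP. Qed.

Lemma bilateral_cvg_sum u l : bilateral_cvg u l -> bilateral_sum u = l.
Proof. by move=> ul; apply: (@cvg_lim _ (@norm_hausdorff _ (R[i]^o))). Qed.

Lemma summable_csum u : summable_c u -> bilateral_cvg u (bilateral_sum u).
Proof. by move=> /summable_cvg[l ul]; rewrite (bilateral_cvg_sum ul). Qed.

Lemma bilateral_cvgZ u l (z : R[i]) : bilateral_cvg u l ->
  bilateral_cvg (fun k => z * u k) (z * l).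
Proof.
move=> /bilateral_cvgP ul; apply/bilateral_cvgP => e e0.
have z0 : 0 < normc z + 1 by rewrite ltr_wpDl// normc_ge0.
apply: filterS (ul _ (divr_gt0 e0 z0)) => p; rewrite ltr_pdivlMr// => H.
rewrite (_ : _ - _ = z * (bilateral_psum u p - l)); last first.
  by rewrite mulrBr /bilateral_psum mulrDr !mulr_sumr.
rewrite normcM; apply: le_lt_trans H; rewrite mulrC ler_wpM2l ?normc_ge0//.
by rewrite lerDl.
Qed.

Lemma csumZ u (z : R[i]) : summable_c u ->
  bilateral_sum (fun k => z * u k) = z * bilateral_sum u.
Proof. by move=> us; apply/bilateral_cvg_sum/bilateral_cvgZ/summable_csum. Qed.

Lemma summable_c_le u v : summable_c v -> (forall k, normc (u k) <= normc (v k)) ->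
  summable_c u.
Proof.
by move=> vs uv; apply: le_lt_trans vs; apply: le_esum => k _; rewrite lee_fin.
Qed.

Lemma sum_normc_le_esum u r : uniq r ->
  ((normc (\sum_(k <- r) u k))%:E <= \esum_(k in [set: int]) (normc (u k))%:E)%E.
Proof.
move=> ur; apply: le_trans (sum_le_esum _ ur) => //.
by rewrite sumEFin lee_fin normc_sum.
Qed.

Lemma psum_split u (p q : nat * nat) : (p.1 <= q.1)%N -> (p.2 <= q.2)%N ->
  bilateral_psum u q =
  bilateral_psum u p + \sum_(k <- [seq k <- bwin q | k \notin bwin p]) u k.
Proof.
move=> h1 h2; rewrite !bilateral_psumE big_filter (bigID (mem (bwin p)))/=; congr (_ + _).
rewrite -big_filter; apply: perm_big; apply: uniq_perm.
- by rewrite filter_uniq// uniq_bwin.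
- exact: uniq_bwin.
move=> k; rewrite mem_filter; apply/andP/idP => [[]//|kp]; split=> //.
by move: kp; rewrite !mem_bwin; case: k => n /leq_trans; apply.
Qed.

(** The difference of two partial sums is a sum over indices outside the smaller
    window. *)
Lemma psum_dist u l p (e : R) : bilateral_cvg u l ->
  (forall r : seq int, uniq r -> (forall k, k \in r -> k \notin bwin p) ->
     normc (\sum_(k <- r) u k) <= e) ->
  normc (bilateral_psum u p - l) <= e.
Proof.
move=> /bilateral_cvgP ul He; apply/ler_addgt0Pr => d d0.
have Hp : \forall q \near (\oo, \oo), (p.1 <= q.1)%N /\ (p.2 <= q.2)%N.
  by apply: (near_bilateral (N := maxn p.1 p.2)) => q; rewrite !geq_max => /andP[? _] /andP[_ ?].
have [q [/= H1 [h1 h2]]] := filter_ex (filterI (ul d d0) Hp).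
rewrite (_ : _ - l = - (bilateral_psum u q - bilateral_psum u p) + (bilateral_psum u q - l)); last by ring.
apply: (le_trans (le_normcD _ _)); rewrite normcN lerD ?(ltW H1)//.
rewrite (psum_split _ h1 h2) addrC addKr; apply: He.
  by rewrite filter_uniq// uniq_bwin.
by move=> k; rewrite mem_filter => /andP[].
Qed.

Lemma normc_csum_le u : summable_c u ->
  ((normc (bilateral_sum u))%:E <= \esum_(k in [set: int]) (normc (u k))%:E)%E.
Proof.
move=> us; have fin : \esum_(k in [set: int]) (normc (u k))%:E \is a fin_num.
  by rewrite ge0_fin_numE// esum_ge0.
rewrite -(fineK fin) lee_fin.
have := psum_dist (p := (0%N, 0%N)) (summable_csum us).
rewrite {1}/bilateral_psum !big_ord0 addr0 sub0r normcN; apply => r ur _.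
by rewrite -lee_fin fineK// sum_normc_le_esum.
Qed.

Lemma csum_real (a : int -> R) : (forall k, 0 <= a k) ->
  (\esum_(k in [set: int]) (a k)%:E < +oo)%E ->
  bilateral_sum (fun k => (a k)%:C) = (fine (\esum_(k in [set: int]) (a k)%:E))%:C.
Proof.
move=> a0 afin.
have a0' k : (0 <= (a k)%:E)%E by rewrite lee_fin.
have fin : \esum_(k in [set: int]) (a k)%:E \is a fin_num.
  by rewrite ge0_fin_numE// esum_ge0.
apply: bilateral_cvg_sum; apply/bilateral_cvgP => e e0.
have [r ur Hr] := esum_approx a0' afin e0.
apply: filterS (seq_sub_bwin r) => p rp.
rewrite bilateral_psumE.
have -> : \sum_(k <- bwin p) (a k)%:C = (\sum_(k <- bwin p) a k)%:C by rewrite rmorph_sum.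
rewrite -rmorphB normc_real.
have le1 : \sum_(k <- bwin p) a k <= fine (\esum_(k in [set: int]) (a k)%:E).
  by rewrite -lee_fin fineK// -sumEFin; apply: sum_le_esum => //; exact: uniq_bwin.
rewrite distrC ger0_norm ?subr_ge0// ltrBlDl -lte_fin fineK// EFinD.
apply: (lt_le_trans Hr); rewrite leeD2r// sumEFin lee_fin.
rewrite [leRHS](bigID (mem r))/= -[in leRHS]big_filter.
rewrite (_ : \sum_(k <- r) a k = \sum_(i <- [seq k <- bwin p | k \in r]) a i).
  by rewrite lerDl sumr_ge0.
apply: perm_big; apply: uniq_perm => //; first by rewrite filter_uniq// uniq_bwin.
by move=> k; rewrite mem_filter; case: (boolP (k \in r)) => // /rp ->.
Qed.

Lemma esum_shift a (m : int) :
  \esum_(k in [set: int]) a (k + m) = \esum_(k in [set: int]) a k.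
Proof.
rewrite [RHS](@reindex_esum _ _ _ [set: int] _ (fun k => k + m))//.
split=> //; first by move=> x y _ _ /addIr.
by move=> k _ /=; exists (k - m) => //; rewrite subrK.
Qed.

Lemma esum_opp a :
  \esum_(k in [set: int]) a (- k) = \esum_(k in [set: int]) a k.
Proof.
by rewrite [RHS](@reindex_esum _ _ _ [set: int] _ (fun k => - k)).
Qed.

Lemma sum_CauchySchwarz (c b : int -> R[i]) (r : seq int) (t : R) : 0 < t ->
  2 * normc (\sum_(k <- r) c k * b k) <=
  t * \sum_(k <- r) normc (c k) ^+ 2 + t^-1 * \sum_(k <- r) normc (b k) ^+ 2.
Proof.
move=> t0; apply: (@le_trans _ _ (2 * \sum_(k <- r) normc (c k * b k))).
  by rewrite ler_pM2l// normc_sum.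
rewrite !mulr_sumr -big_split/=; apply: ler_sum => k _.
by rewrite mulr_natl normcM_le.
Qed.

Lemma summable_l2M (c b : int -> R[i]) : memell2 c -> memell2 b ->
  summable_c (fun k => c k * b k).
Proof.
move=> c2 b2; rewrite /summable_c.
apply: (@le_lt_trans _ _ (\esum_(k in [set: int]) ((normc (c k) ^+ 2)%:E + (normc (b k) ^+ 2)%:E))%E).
  apply: le_esum => k _; rewrite -EFinD lee_fin.
  have := @normcM_le R (c k) (b k) 1 ltr01; rewrite invr1 !mul1r mulr2n.
  have := normc_ge0 (c k * b k); lra.
by rewrite esumD// lte_add_pinfty.
Qed.

(** By Cauchy-Schwarz the tail of [c] controls the error for all [b] of norm at most
    [L] at once; this uniformity in [b] is what yields uniform convergence later. *)
Lemma l2M_psum_dist (c : int -> R[i]) (L e : R) : memell2 c -> 0 < e ->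
  \forall p \near (\oo, \oo), forall b : int -> R[i],
    (\esum_(k in [set: int]) (normc (b k) ^+ 2)%:E <= L%:E)%E ->
    normc (bilateral_psum (fun k => c k * b k) p - bilateral_sum (fun k => c k * b k)) <= e.
Proof.
move=> c2 e0; pose t := (`|L| + 1) / e.
have t0 : 0 < t by rewrite divr_gt0// ltr_wpDl.
have := @esum_tail (fun k => (normc (c k) ^+ 2)%:E) (e / t) (fun k => enormc2_ge0 _) c2
  (divr_gt0 e0 t0).
apply: filterS => p Hp b bL; apply: psum_dist => [|r ur rp].
  by apply/summable_csum/summable_l2M => //; exact: le_lt_trans bL (ltry _).
have := Hp r ur rp; rewrite sumEFin lte_fin ltr_pdivlMr// mulrC => h1.
have := sum_le_esum (fun k => enormc2_ge0 (b k)) ur.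
rewrite sumEFin => /le_trans /(_ bL); rewrite lee_fin => h2.
have h3 : t^-1 * \sum_(k <- r) normc (b k) ^+ 2 <= e.
  rewrite /t invfM invrK -mulrA ler_pdivrMl ?ltr_wpDl// mulrC ler_wpM2r ?(ltW e0)//.
  by rewrite (le_trans h2)// (le_trans (ler_norm _))// lerDl.
have := sum_CauchySchwarz c b r t0; lra.
Qed.

End IntSums.

(** * Translations and periodization *)
Section Translation.
Context {R : realType}.
Local Notation mu := (@lebesgue_measure R).
Implicit Types (D : set R) (F : R -> R[i]).

Lemma measurable_shift (c : R) : measurable_fun [set: R] (fun x => x + c).
Proof. by apply: measurable_funD. Qed.

(** The shift as a self-map of the measurable space that carries [mu]. *)
Let sh (c : R) (x : measurableTypeR R) : measurableTypeR R := (x : R) + c.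

Let msh c : measurable_fun [set: measurableTypeR R] (sh c).
Proof. exact: (measurable_shift c). Qed.

Let mushift c : {measure set (measurableTypeR R) -> \bar R} :=
  measure_function_pushforward__canonical__measure_function_Measure mu (msh c).

(** The shifted measure agrees with [mu] on half-open intervals, which determine
    it. *)
Lemma lebesgue_shift (c : R) (A : set R) : measurable A ->
  mu ((fun x => x + c) @^-1` A) = mu A.
Proof.
move=> mA; apply/esym; apply: (@lebesgue_measure_unique R (mushift c)) => // X.
move=> /ocitvP[->|[[a b] /= ab ->]].
  by rewrite !measure0.
rewrite /pushforward (_ : sh c @^-1` _ = `]a - c, b - c]%classic); last first.
  by apply/seteqP; split => x /=; rewrite !in_itv/= /sh ltrBlDr lerBrDr.
rewrite !lebesgue_measure_itv/= !lte_fin ltrD2r; case: ifP => // _.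
by rewrite -!EFinB; congr (_%:E); ring.
Qed.

Lemma ae_shift (P : R -> Prop) (c : R) : {ae mu, forall x, P x} ->
  {ae mu, forall x, P (x + c)}.
Proof.
move=> [N [mN N0 HN]]; exists ((fun x => x + c) @^-1` N); split.
- by rewrite -[X in measurable X]setTI; exact: measurable_shift.
- by rewrite lebesgue_shift.
- by move=> x /= nP; exact: HN.
Qed.

Lemma ge0_integral_shift (f : R -> \bar R) (c : R) : measurable_fun setT f ->
  (forall x, (0 <= f x)%E) -> (\int[mu]_x f (x + c)%R = \int[mu]_x f x)%E.
Proof.
move=> mf f0.
have H : (\int[mushift c]_y f y = \int[mu]_(x in sh c @^-1` setT) (f \o sh c) x)%E.
  exact: (ge0_integral_pushforward (msh c) mu (D := setT)).
rewrite preimage_setT in H; rewrite -H; apply: eq_measure_integral => A mA _.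
exact: lebesgue_shift.
Qed.

Lemma cmeasurable_shift F (c : R) : cmeasurable F -> cmeasurable (fun x => F (x + c)).
Proof. by move=> mF; apply: (cmeasurable_comp mF); exact: measurable_shift. Qed.

Lemma sqnorm_shift F (c : R) : cmeasurable F ->
  sqnorm setT (fun x => F (x + c)) = sqnorm setT F.
Proof.
move=> mF; apply: (ge0_integral_shift (f := fun x => (normc (F x) ^+ 2)%:E)) => //.
exact: emeasurable_normc2.
Qed.

Lemma L1_shift F (c : R) : L1 setT F -> L1 setT (fun x => F (x + c)).
Proof.
move=> [mF F1]; split; first exact: cmeasurable_shift.
rewrite (ge0_integral_shift (f := fun x => (normc (F x))%:E))//.
exact: emeasurable_normc.
Qed.

Lemma L2_shift F (c : R) : L2 setT F -> L2 setT (fun x => F (x + c)).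
Proof. by move=> [mF F2]; split; [exact: cmeasurable_shift|rewrite sqnorm_shift]. Qed.

Lemma cintegral_shift F (c : R) : L1 setT F ->
  cintegral setT (fun x => F (x + c)) = cintegral setT F.
Proof.
move=> F1; have F1' := L1_shift c F1.
have key (h : R -> R) : measurable_fun setT h ->
    mu.-integrable setT (EFin \o (fun x => h (x + c))) ->
    Rintegral mu setT (fun x => h (x + c)) = Rintegral mu setT h.
  move=> mh ih; congr fine.
  have H : (\int[mushift c]_y (h y)%:E = \int[mu]_(x in sh c @^-1` setT) ((EFin \o h) \o sh c) x)%E.
    by apply: (integral_pushforward (msh c) (mu := mu) (D := setT)) => //; exact/measurable_EFinP.
  rewrite preimage_setT in H; rewrite -H; apply: eq_measure_integral => A mA _.
  exact: lebesgue_shift.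
have mT := @measurableT _ (measurableTypeR R).
congr (_ +i* _); apply: key; [by case: F1 => -[]|exact: (L1_Re mT F1')|by case: F1 => -[]|].
exact: (L1_Im mT F1').
Qed.

Lemma ae_int (P : int -> R -> Prop) : (forall k, {ae mu, forall x, P k x}) ->
  {ae mu, forall x, forall k, P k x}.
Proof.
move=> aP.
have H : mu.-negligible (\bigcup_n (~` [set x | P (Posz n) x] `|` ~` [set x | P (Negz n) x])).
  by apply: negligible_bigcup => n; apply: negligibleU; exact: aP.
apply: negligibleS H => x /= /existsNP[[n|n] nP]; exists n => //=; [by left|by right].
Qed.

Lemma floor_bounds (x : R) (k : int) :
  (k%:~R <= x < k%:~R + 1) = (k == Num.floor x).
Proof.
apply/idP/eqP => [H|->].
  apply/esym/floor_def; by rewrite intrD.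
by rewrite ge_floor/= -intrD1 lt_succ_floor.
Qed.

Lemma fracpart_itv (x : R) : `[0, 1]%classic (x - (Num.floor x)%:~R).
Proof.
rewrite /= in_itv/= subr_ge0 ge_floor/= lerBlDl.
by have := floorD1_gt x; rewrite intrD1 addrC => /ltW.
Qed.

Lemma periodic_int (T : Type) (f : R -> T) : (forall x, f (x + 1) = f x) ->
  forall x (k : int), f (x + k%:~R) = f x.
Proof.
move=> f1 x k; have nat_ y n : f (y + n%:R) = f y.
  by elim: n => [|n IH]; [rewrite addr0|rewrite -natr1 addrA f1].
case: k => n; first exact: nat_.
by rewrite NegzE mulrNz -pmulrn -{2}(subrK n.+1%:R x) nat_.
Qed.

(** Countably many translates of a null subset of the unit interval cover the
    exceptional set. *)
Lemma ae_periodic (P : R -> Prop) : (forall x (k : int), P (x + k%:~R) -> P x) ->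
  {ae mu, forall x, `[0, 1]%classic x -> P x} -> {ae mu, forall x, P x}.
Proof.
move=> Pk H.
have : {ae mu, forall x, forall k : int, `[0, 1]%classic (x + k%:~R) -> P (x + k%:~R)}.
  by apply: ae_int => k; exact: (ae_shift k%:~R H).
move=> /aeS; apply => x Hx; apply: (Pk x (- Num.floor x)); apply: Hx.
by rewrite mulrNz; exact: fracpart_itv.
Qed.

Lemma emeasurable_esum_int D (f : int -> R -> \bar R) :
  (forall k, measurable_fun D (f k)) -> (forall k x, (0 <= f k x)%E) ->
  measurable_fun D (fun x => \esum_(k in [set: int]) f k x).
Proof.
move=> mf f0.
rewrite (_ : (fun x => _) = (fun x => (\sum_(0 <= n <oo) f (Posz n) x) +
  (\sum_(0 <= n <oo) f (Negz n) x))%E); last first.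
  by apply/funext => x; rewrite esum_int.
by apply: emeasurable_funD; apply: ge0_emeasurable_sum.
Qed.

Lemma integral_esum_int D (f : int -> R -> \bar R) : measurable D ->
  (forall k, measurable_fun D (f k)) -> (forall k x, (0 <= f k x)%E) ->
  (\int[mu]_(x in D) (\esum_(k in [set: int]) f k x) =
   (\esum_(k in [set: int]) (\int[mu]_(x in D) f k x)%E))%E.
Proof.
move=> mD mf f0.
rewrite [RHS]esum_int; last by move=> k; apply: integral_ge0 => x _; exact: f0.
under eq_integral => x _ do rewrite esum_int//.
have mp : measurable_fun D (fun x => \sum_(0 <= n <oo) f (Posz n) x)%E.
  exact: ge0_emeasurable_sum.
have mn : measurable_fun D (fun x => \sum_(0 <= n <oo) f (Negz n) x)%E.
  exact: ge0_emeasurable_sum.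
rewrite ge0_integralD//; [|by move=> x _; exact: nneseries_ge0..].
by congr (_ + _)%E; apply: integral_nneseries => // n; exact: mf.
Qed.

(** Tonelli for the tiling of the line by the translates of the unit
    interval. *)
Lemma ge0_integral_periodize (f : R -> \bar R) : measurable_fun setT f ->
  (forall x, (0 <= f x)%E) ->
  (\int[mu]_x f x =
   \int[mu]_(x in `[0%R, 1%R]) (\esum_(k in [set: int]) f (x + k%:~R)%R))%E.
Proof.
move=> mf f0.
pose J (k : int) : set R := `[k%:~R, k%:~R + 1[%classic.
have mJ k : measurable (J k) by exact: measurable_itv.
have mfc (c : R) : measurable_fun setT (fun x : R => f (x + c)).
  exact: (measurableT_comp mf (measurable_shift c)).
transitivity (\int[mu]_x (\esum_(k in [set: int]) (f \_ (J k)) x))%E.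
  apply: eq_integral => x _.
  rewrite (_ : \esum_(k in [set: int]) (f \_ (J k)) x =
               \esum_(k in [set Num.floor x]) f x); first by rewrite esum_set1.
  rewrite [RHS]esum_mkcond; apply: eq_esum => k _; rewrite patchE.
  have -> : (x \in J k) = (k \in [set Num.floor x]).
    apply/idP/idP; rewrite !inE /J /= in_itv/= => H.
      by apply/eqP; rewrite -floor_bounds.
    by rewrite floor_bounds; apply/eqP.
  by [].
have mfJ k : measurable_fun setT (f \_ (J k)).
  by apply/(measurable_restrictT _ _).1 => //; exact: measurable_funTS.
rewrite integral_esum_int//; last by move=> k x; rewrite patchE; case: ifP.
rewrite [X in _ = X](_ : _ = \int[mu]_(x in `[0%R, 1%R[)
    (\esum_(k in [set: int]) f (x + k%:~R)%R))%E; last first.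
  apply/esym; apply: integral_itv_bndo_bndc.
  by apply: emeasurable_esum_int => // k; exact: measurable_funTS.
rewrite integral_esum_int//; last by move=> k; exact: measurable_funTS.
apply: eq_esum => k _; rewrite [RHS]integral_mkcond.
rewrite -[LHS](ge0_integral_shift (k%:~R))//; last by move=> x; rewrite patchE; case: ifP.
apply: eq_integral => x _; rewrite !patchE; congr (if _ then _ else _).
by apply/idP/idP; rewrite !inE /J /= !in_itv/= lerDr addrC ltrD2l.
Qed.

End Translation.

Section Periodization.
Context {R : realType}.
Local Notation mu := (@lebesgue_measure R).
Local Notation I := (`[0%R, 1%R]%classic : set R).
Implicit Types (D A : set R) (F u : R -> R[i]).

Lemma mI : measurable I. Proof. exact: measurable_itv. Qed.
Hint Resolve mI : core.
Lemma mTR : measurable [set: R]. Proof. exact: measurableT. Qed.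
Hint Resolve mTR : core.

Definition ind A (x : R) : R[i] := (\1_A x : R)%:C.

Lemma indE A x : ind A x = if x \in A then 1 else 0.
Proof. by rewrite /ind indicE; case: (x \in A). Qed.

Lemma cmeasurable_ind A : measurable A -> cmeasurable (ind A).
Proof. by move=> mA; apply: cmeasurable_real; exact: measurable_indic. Qed.

Lemma normc_ind A x : normc (ind A x) <= 1.
Proof. by rewrite indE; case: ifP; rewrite ?normc1// normc0. Qed.

Lemma cintegral_ind A F : cintegral setT (fun x => ind A x * F x) = cintegral A F.
Proof.
rewrite /cintegral [in RHS]Rintegral_mkcond [X in _ = _ +i* X]Rintegral_mkcond.
congr (_ +i* _); apply: eq_Rintegral => x _; rewrite patchE indE; case: ifP => _;
  by rewrite ?mul1r ?mul0r.
Qed.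

Lemma cintegral_itv_bndo_bndc (a b : R) F : L1 `[a, b]%classic F ->
  cintegral `[a, b[%classic F = cintegral `[a, b]%classic F.
Proof.
move=> F1; have F1' : L1 `[a, b[%classic F.
  by apply: (L1_sub _ _ _ F1) => // x /=; rewrite !in_itv/= => /andP[-> /ltW].
rewrite /cintegral !Rintegral_itv_bndo_bndc//; [exact: L1_Im|exact: L1_Re].
Qed.

Lemma L1M_ind A F D : measurable A -> measurable D -> L1 D F -> L1 D (fun x => ind A x * F x).
Proof.
move=> mA mD F1; apply: (L1M_bnd (M := 1)) => //; first exact: cmeasurable_ind.
by move=> x _; exact: normc_ind.
Qed.

Lemma esumZ (a : int -> \bar R) (M : R) : 0 <= M -> (forall k, (0 <= a k)%E) ->
  \esum_(k in [set: int]) (M%:E * a k)%E = (M%:E * \esum_(k in [set: int]) a k)%E.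
Proof.
move=> M0 a0; have Ma0 k : (0 <= M%:E * a k)%E by rewrite mule_ge0// lee_fin.
rewrite !esum_int// !nneseriesZl//.
by rewrite ge0_muleDr//; exact: nneseries_ge0.
Qed.

Definition abs_per F (x : R) : \bar R :=
  \esum_(k in [set: int]) (normc (F (x + k%:~R)))%:E.

(** The periodization $\sum_kF(x+k)$, set to $0$ where it does not converge absolutely so
    that it is measurable. *)
Definition perz F (x : R) : R[i] :=
  if (abs_per F x < +oo)%E then bilateral_sum (fun k => F (x + k%:~R)) else 0.

Lemma emeasurable_shift_normc F D k : cmeasurable F ->
  measurable_fun D (fun x => (normc (F (x + k%:~R)))%:E).
Proof. by move=> mF; apply: emeasurable_normc; exact: cmeasurable_shift. Qed.

Lemma measurable_abs_per F D : cmeasurable F -> measurable_fun D (abs_per F).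
Proof.
move=> mF; apply: emeasurable_esum_int => // k; exact: emeasurable_shift_normc.
Qed.

Lemma abs_per_ge0 F x : (0 <= abs_per F x)%E.
Proof. exact: esum_ge0. Qed.

Lemma integral_abs_per F : cmeasurable F ->
  (\int[mu]_x (normc (F x))%:E = \int[mu]_(x in I) abs_per F x)%E.
Proof.
move=> mF; apply: (ge0_integral_periodize (f := fun x => (normc (F x))%:E)) => //.
exact: emeasurable_normc.
Qed.

Lemma esum_periodic (a : R -> \bar R) x (k : int) :
  \esum_(j in [set: int]) a (x + k%:~R + j%:~R) =
  \esum_(j in [set: int]) a (x + j%:~R).
Proof.
rewrite -[RHS](esum_shift _ k); apply: eq_esum => j _; congr a.
by rewrite intrD; ring.
Qed.

Lemma abs_per_int F x (k : int) : abs_per F (x + k%:~R) = abs_per F x.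
Proof. exact: (esum_periodic (fun x => (normc (F x))%:E)). Qed.

Lemma abs_per_integrable F : L1 setT F -> mu.-integrable I (abs_per F).
Proof.
move=> [mF F1]; apply/integrableP; split; first exact: measurable_abs_per.
under eq_integral do rewrite gee0_abs ?abs_per_ge0//.
by rewrite -integral_abs_per.
Qed.

Lemma abs_per_lty F : L1 setT F -> {ae mu, forall x, (abs_per F x < +oo)%E}.
Proof.
move=> F1; apply: ae_periodic; first by move=> x k; rewrite abs_per_int.
have iF := abs_per_integrable F1.
have H : {ae mu, forall x, I x -> abs_per F x \is a fin_num} by exact: integrable_ae.
by apply: (aeS H) => x h Ix; have := h Ix; rewrite ge0_fin_numE// abs_per_ge0.
Qed.

Lemma clim_eq (v : nat -> R[i]) (l : R[i]) :
  (fun n => normc (v n - l)) @ \oo --> (0 : R) ->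
  [/\ cvgn (fun n => complex.Re (v n)), cvgn (fun n => complex.Im (v n)) & clim v = l].
Proof.
move=> /cvgr0P -/(_ (fun _ => normc_ge0 _)) H.
have Hr : (fun n => complex.Re (v n)) @ \oo --> complex.Re l.
  apply/cvgrPdist_lt => e e0; apply: filterS (H e e0) => n; apply: le_lt_trans.
  by rewrite normcB_sym -ReN -ReD Re_le_normc.
have Hi : (fun n => complex.Im (v n)) @ \oo --> complex.Im l.
  apply/cvgrPdist_lt => e e0; apply: filterS (H e e0) => n; apply: le_lt_trans.
  by rewrite normcB_sym -ImN -ImD Im_le_normc.
split; [by apply/cvg_ex; exists (complex.Re l)|by apply/cvg_ex; exists (complex.Im l)|].
apply: complex_eqP => /=; exact: cvg_lim.
Qed.

Lemma summable_diag (v : int -> R[i]) : summable_c v ->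
  (fun n => normc (bilateral_psum v (n, n) - bilateral_sum v)) @ \oo --> (0 : R).
Proof.
move=> /summable_csum/bilateral_cvgP H; apply/cvgr0P => [n|e e0]; first exact: normc_ge0.
exact: bilateral_diag (H e e0).
Qed.

Lemma cmeasurable_psum (v : int -> R -> R[i]) p : (forall k, cmeasurable (v k)) ->
  cmeasurable (fun x => bilateral_psum (fun k => v k x) p).
Proof.
move=> mv; under eq_fun do rewrite bilateral_psumE; exact: cmeasurable_sum.
Qed.

Lemma perz_diag F x : (abs_per F x < +oo)%E ->
  (fun n => normc (bilateral_psum (fun k => F (x + k%:~R)) (n, n) - perz F x)) @ \oo --> (0 : R).
Proof. by move=> Fx; rewrite /perz Fx; exact: summable_diag. Qed.

Lemma cmeasurable_perz F : cmeasurable F -> cmeasurable (perz F).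
Proof.
move=> mF; pose A := [set x | (abs_per F x < +oo)%E].
have mA : measurable A.
  rewrite /A -[X in measurable X]setTI; apply: emeasurable_fun_infty_o => //.
  exact: measurable_abs_per.
have H x : (fun n => normc (ind A x * bilateral_psum (fun k => F (x + k%:~R)) (n, n) - perz F x))
    @ \oo --> (0 : R).
  rewrite indE; have [xA|xA] := boolP (x \in A).
    rewrite inE in xA; under eq_fun do rewrite mul1r; exact: perz_diag.
  rewrite /perz; move: xA; rewrite notin_setE /A/= => /negP/negbTE ->.
  by under eq_fun do rewrite mul0r subr0 normc0; exact: cvg_cst.
rewrite (_ : perz F = fun x => clim (fun n => ind A x * bilateral_psum (fun k => F (x + k%:~R)) (n, n))).
  apply: cmeasurable_clim => [n|x|x].
  - apply: cmeasurableM; first exact: cmeasurable_ind.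
    by apply: cmeasurable_psum => k; exact: cmeasurable_shift.
  - by have [] := clim_eq (H x).
  - by have [] := clim_eq (H x).
by apply/funext => x; have [_ _ ->] := clim_eq (H x).
Qed.

Lemma perz_norm_le F x : ((normc (perz F x))%:E <= abs_per F x)%E.
Proof.
rewrite /perz; case: ifP => Fx; last by rewrite normc0 abs_per_ge0.
exact: normc_csum_le.
Qed.

Lemma perzM F u x : (forall y, u (y + 1) = u y) -> (abs_per F x < +oo)%E ->
  perz (fun y => F y * u y) x = perz F x * u x.
Proof.
move=> u1 Fx; have E k : F (x + k%:~R) * u (x + k%:~R) = u x * F (x + k%:~R).
  by rewrite (periodic_int u1) mulrC.
have Fux : (abs_per (fun y => F y * u y)%R x < +oo)%E.
  rewrite /abs_per; under eq_esum do rewrite E normcM EFinM.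
  rewrite esumZ ?normc_ge0//.
  by rewrite lte_mul_pinfty // enormc_ge0.
rewrite /perz Fux Fx; under eq_fun do rewrite E.
by rewrite csumZ// mulrC.
Qed.

Lemma cintegral_tile F k : L1 setT F ->
  cintegral setT (fun x => ind `[k%:~R, k%:~R + 1[%classic x * F x) =
  cintegral I (fun x => F (x + k%:~R)).
Proof.
move=> F1; have F1k := L1_shift k%:~R F1.
rewrite -(@cintegral_shift _ _ k%:~R); last by apply: L1M_ind => //; exact: measurable_itv.
rewrite -cintegral_itv_bndo_bndc; last by apply: (L1_sub _ _ _ F1k).
rewrite -[RHS]cintegral_ind; apply: eq_cintegral => x _; congr (_ * _).
rewrite !indE; congr (if _ then _ else _).
by apply/idP/idP; rewrite !inE /= !in_itv/= lerDr addrC ltrD2l.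
Qed.

(** Both sides are limits of the integral of [F] over a growing union of tiles, by
    dominated convergence on the unit interval and on the line. *)
Lemma perz_cintegral F : L1 setT F ->
  L1 I (perz F) /\ cintegral I (perz F) = cintegral setT F.
Proof.
move=> F1; have [mF _] := F1.
have ae1 := abs_per_lty F1.
have [L1p _ cv1] : [/\ L1 I (perz F),
    forall n, L1 I (fun x => bilateral_psum (fun k => F (x + k%:~R)) (n, n)) &
    (fun n => normc (cintegral I (fun x => bilateral_psum (fun k => F (x + k%:~R)) (n, n))
       - cintegral I (perz F))) @ \oo --> (0 : R)].
  apply: (dct_cintegral (g := fine \o abs_per F)) => //.
  - by move=> n; apply: cmeasurable_psum => k; exact: cmeasurable_shift.
  - exact: cmeasurable_perz.
  - have iF := abs_per_integrable F1.
    apply: (le_integrable _ _ _ iF) => [//||x _ /=].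
      apply/measurable_EFinP; apply: measurableT_comp => //.
      exact: measurable_abs_per.
    rewrite (gee0_abs (abs_per_ge0 F x)) ger0_norm ?fine_ge0 ?abs_per_ge0//.
    have := abs_per_ge0 F x; by case: (abs_per F x) => //= _; exact: leey.
  - by apply: (aeS ae1) => x Fx _; exact: perz_diag.
  - apply: (aeS ae1) => x Fx _ n; rewrite -lee_fin /= fineK; last first.
      by rewrite ge0_fin_numE// abs_per_ge0.
    by rewrite bilateral_psumE sum_normc_le_esum// uniq_bwin.
split=> //.
pose G n x := \sum_(k <- bwin (n, n)) ind `[k%:~R, k%:~R + 1[%classic x * F x.
have mJ (k : int) : measurable (`[k%:~R, k%:~R + 1[%classic : set R) by exact: measurable_itv.
have GE n : cintegral setT (G n) =
    cintegral I (fun x => bilateral_psum (fun k => F (x + k%:~R)) (n, n)).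
  under [RHS]eq_cintegral do rewrite bilateral_psumE.
  rewrite [LHS]cintegral_sum//; last by move=> k; exact: L1M_ind.
  rewrite [RHS]cintegral_sum//; last by move=> k; apply: (L1_sub _ _ _ (L1_shift k%:~R F1)).
  by apply: eq_bigr => k _; exact: cintegral_tile.
have Gx n x : G n x = if Num.floor x \in bwin (n, n) then F x else 0.
  have inJ (k : int) : (x \in `[k%:~R, k%:~R + 1[%classic) = (k == Num.floor x).
    by rewrite -floor_bounds; apply/idP/idP; rewrite inE /= in_itv.
  rewrite /G; under eq_bigr do rewrite indE inJ.
  case: ifP => xn.
    rewrite (bigD1_seq (Num.floor x)) ?uniq_bwin//= eqxx mul1r big1 ?addr0// => k.
    by move=> /negbTE ->; rewrite mul0r.
  rewrite big_seq big1// => k kn; case: eqP => [Ek|_]; last by rewrite mul0r.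
  by rewrite Ek xn in kn.
have [_ _ cv2] : [/\ L1 setT F, forall n, L1 setT (G n) &
    (fun n => normc (cintegral setT (G n) - cintegral setT F)) @ \oo --> (0 : R)].
  apply: (dct_cintegral (g := fun x => normc (F x))) => //.
  - by move=> n; apply: cmeasurable_sum => k; apply: cmeasurableM => //; exact: cmeasurable_ind.
  - exact: (L1_normc mTR F1).
  - apply: aeT => x _; apply/cvgr0P => [n|e e0]; first exact: normc_ge0.
    have := bilateral_diag (seq_sub_bwin [:: Num.floor x]); apply: filterS => n H.
    by rewrite Gx H ?inE// subrr normc0.
  - by apply: aeT => x _ n; rewrite Gx; case: ifP; rewrite // normc0 normc_ge0.
have [_ _ <-] := clim_eq cv1; have [_ _ <-] := clim_eq cv2.
by congr clim; apply/funext => n; rewrite GE.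
Qed.

Lemma measurable_mull (c : R) : measurable_fun [set: R] (fun x => c * x).
Proof. exact: mulrl_measurable. Qed.

Lemma e2pi_periodic (n : int) (w : R) : e2pi (n%:~R * (w + 1)) = e2pi (n%:~R * w).
Proof. by rewrite mulrDr mulr1 e2piD e2pi_int mulr1. Qed.

(** With the sign opposite to that of the exponentials in [is_fourier_series], so that
    [fcoef z] recovers the coefficients of the series [z]. *)
Definition fcoef (H : R -> R[i]) (n : int) : R[i] :=
  cintegral I (fun w => H w * e2pi (n%:~R * w)).

(** Poisson summation: the characters of the circle are periodic, hence factor out of
    the periodization. *)
Lemma perz_coef F n : L1 setT F ->
  fcoef (perz F) n = cintegral setT (fun x => F x * e2pi (n%:~R * x)).
Proof.
move=> F1; have F1n : L1 setT (fun x => F x * e2pi (n%:~R * x)).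
  by apply: L1e2pi => //; exact: measurable_mull.
have [_ <-] := perz_cintegral F1n.
have [mF _] := F1.
have me : cmeasurable (fun x : R => e2pi (n%:~R * x)).
  by apply: cmeasurable_e2pi_comp; exact: measurable_mull.
apply: cintegral_ae => //.
- by apply: cmeasurableM => //; exact: cmeasurable_perz.
- by apply: cmeasurable_perz; exact: cmeasurableM.
- apply: (aeS (abs_per_lty F1)) => x Fx _.
  by rewrite perzM// => y; exact: e2pi_periodic.
Qed.

Lemma sqnorm_periodize F : cmeasurable F -> sqnorm setT F =
  (\int[mu]_(x in I) (\esum_(k in [set: int]) (normc (F (x + k%:~R)) ^+ 2)%:E))%E.
Proof.
move=> mF; apply: (ge0_integral_periodize (f := fun x => (normc (F x) ^+ 2)%:E)) => //.
exact: emeasurable_normc2.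
Qed.

End Periodization.
#[export] Hint Resolve mI mTR : core.

(** * Trigonometric polynomials determine integrable functions *)
Section Trig.
Context {R : realType}.
Local Notation mu := (@lebesgue_measure R).
Local Notation I := (`[0%R, 1%R]%classic : set R).
Implicit Types (P Q : R -> R[i]).

(** Generated by the characters, so that closure under products and conjugates is an
    induction. *)
Inductive trig : (R -> R[i]) -> Prop :=
| trig_char (k : int) (a : R[i]) : trig (fun w => a * e2pi (k%:~R * w))
| trig_add P Q : trig P -> trig Q -> trig (fun w => P w + Q w).

Lemma trig_ext P Q : P =1 Q -> trig P -> trig Q.
Proof. by move=> /funext ->. Qed.

Lemma trigM P Q : trig P -> trig Q -> trig (fun w => P w * Q w).
Proof.
elim=> {P} [k a|P1 P2 _ IH1 _ IH2] tQ; last first.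
  by apply: trig_ext (trig_add (IH1 tQ) (IH2 tQ)) => w; rewrite mulrDl.
elim: tQ => {Q} [j b|Q1 Q2 _ IH1 _ IH2]; last first.
  by apply: trig_ext (trig_add IH1 IH2) => w; rewrite mulrDr.
apply: trig_ext (trig_char (k + j) (a * b)) => w.
by rewrite intrD mulrDl e2piD; ring.
Qed.

Lemma trig_cst (a : R[i]) : trig (fun _ => a).
Proof. by apply: trig_ext (trig_char 0 a) => w; rewrite mul0r e2pi0 mulr1. Qed.

Lemma trig_conj P : trig P -> trig (fun w => conjc (P w)).
Proof.
elim=> {P} [k a|P Q _ IH1 _ IH2]; last first.
  by apply: trig_ext (trig_add IH1 IH2) => w; rewrite rmorphD.
apply: trig_ext (trig_char (- k) (conjc a)) => w.
by rewrite conjcM -e2piN mulrNz mulNr.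
Qed.

Lemma trigX P n : trig P -> trig (fun w => P w ^+ n).
Proof.
move=> tP; elim: n => [|n IH]; first exact: trig_cst.
by apply: trig_ext (trigM tP IH) => w; rewrite exprS.
Qed.

Lemma trigN P : trig P -> trig (fun w => - P w).
Proof. by move=> tP; apply: trig_ext (trigM (trig_cst (-1)) tP) => w; rewrite mulN1r. Qed.

Lemma trig_cmeasurable P : trig P -> cmeasurable P.
Proof.
elim=> {P} [k a|P Q _ IH1 _ IH2]; last exact: cmeasurableD.
apply: cmeasurableM; first exact: cmeasurable_cst.
by apply: cmeasurable_e2pi_comp; exact: measurable_mull.
Qed.

Lemma trig_bounded P : trig P -> exists M, forall w, normc (P w) <= M.
Proof.
elim=> {P} [k a|P Q _ [M HM] _ [N HN]]; last first.
  by exists (M + N) => w; rewrite (le_trans (le_normcD _ _))// lerD.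
by exists (normc a) => w; rewrite normcM normc_e2pi mulr1.
Qed.

Lemma trig_periodic P : trig P -> forall w, P (w + 1) = P w.
Proof.
elim=> {P} [k a w|P Q _ IH1 _ IH2 w]; last by rewrite IH1 IH2.
by rewrite e2pi_periodic.
Qed.

Lemma trig_sum (I : Type) (r : seq I) (F : I -> R -> R[i]) :
  (forall i, trig (F i)) -> trig (fun w => \sum_(i <- r) F i w).
Proof.
move=> tF; elim: r => [|i r IH].
  by apply: trig_ext (trig_cst 0) => w; rewrite big_nil.
by apply: trig_ext (trig_add (tF i) IH) => w; rewrite big_cons.
Qed.

(** Decreasing in the distance of $w$ to $t$ on the circle: its superlevel sets are the
    arcs centered at $t$. *)
Lemma trig_cos2 (t : R) : trig (fun w => (cos (pi * (w - t)) ^+ 2)%:C).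
Proof.
apply: trig_ext (trig_add (trig_cst (2^-1)) (trig_add (trig_char 1 (e2pi (- t) / 4))
  (trig_char (-1) (e2pi t / 4)))) => w.
have E : cos (pi * (w - t)) ^+ 2 = (1 + cos (2 * pi * (w - t))) / 2 :> R.
  have -> : 2 * pi * (w - t) = (pi * (w - t)) *+ 2 by rewrite -mulr_natl; ring.
  by rewrite cos_mulr2n -mulr_natr; field.
rewrite E mulrNz mulNr !mul1r mulrAC -e2piD mulrAC -e2piD.
have -> : t - w = - (- t + w) by ring.
rewrite e2piN.
have -> : (2^-1 : R[i]) = (2^-1 : R)%:C by rewrite rmorphV/= ?rmorph_nat// unitfE pnatr_eq0.
have -> : (4^-1 : R[i]) = (4^-1 : R)%:C by rewrite rmorphV/= ?rmorph_nat// unitfE pnatr_eq0.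
by apply: complex_eqP; rewrite !ReImE/= (addrC (- t)); field.
Qed.

Lemma bernoulli (y : R) n : 0 <= y <= 1 -> 1 - n%:R * y <= (1 - y) ^+ n.
Proof.
move=> /andP[y0 y1]; elim: n => [|n IH]; first by rewrite mul0r subr0 expr0.
rewrite exprS; have h : 0 <= 1 - y by rewrite subr_ge0.
apply: (le_trans _ (ler_wpM2l h IH)).
have n0 : 0 <= n%:R :> R by [].
rewrite -natr1; nra.
Qed.

Lemma bernoulli_inv (y : R) n : 0 <= y <= 1 -> (1 - y) ^+ n * (1 + n%:R * y) <= 1.
Proof.
move=> /andP[y0 y1].
have H : 1 + n%:R * y <= (1 + y) ^+ n.
  elim: n => [|n IH]; first by rewrite mul0r addr0 expr0.
  rewrite exprS; have h : 0 <= 1 + y by rewrite addr_ge0.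
  apply: (le_trans _ (ler_wpM2l h IH)).
  have n0 : 0 <= n%:R :> R by [].
  rewrite -natr1; nra.
have h : 0 <= (1 - y) ^+ n by rewrite exprn_ge0// subr_ge0.
apply: (le_trans (ler_wpM2l h H)); rewrite -exprMn.
by rewrite exprn_ile1//; nra.
Qed.

(** The polynomials in $x$ by which Brosowski and Deutsch prove the Stone-Weierstrass
    theorem: as $n$ grows they tend to $1$ where $lx<1$ and to $0$ where $lx>1$. *)
Definition sep (l x : R) n := (1 - x ^+ n) ^+ Num.truncn (l ^+ n).

Lemma sep_itv (l x : R) n : 0 <= x <= 1 -> 0 <= sep l x n <= 1.
Proof.
move=> /andP[x0 x1]; have h : 0 <= 1 - x ^+ n <= 1.
  by rewrite subr_ge0 exprn_ile1//= gerBl exprn_ge0.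
by case/andP: h => h1 h2; rewrite /sep exprn_ge0//= exprn_ile1.
Qed.

(** Bernoulli: $(1-x^n)^N \ge 1-Nx^n$ with $N \le l^n$. *)
Lemma sep_cvg1 (l x : R) : 1 < l -> 0 <= x <= 1 -> l * x < 1 ->
  sep l x @ \oo --> (1 : R).
Proof.
move=> l1 /andP[x0 x1] lx; have l0 : 0 < l by rewrite (lt_trans _ l1).
have H n : 1 - (l * x) ^+ n <= sep l x n.
  have xn : 0 <= x ^+ n <= 1 by rewrite exprn_ge0//= exprn_ile1.
  apply: (le_trans _ (bernoulli _ xn)); rewrite lerD2l lerN2 exprMn.
  rewrite ler_wpM2r ?exprn_ge0//.
  by have /andP[] := truncn_itv (exprn_ge0 n (ltW l0)).
apply: (@squeeze_cvgr _ _ _ _ (fun n => 1 - (l * x) ^+ n) (fun _ => 1)).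
- by apply: nearW => n; rewrite H/=; have /andP[] := @sep_itv l x n (introT andP (conj x0 x1)).
- rewrite -[X in _ --> X]subr0; apply: cvgB; first exact: cvg_cst.
  by apply: cvg_expr; rewrite ger0_norm// mulr_ge0// ltW.
- exact: cvg_cst.
Qed.

(** Bernoulli again: $(1-x^n)^N(1+Nx^n) \le 1$ and $l^n < N+1$. *)
Lemma sep_cvg0 (l x : R) : 1 < l -> 0 <= x <= 1 -> 1 < l * x ->
  sep l x @ \oo --> (0 : R).
Proof.
move=> l1 /andP[x0 x1] lx; have l0 : 0 < l by rewrite (lt_trans _ l1).
have H n : sep l x n <= ((l * x)^-1) ^+ n.
  have xn : 0 <= x ^+ n <= 1 by rewrite exprn_ge0//= exprn_ile1.
  have := bernoulli_inv (Num.truncn (l ^+ n)) xn; rewrite -/(sep l x n).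
  have /andP[_ Nl] := truncn_itv (exprn_ge0 n (ltW l0)).
  have /andP[s0 s1] := @sep_itv l x n (introT andP (conj x0 x1)).
  move=> Hs; have lxn : 0 < (l * x) ^+ n by rewrite exprn_gt0// (lt_trans _ lx).
  rewrite exprVn -[leRHS]mul1r ler_pdivlMr//; apply: le_trans Hs.
  rewrite ler_wpM2l// exprMn.
  case/andP: xn => xn0 xn1; move: Nl; rewrite -natr1 => Nl.
  by have := ler_wpM2r xn0 (ltW Nl); lra.
apply: (@squeeze_cvgr _ _ _ _ (fun _ => 0) (fun n => ((l * x)^-1) ^+ n)).
- by apply: nearW => n; rewrite H andbT; have /andP[] := @sep_itv l x n (introT andP (conj x0 x1)).
- exact: cvg_cst.
- by apply: cvg_expr; rewrite ger0_norm ?invr_ge0 ?invf_lt1// ?(lt_trans _ lx)// ltW// (lt_trans _ lx).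
Qed.

Lemma sqr_normc_real (x : R) : normc x%:C ^+ 2 = x ^+ 2.
Proof. by rewrite normc_real real_normK// num_real. Qed.

Lemma cos_sep (t r w : R) : 0 < r -> r < t -> r < 1 - t -> I w ->
  let x := cos (pi * (w - t)) ^+ 2 in let c := cos (pi * r) ^+ 2 in
  [/\ 0 < c < 1, `|w - t| < r -> c < x & r < `|w - t| -> x < c].
Proof.
move=> r0 rt rt1; rewrite /= in_itv/= => /andP[w0 w1].
have pi0 := @pi_gt0 R.
have r2 : r < 2^-1 by lra.
have cr0 : 0 < cos (pi * r).
  apply: cos_gt0_pihalf; rewrite (lt_le_trans _ (mulr_ge0 (ltW pi0) (ltW r0))) ?oppr_lt0 ?divr_gt0//=.
  by rewrite ltr_pM2l.
have inpi (u : R) : 0 <= u <= 1 -> pi * u \in `[0, pi].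
  by move=> /andP[u0 u1]; rewrite in_itv/= mulr_ge0 ?(ltW pi0)//= ler_piMr ?(ltW pi0).
have rin : pi * r \in `[0, pi] by apply: inpi; apply/andP; split; lra.
have cN : cos (pi * (w - t)) = cos (pi * `|w - t|).
  by rewrite -[in LHS]cos_norm normrM (gtr0_norm pi0).
have a1 : `|w - t| < 1 - r by rewrite ltr_norml; apply/andP; split; lra.
set a := `|w - t| in cN a1 *.
have a0 : 0 <= a by exact: normr_ge0.
have ain : pi * a \in `[0, pi] by apply: inpi; apply/andP; split; lra.
rewrite cN; split.
- have cr1 : cos (pi * r) < 1.
    rewrite -cos0 ltr_cos ?mulr_gt0// in_itv/= lexx ltW//.
  rewrite exprn_gt0//= expr2 -[ltRHS]mulr1 ltr_pM// ltW//.
- move=> ar; have H : cos (pi * r) < cos (pi * a) by rewrite ltr_cos// ltr_pM2l.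
  by rewrite ltr_pXn2r// nnegrE ltW// (lt_trans cr0).
- move=> ra; have H : cos (pi * a) < cos (pi * r) by rewrite ltr_cos// ltr_pM2l.
  have H2 : - cos (pi * r) < cos (pi * a).
    have -> : - cos (pi * r) = cos (pi * (1 - r)).
      by rewrite mulrBr mulr1 cosB cospi sinpi; ring.
    rewrite ltr_cos ?ltr_pM2l//; apply: inpi; apply/andP; split; lra.
  by nra.
Qed.

(** The squares of $1-\mathrm{sep}(\cos^2(\pi(w-t)))$ are squares of trigonometric
    polynomials with values in $[0,1]$; they tend to the indicator of the arc where the
    cosine exceeds its value at distance $r$. *)
Lemma integral_ball_ge0 (H : R -> R) (t r : R) : measurable_fun setT H ->
  mu.-integrable I (EFin \o H) ->
  (forall P, trig P -> 0 <= Rintegral mu I (fun w => normc (P w) ^+ 2 * H w)) ->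
  0 < r -> r < t -> r < 1 - t ->
  (0 <= \int[mu]_(w in I) (\1_(ball t r) w * H w)%:E)%E.
Proof.
move=> mH iH HP r0 rt rt1.
pose X w : R := cos (pi * (w - t)) ^+ 2.
pose l : R := (cos (pi * r) ^+ 2)^-1.
have X01 w : 0 <= X w <= 1.
  rewrite /X sqr_ge0/=; have := cos_le1 (pi * (w - t)); have := cos_geN1 (pi * (w - t)).
  by move=> ? ?; nra.
have I0 : I 0 by rewrite /= in_itv/= lexx ler01.
have [/andP[c0 c1] _ _] := cos_sep r0 rt rt1 I0.
have l1 : 1 < l by rewrite /l invf_gt1.
pose Q n w := (1 - sep l (X w) n) ^+ 2.
have mX : measurable_fun setT X.
  apply: measurable_funX; apply: (measurableT_comp (continuous_measurable_fun (@continuous_cos R))).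
  by apply: measurable_funM => //; exact: measurable_funB.
have mQ n : measurable_fun setT (Q n).
  apply: measurable_funX; apply: measurable_funB => //; apply: measurable_funX.
  by apply: measurable_funB => //; exact: measurable_funX.
have Q01 n w : 0 <= Q n w <= 1.
  have /andP[s0 s1] := sep_itv l n (X01 w).
  by rewrite /Q sqr_ge0/= expr_le1// ?subr_ge0// gerBl.
have mf n : measurable_fun I (fun w => (Q n w * H w)%:E).
  by apply/measurable_EFinP; apply: measurable_funTS; exact: measurable_funM.
have Qge0 n : (0 <= \int[mu]_(w in I) (Q n w * H w)%:E)%E.
  pose P w : R[i] := 1 + - (1 + - ((X w)%:C ^+ n)) ^+ Num.truncn (l ^+ n).
  have tP : trig P.
    apply: trig_add; first exact: trig_cst.
    apply: trigN; apply: trigX; apply: trig_add; first exact: trig_cst.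
    by apply: trigN; apply: trigX; exact: trig_cos2.
  have PE w : normc (P w) ^+ 2 = Q n w.
    have -> : P w = (1 - sep l (X w) n)%:C.
      by rewrite /P /sep !(rmorphB, rmorphXn, rmorph1).
    exact: sqr_normc_real.
  have := HP P tP; rewrite /Rintegral; under eq_integral do rewrite PE.
  set y := (\int[_]_(_ in _) _)%E; move=> y0.
  have iy : mu.-integrable I (fun w => (Q n w * H w)%:E).
    apply: (le_integrable _ _ _ iH) => //; first exact: mf.
    move=> w _ /=; rewrite lee_fin normrM; have /andP[q0 q1] := Q01 n w.
    by rewrite (ger0_norm q0) ler_piMl.
  have fy : y \is a fin_num by exact: integrable_fin_num.
  by rewrite -/y -(fineK fy) lee_fin.
have bnd : {ae mu, forall w, w != t - r /\ w != t + r}.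
  apply: aeI.
    exists [set t - r]; split => //; first exact: lebesgue_measure_set1.
    by move=> w /= /negP; rewrite negbK => /eqP.
  exists [set t + r]; split => //; first exact: lebesgue_measure_set1.
  by move=> w /= /negP; rewrite negbK => /eqP.
have mb : measurable_fun I (fun w => (\1_(ball t r) w * H w)%:E).
  apply/measurable_EFinP; apply: measurable_funTS; apply: measurable_funM => //.
  by apply: measurable_indic; exact: measurable_ball.
have iabs : mu.-integrable I (EFin \o (fun w => `|H w|)).
  exact: (integrable_abse iH).
have QH : {ae mu, forall w, I w -> (fun n => (Q n w * H w)%:E) @ \oo --> (\1_(ball t r) w * H w)%:E}.
  apply: (aeS bnd) => w [w1 w2] Iw; apply: cvg_EFin; first exact: nearW.
  apply: cvgM; last exact: cvg_cst.
  have [_ Hin Hout] := cos_sep r0 rt rt1 Iw.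
  rewrite indicE; have [wb|wb] := boolP (w \in (ball t r : set R)).
    have lx : 1 < l * X w.
      rewrite /l mulrC ltr_pdivlMr// mul1r; apply: Hin.
      by move: wb; rewrite inE -ball_normE /= distrC.
    have := sep_cvg0 l1 (X01 w) lx => cv.
    rewrite (_ : 1%:R = (1 - 0) ^+ 2 :> R); last by rewrite subr0 expr1n.
    rewrite /Q; under eq_fun do rewrite expr2; rewrite expr2.
    by apply: cvgM; apply: cvgB => //; exact: cvg_cst.
  have lx : l * X w < 1.
    rewrite /l mulrC ltr_pdivrMr// mul1r; apply: Hout.
    move: wb; rewrite notin_setE -ball_normE /= distrC => /negP; rewrite -leNgt le_eqVlt.
    case/orP => // /eqP E; have := w1; have := w2.
    have [ge|lt] := leP 0 (w - t).
      by rewrite E (ger0_norm ge) addrC subrK eqxx.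
    by move=> _; rewrite E (ltr0_norm lt) opprK addrC subrK eqxx.
  have := sep_cvg1 l1 (X01 w) lx => cv.
  rewrite (_ : 0%:R = (1 - 1) ^+ 2 :> R); last by rewrite subrr expr0n.
  rewrite /Q; under eq_fun do rewrite expr2; rewrite expr2.
  by apply: cvgM; apply: cvgB => //; exact: cvg_cst.
have [] := @dominated_convergence _ _ _ mu I (mI (R := R)) (fun n w => (Q n w * H w)%:E)
  (fun w => (\1_(ball t r) w * H w)%:E) (EFin \o (fun w => `|H w|)) mf mb QH iabs.
  apply: aeT => w n _ /=; rewrite lee_fin normrM; have /andP[q0 q1] := Q01 n w.
  by rewrite (ger0_norm q0) ler_piMl.
move=> _ _ cv; rewrite -(cvg_lim _ cv)//; apply: lime_ge; first by apply/cvg_ex; eexists; exact: cv.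
by apply: nearW => n; exact: Qge0.
Qed.

(** The integrals over arcs are nonnegative by [integral_ball_ge0], and almost every
    value of $H$ is the limit of its means over small arcs by Lebesgue differentiation. *)
Lemma trig_positive (H : R -> R) : measurable_fun setT H ->
  mu.-integrable I (EFin \o H) ->
  (forall P, trig P -> 0 <= Rintegral mu I (fun w => normc (P w) ^+ 2 * H w)) ->
  {ae mu, forall w, I w -> 0 <= H w}.
Proof.
move=> mH iH HP; pose H' w := \1_I w * H w.
have mH' : measurable_fun setT H'.
  by apply: measurable_funM => //; exact: measurable_indic.
have iH' : mu.-integrable setT (EFin \o H').
  rewrite (_ : EFin \o H' = (EFin \o H) \_ I); first by move: iH; apply: (integrable_mkcond _ _).1.
  by apply/funext => w; rewrite patchE /H' /= indicE; case: ifP; rewrite ?mul1r ?mul0r.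
have loc : locally_integrable setT H' by exact: (open_integrable_locally openT iH').
have ends : {ae mu, forall w, w != 0 /\ w != 1}.
  apply: aeI.
    exists [set 0]; split => //; first exact: lebesgue_measure_set1.
    by move=> w /= /negP; rewrite negbK => /eqP.
  exists [set 1]; split => //; first exact: lebesgue_measure_set1.
  by move=> w /= /negP; rewrite negbK => /eqP.
have rn0 (n : nat) : 0 < n.+1%:R^-1 :> R by rewrite invr_gt0.
pose rn n : {posnum R} := PosNum (rn0 n).
have rncv : (rn n)%:num @[n --> \oo] --> (0 : R) by exact: cvg_harmonic.
have shr x : nicely_shrinking x (fun n => ball x (rn n)%:num).
  split; first by move=> n; exact: measurable_ball.
  exists (1, rn); split => //=.
  - by move=> n; exact: subset_refl.
  - by move=> n; rewrite mul1e.
apply: (aeS (aeI ends (lebesgue_differentiation loc))) => t [[t0 t1] /= lt].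
rewrite in_itv/= => /andP[t0' t1'].
have {}t0 : 0 < t by rewrite lt_neqAle eq_sym t0 t0'.
have {}t1 : t < 1 by rewrite lt_neqAle t1 t1'.
have cv := nice_lebesgue_differentiation shr loc lt.
rewrite (_ : H t = H' t); last first.
  by rewrite /H' indicE mem_set ?mul1r//= in_itv/= t0' t1'.
rewrite -lee_fin -(cvg_lim _ cv)//; apply: lime_ge; first by apply/cvg_ex; eexists; exact: cv.
have rt : \forall n \near \oo, (rn n)%:num < t.
  by move/cvgr0P : rncv => /(_ (fun n => ge0 (rn n)))/(_ _ t0).
have rt1 : \forall n \near \oo, (rn n)%:num < 1 - t.
  move/cvgr0P : rncv => /(_ (fun n => ge0 (rn n)))/(_ (1 - t)); rewrite subr_gt0; exact.
near=> n.
have r1 : (rn n)%:num < t by near: n.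
have r2 : (rn n)%:num < 1 - t by near: n.
rewrite mule_ge0 ?inve_ge0//.
rewrite [leRHS](_ : _ = (\int[mu]_(w in I) (\1_(ball t (rn n)%:num) w * H w)%:E)%E).
  exact: (integral_ball_ge0 mH iH HP (gt0 (rn n)) r1 r2).
rewrite [LHS]integral_mkcond [RHS]integral_mkcond; apply: eq_integral => w _.
rewrite !patchE /H' !indicE.
by case: (w \in I); case: (w \in (ball t (rn n)%:num : set R)); rewrite ?mul1r ?mul0r.
Unshelve. all: by end_near. Qed.

(** Apply positivity to the real and imaginary parts of $H$ and $-H$. *)
Lemma fcoef_eq0 (H : R -> R[i]) : L1 I H -> (forall n, fcoef H n = 0) ->
  {ae mu, forall w, I w -> H w = 0}.
Proof.
move=> H1 H0; have [[mr mi] _] := H1.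
have PH0 P : trig P -> cintegral I (fun w => P w * H w) = 0.
  elim=> {P} [k a|P Q tP IHP tQ IHQ].
    transitivity (a * fcoef H k); last by rewrite H0 mulr0.
    rewrite -cintegralZ//; last by apply: L1e2pi => //; exact: measurable_mull.
    by apply: eq_cintegral => w _; ring.
  have L1t T : trig T -> L1 I (fun w => T w * H w).
    move=> tT; have [M HM] := trig_bounded tT.
    by apply: (L1M_bnd (M := M)) => //; exact: trig_cmeasurable.
  transitivity (cintegral I (fun w => P w * H w) + cintegral I (fun w => Q w * H w)).
    rewrite -cintegralD//; [|exact: L1t..].
    by apply: eq_cintegral => w _; rewrite mulrDl.
  by rewrite IHP IHQ addr0.
have sq P : trig P -> cintegral I (fun w => (normc (P w) ^+ 2)%:C * H w) = 0.
  move=> tP; have := PH0 _ (trigM tP (trig_conj tP)).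
  by under eq_cintegral do rewrite mul_conjc.
have re P : trig P -> Rintegral mu I (fun w => normc (P w) ^+ 2 * complex.Re (H w)) = 0.
  move=> tP; transitivity (complex.Re (cintegral I (fun w => (normc (P w) ^+ 2)%:C * H w))).
    rewrite Re_cintegral; apply: eq_Rintegral => w _.
    by rewrite Re_mulc /= mul0r subr0.
  by rewrite sq.
have im P : trig P -> Rintegral mu I (fun w => normc (P w) ^+ 2 * complex.Im (H w)) = 0.
  move=> tP; transitivity (complex.Im (cintegral I (fun w => (normc (P w) ^+ 2)%:C * H w))).
    rewrite Im_cintegral; apply: eq_Rintegral => w _.
    by rewrite Im_mulc /= mul0r addr0.
  by rewrite sq.
have key (h : R -> R) : measurable_fun setT h -> mu.-integrable I (EFin \o h) ->
    (forall P, trig P -> Rintegral mu I (fun w => normc (P w) ^+ 2 * h w) = 0) ->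
    {ae mu, forall w, I w -> h w = 0}.
  move=> mh ih hP.
  have p1 : {ae mu, forall w, I w -> 0 <= h w}.
    by apply: trig_positive => // P tP; rewrite hP.
  have p2 : {ae mu, forall w, I w -> 0 <= - h w}.
    apply: trig_positive => [||P tP]; first exact: measurableT_comp.
      rewrite (_ : EFin \o _ = fun w => (- (h w)%:E)%E)//; exact: integrableN.
    have [M HM] := trig_bounded tP.
    under eq_Rintegral do rewrite mulrN -mulN1r.
    rewrite RintegralZl//; first by rewrite hP// mulr0.
    have mP := measurable_normc2 (trig_cmeasurable tP).
    have iM : mu.-integrable I (fun w => ((M ^+ 2)%:E * (h w)%:E)%E) by exact: integrableZl.
    have mph : measurable_fun I (fun w => (normc (P w) ^+ 2 * h w)%:E).
      by apply/measurable_EFinP; apply: measurable_funTS; exact: measurable_funM.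
    apply: (le_integrable _ _ _ iM) => //.
    move=> w _ /=; rewrite lee_fin !normrM ler_wpM2r//.
    have M0 : 0 <= M by exact: le_trans (normc_ge0 _) (HM w).
    rewrite ger0_norm ?normc_ge0//.
    by rewrite ler_pM ?normc_ge0 ?(le_trans (HM w) (ler_norm _)).
  apply: (aeS (aeI p1 p2)) => w [h1 h2] Iw; apply/eqP.
  by rewrite eq_le h1// andbT -oppr_ge0 h2.
have h1 := key _ mr (L1_Re (mI (R := R)) H1) re.
have h2 := key _ mi (L1_Im (mI (R := R)) H1) im.
apply: (aeS (aeI h1 h2)) => w [r0 i0] Iw; apply: complex_eqP; [exact: r0|exact: i0].
Qed.

End Trig.

(** * Fourier series *)
Section Circle.
Context {R : realType}.
Local Notation mu := (@lebesgue_measure R).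
Local Notation I := (`[0%R, 1%R]%classic : set R).
Implicit Types (H z : R -> R[i]) (c : int -> R[i]).

Lemma integral_cos_period (a : R) : a != 0 -> sin a = 0 ->
  Rintegral mu I (fun w => cos (a * w)) = 0.
Proof.
move=> a0 sa; pose F w := a^-1 * sin (a * w).
have dF (w : R) : is_derive w (1 : R) F (cos (a * w)).
  rewrite /F; apply: is_derive_eq; rewrite /GRing.scale/=.
  by rewrite mulr1 mulrC mulfK.
rewrite /Rintegral (@continuous_FTC2 _ _ F)//.
- by rewrite -EFinB /= /F mulr1 mulr0 sa sin0 !mulr0 subrr.
- apply: continuous_subspaceT => w.
  by apply: continuous_comp; [exact: mulrl_continuous|exact: continuous_cos].
- have cF w : {for w, continuous F} by apply/differentiable_continuous/derivable1_diffP; apply: ex_derive.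
  split; first by move=> w _; apply: ex_derive.
    by apply: cvg_at_right_filter; exact: cF.
  by apply: cvg_at_left_filter; exact: cF.
- by move=> w _; rewrite derive1E; apply: derive_val.
Qed.

Lemma integral_sin_period (a : R) : a != 0 -> cos a = 1 ->
  Rintegral mu I (fun w => sin (a * w)) = 0.
Proof.
move=> a0 ca; pose F w := - (a^-1 * cos (a * w)).
have dF (w : R) : is_derive w (1 : R) F (sin (a * w)).
  rewrite /F; apply: is_derive_eq; rewrite /GRing.scale/=.
  by rewrite mulr1 mulrC mulNr mulNr opprK mulfK.
rewrite /Rintegral (@continuous_FTC2 _ _ F)//.
- by rewrite -EFinB /= /F mulr1 mulr0 ca cos0 subrr.
- apply: continuous_subspaceT => w.
  by apply: continuous_comp; [exact: mulrl_continuous|exact: continuous_sin].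
- have cF w : {for w, continuous F} by apply/differentiable_continuous/derivable1_diffP; apply: ex_derive.
  split; first by move=> w _; apply: ex_derive.
    by apply: cvg_at_right_filter; exact: cF.
  by apply: cvg_at_left_filter; exact: cF.
- by move=> w _; rewrite derive1E; apply: derive_val.
Qed.

Lemma lebesgue_I : mu I = 1%E.
Proof. by rewrite lebesgue_measure_itv/= lte01 oppr0 adde0. Qed.

Lemma integral_cst_I (M : R) : (\int[mu]_(w in I) M%:E = M%:E)%E.
Proof.
rewrite integral_cst//; rewrite [X in (_ * X)%E](_ : _ = 1%E) ?mule1//.
exact: lebesgue_I.
Qed.

Lemma cintegral_char (n : int) :
  cintegral I (fun w => e2pi (n%:~R * w)) = if n == 0 then 1 else 0.
Proof.
have [->|n0] := eqVneq n 0.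
  under eq_cintegral do rewrite mul0r e2pi0.
  by rewrite /cintegral /Rintegral !integral_cst_I.
have a0 : 2 * pi * n%:~R != 0 :> R.
  by rewrite !mulf_neq0// ?pnatr_eq0// ?intr_eq0// gt_eqF// pi_gt0.
have E := e2pi_int n : e2pi n%:~R = 1 :> R[i].
apply: complex_eqP; rewrite /=.
  transitivity (Rintegral mu I (fun w => cos ((2 * pi * n%:~R) * w))).
    by apply: eq_Rintegral => w _; rewrite mulrA.
  by apply: integral_cos_period => //; have := congr1 (@complex.Im R) E.
transitivity (Rintegral mu I (fun w => sin ((2 * pi * n%:~R) * w))).
  by apply: eq_Rintegral => w _; rewrite mulrA.
by apply: integral_sin_period => //; have := congr1 (@complex.Re R) E.
Qed.

Definition tpoly c (r : seq int) (w : R) : R[i] :=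
  \sum_(k <- r) c k * e2pi (- (k%:~R * w)).

Lemma trig_tpoly c r : trig (tpoly c r).
Proof.
apply: trig_sum => k; apply: trig_ext (trig_char (- k) (c k)) => w.
by rewrite mulrNz mulNr.
Qed.

Lemma tpolyE c p w : bilateral_psum (fun k => c k * e2pi (- (k%:~R * w))) p = tpoly c (bwin p) w.
Proof. exact: bilateral_psumE. Qed.

Lemma L2_I_L1 H : L2 I H -> L1 I H.
Proof.
move=> H2; have one : L2 I (fun _ => 1 : R[i]).
  split; first exact: cmeasurable_cst.
  rewrite /sqnorm; under eq_integral do rewrite normc1 expr1n.
  by rewrite integral_cst_I ltry.
have := L2M mI H2 one; congr (L1 _ _); apply/funext => w; by rewrite mulr1.
Qed.

Lemma L2_bounded H (M : R) : cmeasurable H -> (forall w, normc (H w) <= M) -> L2 I H.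
Proof.
move=> mH HM; split => //; apply: (@le_lt_trans _ _ (\int[mu]_(w in I) (M ^+ 2)%:E)%E).
  apply: ge0_le_integral => //; first exact: emeasurable_normc2.
  move=> w _; rewrite lee_fin ler_pXn2r// ?nnegrE ?normc_ge0//.
  exact: le_trans (normc_ge0 _) (HM w).
by rewrite integral_cst_I ltry.
Qed.

Lemma L2_trig P : trig P -> L2 I P.
Proof.
move=> tP; have [M HM] := trig_bounded tP.
by apply: (L2_bounded (M := M)) => //; exact: trig_cmeasurable.
Qed.

Lemma L1_fcoef H n : L1 I H -> L1 I (fun w => H w * e2pi (n%:~R * w)).
Proof. by move=> H1; apply: L1e2pi => //; exact: measurable_mull. Qed.

Lemma fcoefB H z n : L1 I H -> L1 I z ->
  fcoef (fun w => H w - z w) n = fcoef H n - fcoef z n.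
Proof.
move=> H1 z1; rewrite /fcoef -cintegralB//; [|exact: L1_fcoef..].
by apply: eq_cintegral => w _; rewrite mulrBl.
Qed.

Lemma fcoef_ae H z n : cmeasurable H -> cmeasurable z ->
  {ae mu, forall w, I w -> H w = z w} -> fcoef H n = fcoef z n.
Proof.
move=> mH mz Hz.
have me : cmeasurable (fun x : R => e2pi (n%:~R * x)).
  by apply: cmeasurable_e2pi_comp; exact: measurable_mull.
apply: cintegral_ae => //; [exact: cmeasurableM..|].
by apply: (aeS Hz) => w h /h ->.
Qed.

Lemma fcoef_tpoly c r k : uniq r -> fcoef (tpoly c r) k = if k \in r then c k else 0.
Proof.
move=> ur; rewrite /fcoef /tpoly.
transitivity (cintegral I (fun w => \sum_(j <- r) c j * e2pi ((k - j)%:~R * w))).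
  apply: eq_cintegral => w _; rewrite mulr_suml; apply: eq_bigr => j _.
  by rewrite -mulrA -e2piD intrB mulrBl addrC.
rewrite cintegral_sum//; last first.
  by move=> j; apply/L2_I_L1/L2_trig; exact: trig_char.
under eq_bigr => j _.
  rewrite cintegralZ//; last first.
    by apply/L2_I_L1/L2_trig; apply: trig_ext (trig_char (k - j) 1) => w; rewrite mul1r.
  rewrite cintegral_char subr_eq0.
  over.
case: ifP => kr.
  rewrite (bigD1_seq k)//= eqxx mulr1 big1 ?addr0// => j jk.
  by rewrite eq_sym (negbTE jk) mulr0.
rewrite big_seq big1// => j jr; case: eqP => [kj|_]; last by rewrite mulr0.
by rewrite kj jr in kr.
Qed.

Lemma cintegral_conj_tpoly H c r : L1 I H ->
  cintegral I (fun w => H w * conjc (tpoly c r w)) =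
  \sum_(k <- r) conjc (c k) * fcoef H k.
Proof.
move=> H1; rewrite /tpoly.
transitivity (cintegral I (fun w => \sum_(k <- r) conjc (c k) * (H w * e2pi (k%:~R * w)))).
  apply: eq_cintegral => w _; rewrite rmorph_sum mulr_sumr; apply: eq_bigr => k _.
  by rewrite -[X in _ * X]/(conjc _) conjcM -e2piN opprK mulrCA.
rewrite cintegral_sum//; last by move=> k; apply: L1Z => //; exact: L1_fcoef.
by apply: eq_bigr => k _; rewrite cintegralZ//; exact: L1_fcoef.
Qed.

Lemma sqnorm_tpoly c r : uniq r ->
  sqnorm I (tpoly c r) = (\sum_(k <- r) normc (c k) ^+ 2)%:E.
Proof.
move=> ur; have t2 := L2_trig (trig_tpoly c r).
rewrite sqnorm_cintegral// cintegral_conj_tpoly//; last exact: L2_I_L1.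
congr (_%:E); rewrite big_seq; under eq_bigr => k kr.
  rewrite fcoef_tpoly// kr mulrC mul_conjc; over.
by rewrite -rmorph_sum/= -big_seq.
Qed.

(** The remainder of [H] is orthogonal to its partial sum. *)
Lemma bessel H r : uniq r -> L2 I H ->
  ((\sum_(k <- r) normc (fcoef H k) ^+ 2)%:E <= sqnorm I H)%E.
Proof.
move=> ur H2; pose S := tpoly (fcoef H) r; have S2 : L2 I S by exact: L2_trig (trig_tpoly _ _).
have H1 := L2_I_L1 H2; have S1 := L2_I_L1 S2.
have D2 : L2 I (fun w => H w - S w) by exact: L2B.
have := Re_inner mI D2 S2.
rewrite cintegral_conj_tpoly//; last exact: L2_I_L1.
rewrite big_seq big1; last first.
  by move=> k kr; rewrite fcoefB// fcoef_tpoly// kr subrr mulr0.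
rewrite mulr0 (_ : (fun w => H w - S w + S w) = H); last by apply/funext => w; rewrite subrK.
move=> /eqP; rewrite eq_sym subr_eq0 => /eqP E.
rewrite -sqnorm_tpoly// -/S (L2_sqnormE H2) (L2_sqnormE S2) lee_fin -E lerBlDr lerDl.
by rewrite fine_ge0// sqnorm_ge0.
Qed.

(** The difference is a trigonometric polynomial with coefficients outside the window,
    of squared norm the sum of their squares. *)
Lemma tpoly_tail c (e : R) : memell2 c -> 0 < e -> \forall p \near (\oo, \oo),
  forall q : nat * nat, (p.1 <= q.1)%N -> (p.2 <= q.2)%N ->
    (sqnorm I (fun w => tpoly c (bwin p) w - tpoly c (bwin q) w)%R < e%:E)%E.
Proof.
move=> c2 e0.
have := esum_tail (fun k => enormc2_ge0 (c k)) c2 e0; apply: filterS => p Hp q h1 h2.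
set r := [seq k <- bwin q | k \notin bwin p].
have ur : uniq r by rewrite filter_uniq// uniq_bwin.
rewrite (eq_sqnorm (g := tpoly c r)); last first.
  move=> w _; rewrite -!tpolyE (psum_split _ h1 h2) opprD addrA subrr add0r normcN.
  by [].
rewrite sqnorm_tpoly// -sumEFin; apply: Hp => // k.
by rewrite mem_filter => /andP[].
Qed.

Lemma lt_quarters (x y : \bar R) (e : R) :
  (x < (e / 4)%:E)%E -> (y < (e / 4)%:E)%E -> (2%:E * x + 2%:E * y < e%:E)%E.
Proof.
move=> hx hy; have -> : e%:E = (2%:E * (e / 4)%:E + 2%:E * (e / 4)%:E)%E.
  by rewrite -!EFinM -EFinD; congr (_%:E); field.
by apply: lteD; rewrite lte_pmul2l.
Qed.

(** The partial sums are Cauchy by [tpoly_tail]. The limit is taken along the diagonal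
    and shared by all windows; its form [Phi] makes it periodic. *)
Lemma fourier_series_exists c : memell2 c -> exists z, is_fourier_series c z.
Proof.
move=> c2; pose f_ n := tpoly c (bwin (n, n)).
have f2 n : L2 I (f_ n) by exact: L2_trig (trig_tpoly _ _).
have mf n : cmeasurable (f_ n) by exact: (f2 n).1.
have cau (e : R) : 0 < e -> exists N, forall m n, (N <= m)%N -> (N <= n)%N ->
    (sqnorm I (fun w => f_ m w - f_ n w)%R < e%:E)%E.
  move=> e0; have e4 : 0 < e / 4 by rewrite divr_gt0.
  have [N _ /(_ N (leqnn N)) HN] := bilateral_diag (tpoly_tail c2 e4).
  exists N => m n Nm Nn.
  apply: (le_lt_trans (sqnorm_triangle mI (mf m) (mf N) (mf n))).
  have h1 := HN (m, m) Nm Nm; have h2 := HN (n, n) Nn Nn.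
  rewrite (sqnormB_sym _ (f_ m)).
  exact: lt_quarters.
have [Phi [z2 zcv]] := L2_complete mI f2 cau.
set z := fun w => Phi (f_ ^~ w) in z2 zcv.
exists z; split; first exact: z2.1.
  move=> w; rewrite /z; congr Phi; apply/funext => n.
  exact: trig_periodic (trig_tpoly _ _) w.
apply/cvge0P => [p|e e0]; first exact: sqnorm_ge0.
have e4 : 0 < e / 4 by rewrite divr_gt0.
move/cvge0P : zcv => /(_ (fun n => sqnorm_ge0 _ _))/(_ _ e4)[N _ HN].
apply: filterS (tpoly_tail c2 e4) => p Hp.
pose n := maxn N (maxn p.1 p.2).
have np : [/\ (N <= n)%N, (p.1 <= n)%N & (p.2 <= n)%N].
  by rewrite !leq_max !leqnn !orbT.
have [Nn pn1 pn2] := np.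
rewrite (eq_sqnorm (g := fun w => tpoly c (bwin p) w - z w)); last first.
  by move=> w _; rewrite tpolyE.
have mp : cmeasurable (tpoly c (bwin p)) by apply: trig_cmeasurable; exact: trig_tpoly.
apply: (le_lt_trans (sqnorm_triangle mI mp (mf n) z2.1)).
apply: lt_quarters; first exact: (Hp (n, n)).
exact: HN.
Qed.

Lemma fourier_series_tpoly c z : is_fourier_series c z ->
  sqnorm I (fun w => tpoly c (bwin p) w - z w) @[p --> (\oo, \oo)] --> 0%E.
Proof.
case=> _ _; set u := (fun p : nat * nat => _).
suff -> : u = (fun p => sqnorm I (fun w => tpoly c (bwin p) w - z w)) by [].
by apply/funext => p; apply: eq_sqnorm => w _; rewrite tpolyE.
Qed.

Lemma fourier_series_L2 c z : is_fourier_series c z -> L2 I z.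
Proof.
move=> zc; have [mz _ _] := zc; split => //.
have /cvge0P -/(_ (fun p => sqnorm_ge0 _ _))/(_ 1 ltr01) H := fourier_series_tpoly zc.
have [p Hp] := filter_ex H.
have [mt t2] := L2_trig (trig_tpoly c (bwin p)).
apply: (@le_lt_trans _ _ (2%:E * sqnorm I (tpoly c (bwin p)) +
    2%:E * sqnorm I (fun w => z w - tpoly c (bwin p) w)%R)%E).
  rewrite [in leLHS](_ : z = (fun w => tpoly c (bwin p) w + (z w - tpoly c (bwin p) w))).
    by apply: sqnormD_le2 => //; exact: cmeasurableB.
  by apply/funext => w; rewrite addrC subrK.
rewrite lte_add_pinfty// lte_mul_pinfty// sqnormB_sym.
by rewrite (lt_trans Hp)// ltry.
Qed.

Lemma fourier_series_coef c z : is_fourier_series c z -> forall k, fcoef z k = c k.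
Proof.
move=> zc k; have z2 := fourier_series_L2 zc.
apply/eqP; rewrite -subr_eq0 -normc_eq0 eq_le normc_ge0 andbT.
apply/ler_addgt0Pr => e e0; rewrite add0r.
have e2 : L2 I (fun w => e2pi (k%:~R * w)).
  by apply: L2_trig; apply: trig_ext (trig_char k 1) => w; rewrite mul1r.
have H := cvg_cintegralM _ mI (fun p => L2_trig (trig_tpoly c (bwin p))) z2 e2
  (fourier_series_tpoly zc) e0.
have [p [H1 H2]] := filter_ex (filterI (H _) (seq_sub_bwin [:: k])).
have : normc (fcoef (tpoly c (bwin p)) k - fcoef z k) < e by exact: H1.
rewrite fcoef_tpoly ?uniq_bwin//.
by rewrite H2 ?inE// normcB_sym => /ltW.
Qed.

Lemma sqnorm_lim_le (T : Type) (F : set_system T) (FF : ProperFilter F) D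
    (f_ : T -> R -> R[i]) f (M : R) : measurable D -> 0 <= M ->
  (forall p, cmeasurable (f_ p)) -> cmeasurable f ->
  sqnorm D (fun x => f_ p x - f x) @[p --> F] --> 0%E ->
  (forall p, sqnorm D (f_ p) <= M%:E)%E -> (sqnorm D f <= M%:E)%E.
Proof.
move=> mD M0 mf_ mf cv fM.
have one : sqnorm I (fun _ => 1 : R[i]) = 1%E.
  by rewrite /sqnorm; under eq_integral do rewrite normc1 expr1n; rewrite integral_cst_I.
rewrite -[X in (_ <= X)%E]mule1 -one.
apply: (@sqnorm_le_lim _ _ F FF D I f_ (fun _ _ => 1)) => //.
- rewrite (_ : (fun p : T => _) = (fun _ => 0%E)); first exact: cvg_cst.
  by apply/funext => p; rewrite (eq_sqnorm (g := fun _ => 0)) ?sqnorm0// => x _; rewrite subrr.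
- by move=> p; rewrite one mule1.
Qed.

Lemma esum_le_sup (a : int -> \bar R) (M : \bar R) :
  (forall r : seq int, uniq r -> (\sum_(k <- r) a k <= M)%E) ->
  (\esum_(k in [set: int]) a k <= M)%E.
Proof.
move=> H; apply: ge_ereal_sup => _ [A [finA _] <-].
by rewrite fsbig_finite//; apply: H; exact: finmap.fset_uniq.
Qed.

Lemma parseval_series c z : memell2 c -> is_fourier_series c z ->
  sqnorm I z = \esum_(k in [set: int]) (normc (c k) ^+ 2)%:E.
Proof.
move=> c2 zc; have z2 := fourier_series_L2 zc.
apply/eqP; rewrite eq_le; apply/andP; split; last first.
  apply: esum_le_sup => r ur; have := bessel ur z2.
  by rewrite sumEFin; under eq_bigr do rewrite (fourier_series_coef zc).
have fin : \esum_(k in [set: int]) (normc (c k) ^+ 2)%:E \is a fin_num.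
  by rewrite ge0_fin_numE// esum_ge0.
rewrite -(fineK fin).
apply: (@sqnorm_lim_le _ (filter_prod \oo \oo) _ I (fun p => tpoly c (bwin p))) => //.
- by rewrite fine_ge0// esum_ge0.
- by move=> p; apply: trig_cmeasurable; exact: trig_tpoly.
- exact: z2.1.
- exact: fourier_series_tpoly zc.
- by move=> p; rewrite sqnorm_tpoly ?uniq_bwin// fineK// -sumEFin sum_le_esum// uniq_bwin.
Qed.

Lemma fcoef_inj H z : L1 I H -> L1 I z -> (forall k, fcoef H k = fcoef z k) ->
  {ae mu, forall w, I w -> H w = z w}.
Proof.
move=> H1 z1 E; have : {ae mu, forall w, I w -> H w - z w = 0}.
  by apply: fcoef_eq0 => [|n]; [exact: L1B|rewrite fcoefB// E subrr].
by move=> /aeS; apply => w h Iw; apply/eqP; rewrite -subr_eq0; apply/eqP/h.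
Qed.

Lemma fourier_series_ae c z H : is_fourier_series c z -> L1 I H ->
  (forall k, fcoef H k = c k) -> {ae mu, forall w, I w -> z w = H w}.
Proof.
move=> zc H1 Hc; apply: fcoef_inj => //; first exact: L2_I_L1 (fourier_series_L2 zc).
by move=> k; rewrite (fourier_series_coef zc) Hc.
Qed.

(** If the coefficients are square summable, the sum of their series has the same
    coefficients, hence is [H]; if [H] is square integrable, Bessel makes them square
    summable. Otherwise both sides are infinite. *)
Lemma parseval H : L1 I H ->
  \esum_(k in [set: int]) (normc (fcoef H k) ^+ 2)%:E = sqnorm I H.
Proof.
move=> H1.
have [c2|c2] := boolP (\esum_(k in [set: int]) (normc (fcoef H k) ^+ 2)%:E < +oo)%E.
  have [z zc] := fourier_series_exists c2.
  rewrite -(parseval_series c2 zc); apply: sqnorm_ae => //; [by case: zc|exact: H1.1|].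
  exact: (fourier_series_ae zc).
have [H2|H2] := boolP (sqnorm I H < +oo)%E.
  have : (\esum_(k in [set: int]) (normc (fcoef H k) ^+ 2)%:E <= sqnorm I H)%E.
    apply: esum_le_sup => r ur; rewrite sumEFin; apply: bessel => //.
    by split => //; exact: H1.1.
  by move=> /le_lt_trans/(_ H2); rewrite (negbTE c2).
by move: c2 H2; rewrite -!leNgt !leye_eq => /eqP -> /eqP ->.
Qed.

Lemma parseval_l2 H : L2 I H -> memell2 (fcoef H).
Proof. by move=> H2; rewrite /memell2 parseval ?H2.2//; exact: L2_I_L1. Qed.

End Circle.

(** * The Fourier transform of integrable functions *)
Section FourierL1.
Context {R : realType}.
Local Notation mu := (@lebesgue_measure R).
Local Notation I := (`[0%R, 1%R]%classic : set R).
Implicit Types (f g h : R -> R[i]).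

Lemma ccontinuousP f : ccontinuous f <->
  continuous (fun x => complex.Re (f x)) /\ continuous (fun x => complex.Im (f x)).
Proof.
split=> [cf|[cr ci] x].
  by split=> x; apply/cvgrPdist_lt => e e0; have /cvgcP/(_ e e0) := cf x;
    apply: filterS => y; apply: le_lt_trans; rewrite normcB_sym -?ReN -?ImN -?ReD -?ImD
      ?Re_le_normc ?Im_le_normc.
apply/cvgcP => e e0; have e2 : 0 < e / 2 by rewrite divr_gt0.
have /cvgrPdist_lt/(_ _ e2) H1 := cr x; have /cvgrPdist_lt/(_ _ e2) H2 := ci x.
apply: filterS (filterI H1 H2) => y [h1 h2].
apply: (le_lt_trans (normc_le_ReIm _)); rewrite (splitr e) !ReImE.
by rewrite distrC [X in _ + X]distrC ltrD.
Qed.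

Lemma ccontinuous_cmeasurable f : ccontinuous f -> cmeasurable f.
Proof. by move=> /ccontinuousP[cr ci]; split; exact: continuous_measurable_fun. Qed.

Lemma ccontinuous_e2pi : ccontinuous (@e2pi R).
Proof.
apply/ccontinuousP; split=> x; rewrite /e2pi/=.
  by apply: continuous_comp; [exact: mulrl_continuous|exact: continuous_cos].
by apply: continuous_comp; [exact: mulrl_continuous|exact: continuous_sin].
Qed.

Lemma L1_fourier_kernel f w : L1 setT f -> L1 setT (fun x => f x * e2pi (- (x * w))).
Proof.
move=> f1; apply: L1e2pi => //; apply: measurableT_comp => //.
by apply: measurable_funM.
Qed.

Lemma ccontinuous_fourierL1 f : L1 setT f -> ccontinuous (fourierL1 f).
Proof.
move=> f1.
have ig : mu.-integrable setT (fun x => (normc (f x))%:E) by exact: L1_normc.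
have cont (part : R[i] -> R) :
    (forall w, mu.-integrable setT (EFin \o (fun x => part (f x * e2pi (- (x * w)))))) ->
    (forall z, `|part z| <= normc z) ->
    (forall x, continuous (fun w => part (f x * e2pi (- (x * w))))) ->
    continuous (fun w => Rintegral mu setT (fun x => part (f x * e2pi (- (x * w))))).
  move=> ip np cp w0.
  have w0I : w0 \in (`]w0 - 1, w0 + 1[%classic : set R).
    by rewrite inE /= in_itv/= ltrBlDr ltrDl ltr01.
  pose k w x := part (f x * e2pi (- (x * w))).
  pose G (x : R) : R := normc (f x).
  have H1 x : `]w0 - 1, w0 + 1[%classic x -> mu.-integrable setT (EFin \o k x).
    by move=> _; exact: ip.
  have H2 : {ae mu, forall x, setT x -> {in `]w0 - 1, w0 + 1[%classic, continuous (k ^~ x)}}.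
    by apply: aeT => x _ w _; exact: cp.
  have H3 w : `]w0 - 1, w0 + 1[%classic w ->
      {ae mu, forall x, setT x -> `|k w x| <= G x}.
    by move=> _; apply: aeT => x _; rewrite (le_trans (np _))// normcM normc_e2pi mulr1.
  have ig' : mu.-integrable setT (EFin \o G) by exact: ig.
  have H := continuity_under_integral measurableT H1 H2 ig' H3.
  exact: H w0 w0I.
have cphase x : ccontinuous (fun w => f x * e2pi (- (x * w))).
  have /ccontinuousP[ec es] := ccontinuous_e2pi.
  have cl : continuous (fun w : R => - (x * w)).
    by move=> w; apply: cvgN; exact: mulrl_continuous.
  have ec' : continuous (fun w => complex.Re (e2pi (- (x * w)))).
    by move=> w; apply: (continuous_comp (cl w) (ec _)).
  have es' : continuous (fun w => complex.Im (e2pi (- (x * w)))).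
    by move=> w; apply: (continuous_comp (cl w) (es _)).
  apply/ccontinuousP; split=> w.
    under eq_fun do rewrite Re_mulc.
    by apply: cvgB; apply: cvgM; [exact: cvg_cst|exact: ec'|exact: cvg_cst|exact: es'].
  under eq_fun do rewrite Im_mulc.
  by apply: cvgD; apply: cvgM; [exact: cvg_cst|exact: es'|exact: cvg_cst|exact: ec'].
apply/ccontinuousP; split.
  apply: (cont (@complex.Re R)) => [w|z|x].
  - exact: L1_Re mTR (L1_fourier_kernel w f1).
  - exact: Re_le_normc.
  - by have /ccontinuousP[] := cphase x.
apply: (cont (@complex.Im R)) => [w|z|x].
- exact: L1_Im mTR (L1_fourier_kernel w f1).
- exact: Im_le_normc.
- by have /ccontinuousP[] := cphase x.
Qed.

Lemma cmeasurable_fourierL1 f : L1 setT f -> cmeasurable (fourierL1 f).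
Proof. by move=> f1; apply/ccontinuous_cmeasurable/ccontinuous_fourierL1. Qed.

Lemma fourierL1D f g : L1 setT f -> L1 setT g ->
  fourierL1 (fun x => f x + g x) = (fun w => fourierL1 f w + fourierL1 g w).
Proof.
move=> f1 g1; apply/funext => w; rewrite /fourierL1 -cintegralD//; [|exact: L1_fourier_kernel..].
by apply: eq_cintegral => x _; rewrite mulrDl.
Qed.

Lemma fourierL1Z f (a : R[i]) : L1 setT f ->
  fourierL1 (fun x => a * f x) = (fun w => a * fourierL1 f w).
Proof.
move=> f1; apply/funext => w; rewrite /fourierL1 -cintegralZ//; last exact: L1_fourier_kernel.
by apply: eq_cintegral => x _; rewrite mulrA.
Qed.

Lemma fourierL1_shift f (c : R) : L1 setT f ->
  fourierL1 (fun x => f (x - c)) = (fun w => e2pi (- (c * w)) * fourierL1 f w).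
Proof.
move=> f1; apply/funext => w; rewrite /fourierL1.
rewrite -cintegralZ//; last exact: L1_fourier_kernel.
rewrite -[RHS](@cintegral_shift _ _ (- c)); last by apply: L1Z => //; exact: L1_fourier_kernel.
apply: eq_cintegral => x _; rewrite mulrCA -e2piD; congr (_ * e2pi _); ring.
Qed.

(** Joint measurability, for kernels on the plane. *)
Definition cmeas2 (F : R * R -> R[i]) :=
  measurable_fun [set: R * R] (fun z => complex.Re (F z)) /\
  measurable_fun [set: R * R] (fun z => complex.Im (F z)).

Lemma cmeas2M F G : cmeas2 F -> cmeas2 G -> cmeas2 (fun z => F z * G z).
Proof.
move=> [f1 f2] [g1 g2]; split.
  by under eq_fun do rewrite Re_mulc; apply: measurable_funB; exact: measurable_funM.
by under eq_fun do rewrite Im_mulc; apply: measurable_funD; exact: measurable_funM.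
Qed.

Lemma cmeas2_sum (J : Type) (r : seq J) (F : J -> R * R -> R[i]) :
  (forall i, cmeas2 (F i)) -> cmeas2 (fun z => \sum_(i <- r) F i z).
Proof.
move=> mF; elim: r => [|i r [IH1 IH2]].
  by under eq_fun do rewrite big_nil; split; exact: measurable_cst.
under eq_fun do rewrite big_cons; have [f1 f2] := mF i; split.
  by under eq_fun do rewrite ReD; exact: measurable_funD.
by under eq_fun do rewrite ImD; exact: measurable_funD.
Qed.

Lemma cmeas2_comp F (u : R * R -> R) : cmeasurable F -> measurable_fun setT u ->
  cmeas2 (fun z => F (u z)).
Proof.
by move=> [f1 f2] mu_; split; [exact: (measurableT_comp f1)|exact: (measurableT_comp f2)].
Qed.

Lemma cmeas2_normc2 F : cmeas2 F -> measurable_fun [set: R * R] (fun z => normc (F z) ^+ 2).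
Proof.
move=> [f1 f2]; under eq_fun do rewrite normc2E.
by apply: measurable_funD; exact: measurable_funX.
Qed.

Lemma cmeas2_normc F : cmeas2 F -> measurable_fun [set: R * R] (fun z => normc (F z)).
Proof.
move=> mF; rewrite (_ : (fun z => _) = (@powR R ^~ 2^-1) \o (fun z => normc (F z) ^+ 2)).
  exact: (measurableT_comp (measurable_powR _) (cmeas2_normc2 mF)).
apply/funext => x /=; rewrite powR12_sqrt ?sqr_ge0//.
by rewrite sqrtr_sqr ger0_norm// normc_ge0.
Qed.

Lemma cmeas2_kernel : cmeas2 (fun z => e2pi (- (z.1 * z.2))).
Proof.
apply: (cmeas2_comp (cmeasurable_e2pi (R := R))); apply: measurableT_comp => //.
by apply: measurable_funM; [exact: measurable_fst|exact: measurable_snd].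
Qed.

Lemma integral_swap_normc (F : R * R -> R) : measurable_fun [set: R * R] F ->
  (forall z, 0 <= F z) ->
  (\int[mu]_x \int[mu]_w (F (x, w))%:E = \int[mu]_w \int[mu]_x (F (x, w))%:E)%E.
Proof.
move=> mF F0; apply: (fubini_tonelli (m1 := mu) (m2 := mu) (fun z => (F z)%:E)).
  by apply/measurable_EFinP.
by move=> z; rewrite lee_fin.
Qed.

Lemma cfubini (K : R * R -> R[i]) : cmeas2 K ->
  (forall x, L1 setT (fun w => K (x, w))) -> (forall w, L1 setT (fun x => K (x, w))) ->
  (\int[mu]_x \int[mu]_w (normc (K (x, w)))%:E < +oo)%E ->
  cintegral setT (fun x => cintegral setT (fun w => K (x, w))) =
  cintegral setT (fun w => cintegral setT (fun x => K (x, w))).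
Proof.
move=> mK Kx Kw Kfin.
have key (h : R * R -> R) : measurable_fun [set: R * R] h ->
    (forall z, `|h z| <= normc (K z)) ->
    (forall x, mu.-integrable setT (EFin \o (fun w => h (x, w)))) ->
    (forall w, mu.-integrable setT (EFin \o (fun x => h (x, w)))) ->
    Rintegral mu setT (fun x => Rintegral mu setT (fun w => h (x, w))) =
    Rintegral mu setT (fun w => Rintegral mu setT (fun x => h (x, w))).
  move=> mh hK hx hw.
  have mh' : measurable_fun [set: measurableTypeR R * measurableTypeR R] (fun z => (h z)%:E).
    by apply/measurable_EFinP.
  have ih : (mu \x mu)%E.-integrable setT (fun z => (h z)%:E).
    apply/(integrable12ltyP mu mu mh'); apply: le_lt_trans Kfin.
    have mKn : measurable_fun [set: measurableTypeR R * measurableTypeR R] (fun z => (normc (K z))%:E).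
      by apply/measurable_EFinP; exact: cmeas2_normc.
    apply: ge0_le_integral => //.
    - by move=> x _; exact: integral_ge0.
    - apply: (measurable_fun_fubini_tonelli_F (m2 := mu) (fun z => `|(h z)%:E|%E)) => //.
      exact: measurableT_comp.
    - exact: (measurable_fun_fubini_tonelli_F (m2 := mu) (fun z => (normc (K z))%:E)).
    - move=> x _; apply: ge0_le_integral => //.
      + by apply: measurableT_comp => //; case/integrableP: (hx x).
      + by apply: emeasurable_normc; case: (Kx x).
      + by move=> w _; rewrite lee_fin hK.
  have F := Fubini ih.
  rewrite /Rintegral; congr fine.
  transitivity (\int[mu]_x \int[mu]_w (h (x, w))%:E)%E.
    by apply: eq_integral => x _; rewrite fineK//; apply: integrable_fin_num => //; exact: hx.
  rewrite F; apply: eq_integral => w _; rewrite fineK//.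
  by apply: integrable_fin_num => //; exact: hw.
have [mr mi] := mK.
have kr := key (fun z => complex.Re (K z)) mr (fun z => Re_le_normc _)
  (fun x => L1_Re mTR (Kx x)) (fun w => L1_Re mTR (Kw w)).
have ki := key (fun z => complex.Im (K z)) mi (fun z => Im_le_normc _)
  (fun x => L1_Im mTR (Kx x)) (fun w => L1_Im mTR (Kw w)).
by apply: complex_eqP; [exact: kr|exact: ki].
Qed.

(** Fubini for the kernel $f(x)e^{-2\pi ix\omega}g(\omega)$. *)
Lemma fourierL1_mul f g : L1 setT f -> L1 setT g ->
  cintegral setT (fun w => fourierL1 f w * g w) =
  cintegral setT (fun x => f x * fourierL1 g x).
Proof.
move=> f1 g1; have [mf fi] := f1; have [mg gi] := g1.
pose K (z : R * R) : R[i] := f z.1 * e2pi (- (z.1 * z.2)) * g z.2.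
have mK : cmeas2 K.
  apply: cmeas2M; last exact: (cmeas2_comp mg (@measurable_snd _ _ _ _)).
  by apply: cmeas2M; [exact: (cmeas2_comp mf (@measurable_fst _ _ _ _))|exact: cmeas2_kernel].
have nK x w : normc (K (x, w)) = normc (f x) * normc (g w).
  by rewrite /K !normcM normc_e2pi mulr1.
have KI : (\int[mu]_x \int[mu]_w (normc (K (x, w)))%:E < +oo)%E.
  under eq_integral => x _.
    under eq_integral do rewrite nK EFinM.
    rewrite ge0_integralZl//; last exact: emeasurable_normc.
    over.
  rewrite ge0_integralZr//; [|exact: emeasurable_normc|exact: integral_ge0].
  by rewrite lte_mul_pinfty//; [exact: integral_ge0|rewrite ge0_fin_numE// integral_ge0].
have KxE x : (fun w => K (x, w)) = (fun w => f x * (g w * e2pi (- (w * x)))).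
  by apply/funext => w; rewrite /K /= (mulrC w); ring.
have KwE w : (fun x => K (x, w)) = (fun x => g w * (f x * e2pi (- (x * w)))).
  by apply/funext => x; rewrite /K /=; ring.
have Kx x : L1 setT (fun w => K (x, w)).
  by rewrite KxE; apply: L1Z => //; exact: L1_fourier_kernel.
have Kw w : L1 setT (fun x => K (x, w)).
  by rewrite KwE; apply: L1Z => //; exact: L1_fourier_kernel.
have E1 x : cintegral setT (fun w => K (x, w)) = f x * fourierL1 g x.
  by rewrite KxE cintegralZ//; exact: L1_fourier_kernel.
have E2 w : cintegral setT (fun x => K (x, w)) = fourierL1 f w * g w.
  by rewrite KwE cintegralZ//; [rewrite mulrC|exact: L1_fourier_kernel].
have := cfubini mK Kx Kw KI; rewrite (eq_cintegral (fun x _ => E1 x)).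
by rewrite (eq_cintegral (fun w _ => E2 w)) => ->.
Qed.

(** Dominated convergence integrates the series term by term. *)
Lemma abs_series_coef (c : int -> R[i]) : summable_c c ->
  let S w := bilateral_sum (fun k => c k * e2pi (- (k%:~R * w))) in
  L1 I S /\ forall k, fcoef S k = c k.
Proof.
move=> c1 S; pose M := fine (\esum_(k in [set: int]) (normc (c k))%:E).
have sw w : summable_c (fun k => c k * e2pi (- (k%:~R * w))).
  by apply: (summable_c_le c1) => k; rewrite normcM normc_e2pi mulr1.
have cv w : (fun n => normc (tpoly c (bwin (n, n)) w - S w)) @ \oo --> (0 : R).
  by under eq_fun do rewrite -tpolyE; exact: summable_diag.
have bnd n w : normc (tpoly c (bwin (n, n)) w) <= M.
  have fin : \esum_(k in [set: int]) (normc (c k))%:E \is a fin_num.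
    by rewrite ge0_fin_numE// esum_ge0.
  rewrite -lee_fin fineK//.
  apply: (le_trans (sum_normc_le_esum (fun k => c k * e2pi (- (k%:~R * w))) (uniq_bwin (n, n)))).
  by apply: le_esum => k _; rewrite normcM normc_e2pi mulr1.
have mt n : cmeasurable (tpoly c (bwin (n, n))) by apply: trig_cmeasurable; exact: trig_tpoly.
have mS : cmeasurable S.
  rewrite (_ : S = fun w => clim (fun n => tpoly c (bwin (n, n)) w)).
    by apply: cmeasurable_clim => // w; have [] := clim_eq (cv w).
  by apply/funext => w; have [_ _ ->] := clim_eq (cv w).
have iM : mu.-integrable I (EFin \o (fun _ => M)).
  apply/integrableP; split; first exact: measurable_cst.
  by rewrite /= integral_cst_I ltry.
split.
  have [] := dct_cintegral mI mt mS iM (aeT (fun w _ => cv w)) (aeT (fun w _ n => bnd n w)).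
  by [].
move=> k.
have me : cmeasurable (fun x : R => e2pi (k%:~R * x)).
  by apply: cmeasurable_e2pi_comp; exact: measurable_mull.
have [_ _ lim] : [/\ L1 I (fun w => S w * e2pi (k%:~R * w)),
    forall n, L1 I (fun w => tpoly c (bwin (n, n)) w * e2pi (k%:~R * w)) &
    (fun n => normc (fcoef (tpoly c (bwin (n, n))) k - fcoef S k)) @ \oo --> (0 : R)].
  apply: (dct_cintegral mI _ _ iM) => [n|||].
  - exact: cmeasurableM.
  - exact: cmeasurableM.
  - apply: aeT => w _; under eq_fun do rewrite -mulrBl normcM normc_e2pi mulr1.
    exact: cv.
  - by apply: aeT => w _ n; rewrite normcM normc_e2pi mulr1.
have [_ _ <-] := clim_eq lim.
have : (fun n => normc (fcoef (tpoly c (bwin (n, n))) k - c k)) @ \oo --> (0 : R).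
  apply/cvgr0P => [n|e e0]; first exact: normc_ge0.
  have := bilateral_diag (seq_sub_bwin [:: k]); apply: filterS => n H.
  by rewrite fcoef_tpoly ?uniq_bwin// H ?inE// subrr normc0.
by move=> /clim_eq[_ _ ->].
Qed.

End FourierL1.

(** * Plancherel *)
Section Plancherel.
Context {R : realType}.
Local Notation mu := (@lebesgue_measure R).
Local Notation I := (`[0%R, 1%R]%classic : set R).
Implicit Types (f g h u : R -> R[i]).

(** Both the transform and the function are read off the two-variable function
    $\sum_n h(x+n)e^{-2\pi i(x+n)\omega}$: in $x$ its Fourier coefficients are the
    $\hat h(\omega+k)$, in $\omega$ they are, up to a phase, the $h(x+n)$. *)
Lemma plancherel_L1 h : L1 setT h -> sqnorm setT (fourierL1 h) = sqnorm setT h.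
Proof.
move=> h1; have mh := h1.1.
pose F w y := h y * e2pi (- (y * w)).
have F1 w : L1 setT (F w) by exact: L1_fourier_kernel.
have aF w x : abs_per (F w) x = abs_per h x.
  by apply: eq_esum => k _; rewrite /F normcM normc_e2pi mulr1.
pose A := [set x | (abs_per h x < +oo)%E].
have mA : measurable A.
  rewrite /A -[X in measurable X]setTI; apply: emeasurable_fun_infty_o => //.
  exact: measurable_abs_per.
pose K (z : R * R) := perz (F z.2) z.1.
pose Kn n (z : R * R) := ind A z.1 *
  \sum_(k <- bwin (n, n)) h (z.1 + k%:~R) * e2pi (- ((z.1 + k%:~R) * z.2)).
have mKn n : cmeas2 (Kn n).
  apply: cmeas2M; first exact: (cmeas2_comp (cmeasurable_ind mA) (@measurable_fst _ _ _ _)).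
  have msh k : measurable_fun [set: R * R] (fun z => z.1 + k%:~R).
    by apply: measurable_funD => //; exact: measurable_fst.
  apply: cmeas2_sum => k; apply: cmeas2M; first exact: (cmeas2_comp mh (msh k)).
  apply: (cmeas2_comp (cmeasurable_e2pi (R := R))); apply: measurableT_comp => //.
  by apply: measurable_funM; [exact: msh|exact: measurable_snd].
have KnK z : (fun n => normc (Kn n z - K z)) @ \oo --> (0 : R).
  rewrite /Kn indE; have [zA|zA] := boolP (z.1 \in A).
    rewrite inE in zA; under eq_fun do rewrite mul1r -bilateral_psumE.
    by apply: perz_diag; rewrite aF.
  rewrite /K /perz aF; move: zA; rewrite notin_setE /A/= => /negP/negbTE ->.
  by under eq_fun do rewrite mul0r subr0 normc0; exact: cvg_cst.
pose G (z : R * R) : R := normc (K z) ^+ 2.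
have mG : measurable_fun [set: R * R] G.
  apply: (@measurable_fun_cvg _ _ _ setT (fun n z => normc (Kn n z) ^+ 2)) => [n|z _].
    exact: cmeas2_normc2.
  exact: cvg_normc2 (KnK z).
pose GI (z : R * R) : R := \1_I z.1 * \1_I z.2 * G z.
have m1I : measurable_fun setT (\1_I : R -> R) by exact: measurable_indic.
have mGI : measurable_fun [set: R * R] GI.
  apply: measurable_funM => //; apply: measurable_funM.
    exact: (measurableT_comp m1I (@measurable_fst _ _ _ _)).
  exact: (measurableT_comp m1I (@measurable_snd _ _ _ _)).
have indI (a : R -> \bar R) :
    (\int[mu]_x ((\1_I x : R)%:E * a x) = \int[mu]_(x in I) a x)%E.
  rewrite [RHS]integral_mkcond; apply: eq_integral => x _.
  by rewrite patchE indicE; case: (x \in I); rewrite ?mul1e ?mul0e.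
have row w : \esum_(k in [set: int]) (normc (fourierL1 h (w + k%:~R)) ^+ 2)%:E =
    (\int[mu]_(x in I) (G (x, w))%:E)%E.
  have [p1 _] := perz_cintegral (F1 w).
  rewrite -[RHS](parseval p1) -[LHS]esum_opp; apply: eq_esum => k _.
  rewrite perz_coef//; congr ((normc _ ^+ 2)%:E); apply: eq_cintegral => y _.
  by rewrite /F -mulrA -e2piD mulrNz; congr (_ * e2pi _); ring.
have mcol w : measurable_fun setT (fun x => (G (x, w))%:E).
  apply/measurable_EFinP.
  exact: (measurableT_comp mG (@pair2_measurable _ _ (measurableTypeR R) (measurableTypeR R) w)).
have mrow x : measurable_fun setT (fun w => (G (x, w))%:E).
  apply/measurable_EFinP.
  exact: (measurableT_comp mG (@pair1_measurable _ _ (measurableTypeR R) (measurableTypeR R) x)).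
have m1E : measurable_fun setT (fun x : R => (\1_I x : R)%:E) by exact/measurable_EFinP.
have mcolM w : measurable_fun setT (fun x => (\1_I x : R)%:E * (G (x, w))%:E)%E.
  exact: emeasurable_funM m1E (mcol w).
have mrowM x : measurable_fun setT (fun w => (\1_I w : R)%:E * (G (x, w))%:E)%E.
  exact: emeasurable_funM m1E (mrow x).
have G0 z : (0 <= (G z)%:E)%E by rewrite lee_fin sqr_ge0.
have GI0 z : 0 <= GI z by rewrite /GI mulr_ge0 ?sqr_ge0// mulr_ge0// indicE.
have mG2 : measurable_fun [set: measurableTypeR R * measurableTypeR R] (fun z => (G z)%:E).
  by apply/measurable_EFinP.
have mGI2 : measurable_fun [set: measurableTypeR R * measurableTypeR R] (fun z => (GI z)%:E).
  by apply/measurable_EFinP.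
have E1 w : (\int[mu]_x (GI (x, w))%:E = (\1_I w)%:E * \int[mu]_(x in I) (G (x, w))%:E)%E.
  rewrite -indI// -ge0_integralZl ?lee_fin ?indicE//; last 2 first.
  - exact: mcolM.
  - by move=> x _; rewrite mule_ge0// lee_fin indicE.
  by apply: eq_integral => x _; rewrite /GI /= -!EFinM indicE; congr (_%:E); ring.
have E2 x : (\int[mu]_w (GI (x, w))%:E = (\1_I x)%:E * \int[mu]_(w in I) (G (x, w))%:E)%E.
  rewrite -indI// -ge0_integralZl ?lee_fin ?indicE//; last 2 first.
  - exact: mrowM.
  - by move=> w _; rewrite mule_ge0// lee_fin indicE.
  by apply: eq_integral => w _; rewrite /GI /= -!EFinM indicE; congr (_%:E); ring.
have col : {ae mu, forall x, I x -> (\int[mu]_(w in I) (G (x, w))%:E)%E =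
    \esum_(k in [set: int]) (normc (h (x + k%:~R)) ^+ 2)%:E}.
  apply: (aeS (abs_per_lty h1)) => x hx _.
  have [S1 Sc] := abs_series_coef (hx : summable_c (fun k => h (x + k%:~R))).
  under [RHS]eq_esum do rewrite -Sc; rewrite (parseval S1); apply: eq_integral => w _.
  rewrite /G /K /perz aF hx; congr ((_ ^+ 2)%:E).
  rewrite -[RHS]mul1r -[X in _ = X * _](normc_e2pi (- (x * w))) -normcM -csumZ; last first.
    by apply: (summable_c_le (hx : summable_c (fun k => h (x + k%:~R)))) => k;
      rewrite normcM normc_e2pi mulr1.
  congr (normc (bilateral_sum _)); apply/funext => k.
  rewrite mulrCA -e2piD; congr (_ * e2pi _) => /=; ring.
rewrite (sqnorm_periodize (cmeasurable_fourierL1 h1)) (sqnorm_periodize mh).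
under eq_integral do rewrite row.
clearbody GI.
transitivity (\int[mu]_w \int[mu]_x (GI (x, w))%:E)%E.
  rewrite -(indI (fun w => \int[mu]_(x in I) (G (x, w))%:E)%E).
  by apply: eq_integral => w _; rewrite E1.
transitivity (\int[mu]_x \int[mu]_w (GI (x, w))%:E)%E.
  by symmetry; exact: (integral_swap_normc mGI GI0).
transitivity (\int[mu]_(x in I) \int[mu]_(w in I) (G (x, w))%:E)%E.
  rewrite -(indI (fun x => \int[mu]_(w in I) (G (x, w))%:E)%E).
  by apply: eq_integral => x _; rewrite E2.
apply: ge0_ae_eq_integral => //.
- have mF := measurable_fun_fubini_tonelli_F (m2 := mu) (fun z => (GI z)%:E) mGI2
    (fun z => (introT idP (GI0 z) : (0 <= (GI z)%:E)%E)).
  apply: (eq_measurable_fun (fun x => \int[mu]_w (GI (x, w))%:E)%E).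
    by move=> x xI; rewrite E2 indicE xI mul1e.
  exact: measurable_funTS mF.
- apply: emeasurable_esum_int => // k; apply: emeasurable_normc2; exact: cmeasurable_shift.
- by move=> x _; exact: integral_ge0.
- by move=> x _; exact: esum_ge0.
Qed.

Lemma L2_truncate f : L2 setT f -> exists h_ : nat -> R -> R[i],
  (forall n, L1 setT (h_ n) /\ L2 setT (h_ n)) /\
  sqnorm setT (fun x => h_ n x - f x) @[n --> \oo] --> 0%E.
Proof.
move=> f2; have mf := f2.1.
pose J n : set R := `[- n%:R, n%:R]%classic.
have mJ n : measurable (J n) by exact: measurable_itv.
exists (fun n x => ind (J n) x * f x); split.
  move=> n; have mi := cmeasurable_ind (mJ n).
  have i2 : L2 setT (ind (J n)).
    split => //; apply: (@le_lt_trans _ _ (\int[mu]_(x in J n) 1%:E)%E).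
      rewrite [leRHS]integral_mkcond; rewrite le_eqVlt; apply/orP; left; apply/eqP.
      apply: eq_integral => x _; rewrite patchE indE; case: ifP => _.
        by rewrite normc1 expr1n.
      by rewrite normc0 expr0n.
    rewrite (integral_cst mu (mJ n)) mul1e.
    rewrite [X in (X < _)%E](_ : _ = mu (J n))// /J lebesgue_measure_itv/= lte_fin.
    by case: ifP => _; rewrite ?ltry// -EFinB ltry.
  split; first exact: L2M.
  by apply: (L2M_bnd (M := 1)) => // x _; exact: normc_ind.
rewrite /sqnorm; apply: (dct0 (g := fun x => normc (f x) ^+ 2)) => //.
- move=> n; apply: measurable_normc2; apply: cmeasurableB => //.
  by apply: cmeasurableM => //; exact: cmeasurable_ind.
- by move=> n x _; exact: sqr_ge0.
- apply/integrableP; split; first exact: emeasurable_normc2.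
  by under eq_integral do rewrite /= ger0_norm ?sqr_ge0//; exact: f2.2.
- apply: aeT => x _; apply/cvgr0P => [n|e e0]; first exact: sqr_ge0.
  exists (Num.truncn `|x|).+1 => // n /= xn.
  rewrite indE mem_set ?mul1r ?subrr ?normc0 ?expr0n//=.
  by rewrite /J/= in_itv/= -ler_norml ltW// (lt_le_trans (truncnS_gt _))// ler_nat.
- apply: aeT => x _ n; rewrite ler_pXn2r ?nnegrE ?normc_ge0// indE; case: ifP => _.
    by rewrite mul1r subrr normc0 normc_ge0.
  by rewrite mul0r sub0r normcN.
Qed.

Lemma L2_fourierL1 h : L1 setT h -> L2 setT h -> L2 setT (fourierL1 h).
Proof.
move=> h1 h2; split; first exact: cmeasurable_fourierL1.
by rewrite plancherel_L1//; exact: h2.2.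
Qed.

Lemma fourierL1B f g : L1 setT f -> L1 setT g ->
  fourierL1 (fun x => f x - g x) = (fun w => fourierL1 f w - fourierL1 g w).
Proof.
move=> f1 g1; rewrite fourierL1D//; last exact: L1N.
apply/funext => w; congr (_ + _); rewrite /fourierL1 -cintegralN//; last exact: L1_fourier_kernel.
by apply: eq_cintegral => x _; rewrite mulNr.
Qed.

Lemma fourier_exists f : L2 setT f -> exists g, is_fourier f g.
Proof.
move=> f2; have [h_ [hL hcv]] := L2_truncate f2.
have mT := @mTR R.
have H2 n : L2 setT (fourierL1 (h_ n)) by apply: L2_fourierL1; case: (hL n).
have dist m n : sqnorm setT (fun w => fourierL1 (h_ m) w - fourierL1 (h_ n) w) =
    sqnorm setT (fun x => h_ m x - h_ n x).
  have [m1 _] := hL m; have [n1 _] := hL n.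
  by rewrite -fourierL1B// plancherel_L1//; exact: (L1B mT m1 n1).
have cau (e : R) : 0 < e -> exists N, forall m n, (N <= m)%N -> (N <= n)%N ->
    (sqnorm setT (fun w => fourierL1 (h_ m) w - fourierL1 (h_ n) w)%R < e%:E)%E.
  move=> e0; have e4 : 0 < e / 4 by rewrite divr_gt0.
  move/cvge0P : hcv => /(_ (fun n => sqnorm_ge0 _ _))/(_ _ e4)[N _ HN].
  exists N => m n Nm Nn; rewrite dist.
  apply: (le_lt_trans (sqnorm_triangle mT (hL m).2.1 f2.1 (hL n).2.1)).
  apply: lt_quarters; first exact: HN.
  by rewrite sqnormB_sym; exact: HN.
have [Phi [z2 zcv]] := L2_complete mT H2 cau.
by eexists; split; first exact: z2; exists h_; split.
Qed.

Lemma fourierP f : L2 setT f -> is_fourier f (fourier f).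
Proof. by move=> /fourier_exists; rewrite /fourier => -[g fg]; apply: xgetPex; exists g. Qed.

End Plancherel.

(** * The Fourier transform on L2 and its inversion *)
Section FourierL2.
Context {R : realType}.
Local Notation mu := (@lebesgue_measure R).
Implicit Types (f g h u : R -> R[i]).
Let mT := @mTR R.

Lemma ae_guard (P : R -> Prop) : {ae mu, forall x, P x} -> {ae mu, forall x, [set: R] x -> P x}.
Proof. by move=> /aeS; apply. Qed.

Lemma sqnorm_eq0P f : cmeasurable f -> sqnorm setT f = 0%E <-> {ae mu, forall x, f x = 0}.
Proof.
move=> mf; split => [/(sqnorm0_ae mT mf)/aeS|f0]; first by apply => x; exact.
by rewrite (sqnorm_ae mT mf (cmeasurable_cst 0) (ae_guard f0)) sqnorm0.
Qed.

Lemma sqnormB_eq0P f g : cmeasurable f -> cmeasurable g ->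
  sqnorm setT (fun x => f x - g x) = 0%E <-> {ae mu, forall x, f x = g x}.
Proof.
move=> mf mg; rewrite sqnorm_eq0P; last exact: cmeasurableB.
split => /aeS; apply => x; last by move=> ->; rewrite subrr.
by move=> /eqP; rewrite subr_eq0 => /eqP.
Qed.

Lemma sqnorm_lim_unique (T : Type) (F : set_system T) (FF : ProperFilter F) D
    (f_ : T -> R -> R[i]) f g : measurable D -> (forall p, cmeasurable (f_ p)) ->
  cmeasurable f -> cmeasurable g ->
  sqnorm D (fun x => f_ p x - f x) @[p --> F] --> 0%E ->
  sqnorm D (fun x => f_ p x - g x) @[p --> F] --> 0%E ->
  sqnorm D (fun x => f x - g x) = 0%E.
Proof.
move=> mD mf_ mf mg cf cg; apply/eqP; rewrite eq_le sqnorm_ge0 andbT.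
apply/lee_addgt0Pr => e e0; rewrite add0e.
have e4 : 0 < e / 4 by rewrite divr_gt0.
move/(cvge0P _ (fun p => sqnorm_ge0 _ _)) : cf => /(_ _ e4) cf.
move/(cvge0P _ (fun p => sqnorm_ge0 _ _)) : cg => /(_ _ e4) cg.
have [p [pf pg]] := filter_ex (filterI cf cg).
apply: (le_trans (sqnorm_triangle mD mf (mf_ p) mg)); apply: ltW.
by apply: lt_quarters => //; rewrite sqnormB_sym.
Qed.

Lemma is_fourier_L1L2 h : L1 setT h -> L2 setT h -> is_fourier h (fourierL1 h).
Proof.
move=> h1 h2; split; first exact: L2_fourierL1.
exists (fun _ => h); split => // ; rewrite (_ : sqnorm _ _ = 0%E); try exact: cvg_cst.
  by rewrite -[RHS](sqnorm0 setT); apply: eq_sqnorm => x _; rewrite subrr.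
by rewrite -[RHS](sqnorm0 setT); apply: eq_sqnorm => x _; rewrite subrr.
Qed.

Lemma is_fourier_ae f g g' : is_fourier f g -> cmeasurable g' -> {ae mu, forall x, g x = g' x} ->
  is_fourier f g'.
Proof.
move=> [g2 [h [hL hf hg]]] mg' gg'; split.
  exact: (L2_ae mT mg' (ae_guard gg') g2).
exists h; split => //; rewrite (_ : (fun n => _) = (fun n =>
  sqnorm setT (fun w => fourierL1 (h n) w - g w)))//; apply/funext => n.
have mh := cmeasurable_fourierL1 (hL n).1.
apply: sqnorm_ae => //; [exact: cmeasurableB|exact: cmeasurableB g2.1|].
by apply: (aeS gg') => x ->.
Qed.

Lemma sqnorm_linear_cvg (f_ f'_ : nat -> R -> R[i]) f f' (a : R[i]) :
  (forall n, cmeasurable (f_ n)) -> (forall n, cmeasurable (f'_ n)) ->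
  cmeasurable f -> cmeasurable f' ->
  sqnorm setT (fun x => f_ n x - f x) @[n --> \oo] --> 0%E ->
  sqnorm setT (fun x => f'_ n x - f' x) @[n --> \oo] --> 0%E ->
  sqnorm setT (fun x => (f_ n x + a * f'_ n x) - (f x + a * f' x)) @[n --> \oo] --> 0%E.
Proof.
move=> mf_ mf'_ mf mf' cf cf'.
apply: (cvge0_lin (a := 2) (b := 2 * normc a ^+ 2) _ _ _ _ _ _ _ cf cf') => //.
- by move=> n; exact: sqnorm_ge0.
- by move=> n; exact: sqnorm_ge0.
- by move=> n; exact: sqnorm_ge0.
- by rewrite mulr_ge0// sqr_ge0.
move=> n; rewrite EFinM -muleA -sqnormZ//; last exact: cmeasurableB.
rewrite (_ : (fun x => _) = (fun x => (f_ n x - f x) + a * (f'_ n x - f' x))); last first.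
  by apply/funext => x; ring.
apply: sqnormD_le2 => //; first exact: cmeasurableB.
by apply: cmeasurableM; [exact: cmeasurable_cst|exact: cmeasurableB].
Qed.

Lemma is_fourier_linear f f' g g' (a : R[i]) : cmeasurable f -> cmeasurable f' ->
  is_fourier f g -> is_fourier f' g' ->
  is_fourier (fun x => f x + a * f' x) (fun w => g w + a * g' w).
Proof.
move=> mf mf' [g2 [h [hL hf hg]]] [g2' [h' [hL' hf' hg']]]; split.
  by apply: (L2D mT g2); exact: L2Z.
exists (fun n x => h n x + a * h' n x).
have hL1 n : L1 setT (h n) := (hL n).1; have hL1' n : L1 setT (h' n) := (hL' n).1.
split.
- move=> n; split.
    by apply: (L1D mT (hL1 n)); exact: L1Z.
  by apply: (L2D mT (hL n).2); apply: L2Z => //; exact: (hL' n).2.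
- by apply: sqnorm_linear_cvg => // n; [exact: (hL1 n).1|exact: (hL1' n).1].
- under eq_fun do under [X in sqnorm _ X]eq_fun do rewrite (fourierL1D (hL1 _) (L1Z a mT (hL1' _))) fourierL1Z//.
  apply: (sqnorm_linear_cvg _ _ _ g2.1 g2'.1 hg hg') => n.
  + exact: cmeasurable_fourierL1 (hL1 n).
  + exact: cmeasurable_fourierL1 (hL1' n).
Qed.

(** The identity of norms on the approximating functions passes to both limits. *)
Lemma is_fourier_isometry f g : L2 setT f -> is_fourier f g -> sqnorm setT g = sqnorm setT f.
Proof.
move=> f2 [g2 [h [hL hf hg]]].
have mh n : cmeasurable (h n) by exact: (hL n).1.1.
have mH n : cmeasurable (fourierL1 (h n)) by apply: cmeasurable_fourierL1; exact: (hL n).1.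
have eqn n : sqnorm setT (fourierL1 (h n)) = sqnorm setT (h n).
  by apply: plancherel_L1; exact: (hL n).1.
apply/eqP; rewrite eq_le; apply/andP; split.
- rewrite -[leRHS]mul1e; apply: (sqnorm_le_lim _ mT mT ler01 mH g2.1 mh f2.1 hg hf) => n.
  by rewrite mul1e eqn.
- rewrite -[leRHS]mul1e; apply: (sqnorm_le_lim _ mT mT ler01 mh f2.1 mH g2.1 hf hg) => n.
  by rewrite mul1e eqn.
Qed.

Lemma is_fourier_dist f f' g g' : L2 setT f -> L2 setT f' -> is_fourier f g -> is_fourier f' g' ->
  sqnorm setT (fun w => g w - g' w) = sqnorm setT (fun x => f x - f' x).
Proof.
move=> f2 f2' fg fg'.
have E (a b : R[i]) : a - b = a + (-1) * b by ring.
under eq_fun do rewrite E; under [X in _ = sqnorm _ X]eq_fun do rewrite E.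
apply: is_fourier_isometry; first by apply: L2D => //; exact: L2Z.
apply: is_fourier_linear => //; [exact: f2.1|exact: f2'.1].
Qed.

Lemma is_fourier_unique f g g' : L2 setT f -> is_fourier f g -> is_fourier f g' ->
  {ae mu, forall x, g x = g' x}.
Proof.
move=> f2 fg fg'; apply/(sqnormB_eq0P fg.1.1 fg'.1.1); rewrite (is_fourier_dist f2 f2 fg fg').
by rewrite -[RHS](sqnorm0 setT); apply: eq_sqnorm => x _; rewrite subrr.
Qed.

Lemma is_fourier_inj f f' g g' : L2 setT f -> L2 setT f' -> is_fourier f g -> is_fourier f' g' ->
  {ae mu, forall x, g x = g' x} -> {ae mu, forall x, f x = f' x}.
Proof.
move=> f2 f2' fg fg' gg'; apply/(sqnormB_eq0P f2.1 f2'.1); rewrite -(is_fourier_dist f2 f2' fg fg').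
exact/(sqnormB_eq0P fg.1.1 fg'.1.1).
Qed.

Lemma is_fourier_inner f f' g g' : L2 setT f -> L2 setT f' -> is_fourier f g -> is_fourier f' g' ->
  inner f f' = inner g g'.
Proof.
move=> f2 f2' fg fg'; apply: inner_polar => //; try by case: fg; case: fg'.
- move=> a; symmetry; apply: is_fourier_isometry; first by apply: L2D => //; exact: L2Z.
  by apply: is_fourier_linear => //; [exact: f2.1|exact: f2'.1].
- by symmetry; exact: is_fourier_isometry.
- by symmetry; exact: is_fourier_isometry.
Qed.

(** The graph of the transform is closed: the transforms $g_p$ tend to $g$ and, by
    isometry, to $\hat f$. *)
Lemma is_fourier_lim (T : Type) (F : set_system T) (FF : ProperFilter F)
    (f_ g_ : T -> R -> R[i]) f g : (forall p, L2 setT (f_ p)) -> L2 setT f ->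
  (forall p, is_fourier (f_ p) (g_ p)) -> cmeasurable g ->
  sqnorm setT (fun x => f_ p x - f x) @[p --> F] --> 0%E ->
  sqnorm setT (fun w => g_ p w - g w) @[p --> F] --> 0%E -> is_fourier f g.
Proof.
move=> f2_ f2 fg_ mg cf cg; have ff := fourierP f2.
apply: (is_fourier_ae ff mg); apply/(sqnormB_eq0P ff.1.1 mg).
apply: (sqnorm_lim_unique FF mT (f_ := g_)) => //; [by move=> p; exact: (fg_ p).1.1|exact: ff.1.1|].
by under eq_fun do rewrite (is_fourier_dist (f2_ _) f2 (fg_ _) ff).
Qed.

Lemma L2_translate f k : L2 setT f -> L2 setT (translate f k).
Proof. by move=> f2; have := L2_shift (- k%:~R) f2. Qed.

Lemma is_fourier_translate f g k : is_fourier f g -> cmeasurable f ->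
  is_fourier (translate f k) (fun w => e2pi (- (k%:~R * w)) * g w).
Proof.
move=> [g2 [h [hL hf hg]]] mf.
have me : cmeasurable (fun w => e2pi (- (k%:~R * w)) : R[i]).
  apply: cmeasurable_e2pi_comp; apply: measurableT_comp => //; exact: measurable_mull.
split.
  by apply: (L2M_bnd (M := 1) mT g2 me) => w _; rewrite normc_e2pi.
have hL1 n : L1 setT (h n) := (hL n).1.
exists (fun n => translate (h n) k); split.
- move=> n; split; last by apply: L2_translate; exact: (hL n).2.
  by have := L1_shift (- k%:~R) (hL1 n).
- under eq_fun do rewrite (sqnorm_shift (F := fun x => h _ x - f x) (- k%:~R) (cmeasurableB (hL1 _).1 mf)).
  exact: hf.
- rewrite (_ : (fun n => _) = (fun n => sqnorm setT (fun w => fourierL1 (h n) w - g w)))//.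
  apply/funext => n; apply: eq_sqnorm => w _.
  by rewrite /translate fourierL1_shift// -mulrBr normcM normc_e2pi mul1r.
Qed.

(** The conjugate form of the inverse transform lets Plancherel apply without
    reflecting the line. *)
Definition inverseF g (x : R) : R[i] := conjc (fourierL1 (fun w => conjc (g w)) x).

Lemma inverseFE g x : L1 setT g -> inverseF g x = cintegral setT (fun w => g w * e2pi (x * w)).
Proof.
move=> g1; rewrite /inverseF /fourierL1 -cintegral_conj//; last first.
  by apply: L1_fourier_kernel; exact: L1_conj.
by apply: eq_cintegral => w _; rewrite conjcM conjcK -e2piN opprK mulrC [w * x]mulrC mulrC.
Qed.

Lemma ccontinuous_conj f : ccontinuous f -> ccontinuous (fun x => conjc (f x)).
Proof.
move=> /ccontinuousP[cr ci]; apply/ccontinuousP; split.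
  by under eq_fun do rewrite Reconj.
by under eq_fun do rewrite Imconj; move=> x; apply: cvgN; exact: ci.
Qed.

Lemma ccontinuous_inverseF g : L1 setT g -> ccontinuous (inverseF g).
Proof. by move=> g1; apply: ccontinuous_conj; apply: ccontinuous_fourierL1; exact: L1_conj. Qed.

Lemma L2_inverseF g : L1 setT g -> L2 setT g -> L2 setT (inverseF g).
Proof.
by move=> g1 g2; apply: L2_conj; apply: L2_fourierL1; [exact: L1_conj|exact: L2_conj].
Qed.

Lemma sqnorm_inverseF g : L1 setT g -> sqnorm setT (inverseF g) = sqnorm setT g.
Proof.
move=> g1; rewrite (@eq_sqnorm _ _ _ (fourierL1 (fun w => conjc (g w)))).
  rewrite plancherel_L1; last exact: L1_conj.
  by apply: eq_sqnorm => x _; rewrite normc_conj.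
by move=> x _; rewrite normc_conj.
Qed.

(** With $u$ the inverse transform of $g$, Fubini gives
    $\langle \hat h, g\rangle = \langle h, u\rangle$ first for $h$ in
    $L^1 \cap L^2$, then for $h = u$; hence
    $\|\hat u - g\|^2 = \|u\|^2 + \|g\|^2 - 2\|u\|^2 = 0$. *)
Lemma is_fourier_inverseF g : L1 setT g -> L2 setT g -> is_fourier (inverseF g) g.
Proof.
move=> g1 g2; set u := inverseF g; have u2 : L2 setT u by exact: L2_inverseF.
have uf := fourierP u2; have U2 : L2 setT (fourier u) := uf.1.
have gc2 := L2_conj g2; have uc2 := L2_conj u2.
have E : cintegral setT (fun w => fourier u w * conjc (g w)) =
         cintegral setT (fun x => u x * conjc (u x)).
  have [_ [h [hL hf hg]]] := uf.
  have H2 n : L2 setT (fourierL1 (h n)).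
    by apply: L2_fourierL1; [exact: (hL n).1|exact: (hL n).2].
  have eqn n : cintegral setT (fun w => fourierL1 (h n) w * conjc (g w)) =
      cintegral setT (fun x => h n x * conjc (u x)).
    rewrite fourierL1_mul; [|exact: (hL n).1|exact: L1_conj].
    by apply: eq_cintegral => x _; rewrite /u /inverseF conjcK.
  apply/eqP; rewrite -subr_eq0 -normc_eq0 eq_le normc_ge0 andbT.
  apply/ler_addgt0Pr => e e0; rewrite add0r.
  have e2 : 0 < e / 2 by rewrite divr_gt0.
  have A := cvg_cintegralM eventually_filter mT H2 U2 gc2 hg e2.
  have B := cvg_cintegralM eventually_filter mT (fun n => (hL n).2) u2 uc2 hf e2.
  have [n [An Bn]] := filter_ex (filterI A B).
  rewrite eqn in An; apply/ltW; rewrite [e]splitr.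
  move: An Bn; set a := cintegral _ _; set b := cintegral _ _; set c := cintegral _ _.
  move=> An Bn; rewrite (_ : b - c = (b - a) + (a - c)); last by ring.
  by apply: (le_lt_trans (le_normcD _ _)); rewrite ltrD// normcB_sym.
apply: (is_fourier_ae uf g2.1); apply/(sqnormB_eq0P U2.1 g2.1).
have := Re_inner mT U2 (L2N g2).
rewrite sqnormN (is_fourier_isometry u2 uf).
rewrite (@eq_cintegral _ _ _ (fun x => - (fourier u x * conjc (g x)))); last first.
  by move=> x _; rewrite rmorphN mulrN.
rewrite (cintegralN mT); last exact: L2M.
rewrite E ReN; have := sqnorm_cintegral mT u2; rewrite (sqnorm_inverseF g1) => su.
have du : L2 setT (fun x => fourier u x - g x) by exact: L2B.
rewrite (L2_sqnormE du) su /fine; move: (complex.Re _) => r.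
by move=> /= H; congr _%:E; lra.
Qed.

(** The set where they differ is open, and balls have positive measure. *)
Lemma ccontinuous_ae_eq f g : ccontinuous f -> ccontinuous g ->
  {ae mu, forall x, f x = g x} -> f =1 g.
Proof.
move=> cf cg [A [mA A0 sA]] x; apply: contrapT => fgx.
pose d x := normc (f x - g x).
have d0 : 0 < d x by rewrite lt_neqAle normc_ge0 andbT eq_sym normc_eq0 subr_eq0; exact/eqP.
have cd : \forall y \near x, f y != g y.
  have d2 : 0 < d x / 2 by rewrite divr_gt0.
  have /cvgcP/(_ _ d2) F := cf x; have /cvgcP/(_ _ d2) G := cg x.
  near=> y; apply/eqP => fgy.
  have Fy : normc (f y - f x) < d x / 2 by near: y.
  have Gy : normc (g y - g x) < d x / 2 by near: y.
  have : d x < d x.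
    rewrite {1}/d (_ : f x - g x = - (f y - f x) + (g y - g x)); last by rewrite fgy; ring.
    by apply: (le_lt_trans (le_normcD _ _)); rewrite normcN [ltRHS]splitr ltrD.
  by rewrite ltxx.
have [r /= r0 Br] := cd.
have : (mu (ball x r) <= mu A)%E.
  apply: le_measure; rewrite ?inE//; first exact: measurable_ball.
  by move=> y /Br/eqP fy; apply: sA.
rewrite [X in (_ <= X)%E -> _]A0 lebesgue_measure_ball; last exact: ltW.
by rewrite leNgt lte_fin mulrn_wgt0.
Unshelve. all: by end_near. Qed.

(** Both sides are continuous and have the same transform. *)
Lemma classU_inversion f : classU f -> f =1 inverseF (fourier f).
Proof.
move=> [cf f2 F1]; have ff := fourierP f2.
apply: (ccontinuous_ae_eq cf (ccontinuous_inverseF F1)).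
apply: (is_fourier_inj f2 (L2_inverseF F1 ff.1) ff (is_fourier_inverseF F1 ff.1)).
exact: aeT.
Qed.

Lemma is_fourier_classU g : L1 setT g -> L2 setT g -> classU (inverseF g).
Proof.
move=> g1 g2; have u2 := L2_inverseF g1 g2; have uf := is_fourier_inverseF g1 g2.
have E := is_fourier_unique u2 (fourierP u2) uf.
split=> //; first exact: ccontinuous_inverseF.
apply: (L1_ae mT (fourierP u2).1.1 _ g1).
by apply: (aeS E) => x ->.
Qed.

End FourierL2.

(** * Fibers of shift-invariant spaces *)
Section Fibers.
Context {R : realType}.
Local Notation mu := (@lebesgue_measure R).
Local Notation I := (`[0%R, 1%R]%classic : set R).
Implicit Types (f g h s S C : R -> R[i]) (c : int -> R[i]).
Let mT := @mTR R.

(** For $S=\hat f$ this is the Grammian; [gram f] is convertible to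
    [fiber_sq (fourier f)]. *)
Definition fiber_sq S (w : R) : \bar R :=
  \esum_(k in [set: int]) (normc (S (w + k%:~R)) ^+ 2)%:E.

Definition fiber_supp S : set R := [set w | (0 < fiber_sq S w)%E].

Definition periodic1 (T : Type) (C : R -> T) := forall w, C (w + 1) = C w.

Lemma fiber_sq_ge0 S w : (0 <= fiber_sq S w)%E.
Proof. exact: esum_ge0. Qed.
Hint Resolve fiber_sq_ge0 : core.

Lemma measurable_fiber_sq D S : cmeasurable S -> measurable_fun D (fiber_sq S).
Proof.
move=> mS; apply: emeasurable_esum_int => // k; apply: emeasurable_normc2.
exact: cmeasurable_shift.
Qed.

Lemma measurable_fiber_supp S : cmeasurable S -> measurable (fiber_supp S).
Proof.
move=> mS; rewrite -[X in measurable X]setTI.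
by apply: emeasurable_fun_o_infty => //; exact: measurable_fiber_sq.
Qed.

Lemma fiber_sq_int S w (k : int) : fiber_sq S (w + k%:~R) = fiber_sq S w.
Proof. exact: (esum_periodic (fun x => (normc (S x) ^+ 2)%:E)). Qed.

Lemma fiber_sq_periodic S : periodic1 (fiber_sq S).
Proof. by move=> w; have := fiber_sq_int S w 1. Qed.

Lemma fiber_sq_ae S S' : {ae mu, forall w, S w = S' w} ->
  {ae mu, forall w, fiber_sq S w = fiber_sq S' w}.
Proof.
move=> SS'; apply: (aeS (ae_int (fun k => ae_shift k%:~R SS'))) => w E.
by apply: eq_esum => k _; rewrite E.
Qed.

Lemma fiber_sqM C S w : periodic1 C ->
  fiber_sq (fun w => C w * S w) w = ((normc (C w) ^+ 2)%:E * fiber_sq S w)%E.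
Proof.
move=> pC; rewrite /fiber_sq -esumZ ?sqr_ge0//; apply: eq_esum => k _.
by rewrite normcM exprMn (periodic_int pC) EFinM.
Qed.

Lemma fiber_sq_eq0 S w (k : int) : fiber_sq S w = 0%E -> S (w + k%:~R) = 0.
Proof.
move=> S0; have := @sum_le_esum _ (fun k => (normc (S (w + k%:~R)) ^+ 2)%:E) [:: k]
  (fun _ => enormc2_ge0 _) isT.
rewrite big_seq1 -[X in (_ <= X)%E]/(fiber_sq S w) S0 lee_fin => H.
by apply/eqP; rewrite -normc_eq0 -sqrf_eq0 eq_le H sqr_ge0.
Qed.

Lemma fiber_suppPn S w : ~ fiber_supp S w -> fiber_sq S w = 0%E.
Proof. by move=> /negP; rewrite -leNgt => H; apply/eqP; rewrite eq_le H fiber_sq_ge0. Qed.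

Lemma fiber_supp_off S w : ~ fiber_supp S w -> S w = 0.
Proof. by move=> /fiber_suppPn/fiber_sq_eq0 => /(_ 0); rewrite addr0. Qed.

Lemma sqnorm_fiber S : cmeasurable S -> sqnorm setT S = (\int[mu]_(w in I) fiber_sq S w)%E.
Proof. exact: sqnorm_periodize. Qed.

Lemma sqnorm_multiplier C S : cmeasurable C -> cmeasurable S -> periodic1 C ->
  sqnorm setT (fun w => C w * S w) =
  (\int[mu]_(w in I) ((normc (C w) ^+ 2)%:E * fiber_sq S w))%E.
Proof.
move=> mC mS pC; rewrite sqnorm_fiber; last exact: cmeasurableM.
by apply: eq_integral => w _; rewrite fiber_sqM.
Qed.

(** Bounds of the fiber norms on their support; [frame_bracket] and [bracket_frame]
    identify them with frame bounds. *)
Definition bracket S (A B : R) := {ae mu, forall w, (fiber_sq S w <= B%:E)%E /\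
  (fiber_supp S w -> (A%:E <= fiber_sq S w)%E)}.

Lemma measurable_multiplier D C S : cmeasurable C -> cmeasurable S ->
  measurable_fun D (fun w => (normc (C w) ^+ 2)%:E * fiber_sq S w)%E.
Proof.
move=> mC mS; apply: emeasurable_funM; first exact: emeasurable_normc2.
exact: measurable_fiber_sq.
Qed.

Lemma sqnorm_multiplier_le C S (A B : R) : cmeasurable C -> cmeasurable S -> periodic1 C ->
  0 <= B -> bracket S A B ->
  (sqnorm setT (fun w => C w * S w)%R <= B%:E * sqnorm I C)%E.
Proof.
move=> mC mS pC B0 br; rewrite sqnorm_multiplier// /sqnorm -ge0_integralZl ?lee_fin//; last 1 first.
- exact: emeasurable_normc2.
apply: ae_ge0_le_integral => //.
- by move=> w _; rewrite mule_ge0.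
- exact: measurable_multiplier.
- by move=> w _; rewrite mule_ge0.
- by apply: emeasurable_funM => //; exact: emeasurable_normc2.
- by apply: (aeS br) => w [H _] _; rewrite (muleC B%:E); exact: (lee_wpmul2l (enormc2_ge0 _) H).
Qed.

Lemma sqnorm_multiplier_ge C S (A B : R) : cmeasurable C -> cmeasurable S -> periodic1 C ->
  0 <= A -> bracket S A B -> (forall w, ~ fiber_supp S w -> C w = 0) ->
  (A%:E * sqnorm I C <= sqnorm setT (fun w => C w * S w)%R)%E.
Proof.
move=> mC mS pC A0 br C0; rewrite sqnorm_multiplier// /sqnorm -ge0_integralZl ?lee_fin//; last 1 first.
- exact: emeasurable_normc2.
apply: ae_ge0_le_integral => //.
- by move=> w _; rewrite mule_ge0.
- by apply: emeasurable_funM => //; exact: emeasurable_normc2.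
- by move=> w _; rewrite mule_ge0.
- exact: measurable_multiplier.
apply: (aeS br) => w [_ H] _; have [wE|wE] := pselect (fiber_supp S w).
  by rewrite (muleC A%:E); exact: (lee_wpmul2l (enormc2_ge0 _) (H wE)).
by rewrite C0// normc0 expr0n/= mule0 mul0e.
Qed.

(** ** Finite combinations of translates *)

Definition combo s (r : seq int) c (x : R) : R[i] := \sum_(k <- r) c k * translate s k x.

Lemma L2_combo s r c : L2 setT s -> L2 setT (combo s r c).
Proof. by move=> s2; apply: L2_sum => // k; apply: L2Z => //; exact: L2_translate. Qed.

Lemma is_fourier_combo s S r c : L2 setT s -> is_fourier s S ->
  is_fourier (combo s r c) (fun w => tpoly c r w * S w).
Proof.
move=> s2 sS; elim: r => [|k r IH].
  rewrite (_ : combo _ _ _ = fun x => 0); last by apply/funext => x; rewrite /combo big_nil.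
  rewrite [X in is_fourier _ X](_ : _ = fourierL1 (fun _ : R => 0)).
    by apply: is_fourier_L1L2; [exact: L10|exact: L20].
  by apply/funext => w; rewrite /tpoly big_nil mul0r /fourierL1;
    under eq_cintegral do rewrite mul0r; rewrite cintegral0.
rewrite (_ : combo _ _ _ = fun x => combo s r c x + c k * translate s k x); last first.
  by apply/funext => x; rewrite /combo big_cons addrC.
rewrite [X in is_fourier _ X](_ : _ = fun w => tpoly c r w * S w + c k * (e2pi (- (k%:~R * w)) * S w)).
  apply: is_fourier_linear => //; [exact: (L2_combo _ _ s2).1|exact: (L2_translate _ s2).1|].
  exact: is_fourier_translate s2.1.
by apply/funext => w; rewrite /tpoly big_cons; ring.
Qed.

Lemma combo_psum s c p x :
  bilateral_psum (fun k => c k * translate s k x) p = combo s (bwin p) c x.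
Proof. exact: bilateral_psumE. Qed.

(** A list may repeat an index, whereas coefficients are functions of the index:
    repetitions are turned into multiples. *)
Lemma sum_count (F : int -> R[i]) c (r u : seq int) : uniq u -> {subset r <= u} ->
  \sum_(k <- r) c k * F k = \sum_(k <- u) (c k *+ count_mem k r) * F k.
Proof.
move=> uu; elim: r => [|a r IH] ru.
  by rewrite big_nil big1// => k _; rewrite mulr0n mul0r.
rewrite big_cons IH; last by move=> k kr; apply: ru; rewrite inE kr orbT.
under [RHS]eq_bigr => k _ do rewrite /= mulrnDr mulrDl.
rewrite big_split/=; congr (_ + _).
rewrite (bigD1_seq a)//=; last by apply: ru; rewrite inE eqxx.
rewrite eqxx mulr1n big1 ?addr0// => k /negbTE ka.
by rewrite eq_sym ka mulr0n mul0r.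
Qed.

Lemma sum_merge r c r' c' : exists r'' c'', forall F : int -> R[i],
  \sum_(k <- r'') c'' k * F k = \sum_(k <- r) c k * F k + \sum_(k <- r') c' k * F k.
Proof.
exists (undup (r ++ r')), (fun k => c k *+ count_mem k r + c' k *+ count_mem k r') => F.
rewrite (@sum_count _ c r (undup (r ++ r'))) ?undup_uniq//; last first.
  by move=> k kr; rewrite mem_undup mem_cat kr.
rewrite (@sum_count _ c' r' (undup (r ++ r'))) ?undup_uniq//; last first.
  by move=> k kr; rewrite mem_undup mem_cat kr orbT.
by rewrite -big_split; apply: eq_bigr => k _; rewrite mulrDl.
Qed.

Lemma shift_spanP s g : shift_span s g <-> L2 setT g /\ forall e : R, 0 < e ->
  exists r c, (sqnorm setT (fun x => g x - combo s r c x)%R < e%:E)%E.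
Proof. by []. Qed.

Lemma shift_span_self s k : L2 setT s -> shift_span s (translate s k).
Proof.
move=> s2; apply/shift_spanP; split; first exact: L2_translate.
move=> e e0; exists [:: k], (fun _ => 1).
rewrite (@eq_sqnorm _ _ _ (fun _ => 0)) ?sqnorm0// => x _.
by rewrite /combo big_seq1 mul1r subrr.
Qed.

Lemma shift_spanD s g h : L2 setT s -> shift_span s g -> shift_span s h ->
  shift_span s (fun x => g x + h x).
Proof.
move=> s2 /shift_spanP[g2 gs] /shift_spanP[h2 hs]; apply/shift_spanP; split; first exact: L2D.
move=> e e0; have e4 : 0 < e / 4 by rewrite divr_gt0.
have [r [c gc]] := gs _ e4; have [r' [c' hc]] := hs _ e4.
have [r'' [c'' E]] := sum_merge r c r' c'; exists r'', c''.
rewrite (_ : (fun x => _) = (fun x => (g x - combo s r c x) + (h x - combo s r' c' x))); last first.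
  by apply/funext => x; rewrite {1}/combo E -/(combo _ _ _ _) -/(combo _ _ _ _); ring.
apply: (le_lt_trans (sqnormD_le2 mT _ _)).
- by apply: cmeasurableB; [exact: g2.1|exact: (L2_combo _ _ s2).1].
- by apply: cmeasurableB; [exact: h2.1|exact: (L2_combo _ _ s2).1].
exact: lt_quarters.
Qed.

Lemma shift_spanZ s g (a : R[i]) : L2 setT s -> shift_span s g -> shift_span s (fun x => a * g x).
Proof.
move=> s2 /shift_spanP[g2 gs]; apply/shift_spanP; split; first exact: L2Z.
move=> e e0; have M0 : 0 < normc a ^+ 2 + 1 by rewrite ltr_wpDl// sqr_ge0.
have [r [c gc]] := gs _ (divr_gt0 e0 M0); exists r, (fun k => a * c k).
rewrite (_ : (fun x => _) = (fun x => a * (g x - combo s r c x))); last first.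
  apply/funext => x; rewrite mulrBr /combo mulr_sumr; congr (_ - _).
  by apply: eq_bigr => k _; rewrite mulrA.
rewrite sqnormZ//; last by apply: cmeasurableB; [exact: g2.1|exact: (L2_combo _ _ s2).1].
apply: (@le_lt_trans _ _ ((normc a ^+ 2 + 1)%:E * sqnorm setT (fun x => g x - combo s r c x)%R)%E).
  by apply: lee_wpmul2r; rewrite ?sqnorm_ge0// lee_fin lerDl.
by rewrite -lte_pdivlMl// muleC -EFinM.
Qed.

Lemma shift_span0 s : shift_span s (fun _ => 0).
Proof.
apply/shift_spanP; split; first exact: L20.
move=> e e0; exists [::], (fun _ => 0); rewrite (@eq_sqnorm _ _ _ (fun _ => 0)) ?sqnorm0// => x _.
by rewrite /combo big_nil subrr.
Qed.

Lemma shift_span_combo phi s r c : L2 setT phi -> (forall k, shift_span phi (translate s k)) ->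
  shift_span phi (combo s r c).
Proof.
move=> p2 sk; elim: r => [|k r IH].
  rewrite (_ : combo _ _ _ = fun x => 0); first exact: shift_span0.
  by apply/funext => x; rewrite /combo big_nil.
rewrite (_ : combo _ _ _ = fun x => c k * translate s k x + combo s r c x).
  by apply: shift_spanD => //; exact: shift_spanZ.
by apply/funext => x; rewrite /combo big_cons.
Qed.

(** ** Series of translates *)

(** The upper fiber bound transfers convergence of the Fourier series of [z] from the
    circle to the line. *)
Lemma tpoly_multiplier_cvg c z S (A B : R) : cmeasurable S -> 0 <= B -> bracket S A B ->
  is_fourier_series c z ->
  sqnorm setT (fun w => tpoly c (bwin p) w * S w - z w * S w) @[p --> (\oo, \oo)] --> 0%E.
Proof.
move=> mS B0 br cz; have [mz pz _] := cz.
have pt p : periodic1 (tpoly c (bwin p)) by apply: trig_periodic; exact: trig_tpoly.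
have mt p : cmeasurable (tpoly c (bwin p)) by apply: trig_cmeasurable; exact: trig_tpoly.
apply: (cvge0_lin (a := B) (b := 0) _ _ _ _ _ _ _ (fourier_series_tpoly cz) (fourier_series_tpoly cz)) => //.
- by move=> p; exact: sqnorm_ge0.
- by move=> p; exact: sqnorm_ge0.
- by move=> p; exact: sqnorm_ge0.
move=> p; rewrite mul0e adde0; under eq_fun do rewrite -mulrBl.
apply: (sqnorm_multiplier_le _ mS _ B0 br); first exact: cmeasurableB.
by move=> w; rewrite pt pz.
Qed.

Lemma series_L2_cvg s S g c z (A B : R) : L2 setT s -> L2 setT g -> is_fourier s S ->
  is_fourier g (fun w => z w * S w) -> 0 <= B -> bracket S A B -> is_fourier_series c z ->
  sqnorm setT (fun x => bilateral_psum (fun k => c k * translate s k x) p - g x)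
    @[p --> (\oo, \oo)] --> 0%E.
Proof.
move=> s2 g2 sS gS B0 br cz.
under eq_fun do under [X in sqnorm _ X]eq_fun do rewrite combo_psum.
under eq_fun do rewrite -(is_fourier_dist (L2_combo _ _ s2) g2 (is_fourier_combo _ _ s2 sS) gS).
exact: (tpoly_multiplier_cvg sS.1.1 B0 br cz).
Qed.

Lemma shift_span_series s g c : L2 setT s -> L2 setT g ->
  sqnorm setT (fun x => bilateral_psum (fun k => c k * translate s k x) p - g x)
    @[p --> (\oo, \oo)] --> 0%E -> shift_span s g.
Proof.
move=> s2 g2 /(cvge0P _ (fun p => sqnorm_ge0 _ _)) H; apply/shift_spanP; split => // e e0.
have [p Hp] := filter_ex (H _ e0); exists (bwin p), c.
by rewrite sqnormB_sym; under eq_fun do rewrite -combo_psum.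
Qed.

(** The lower bound on the fibers turns convergence of $P_n \hat s$ into
    convergence of the trigonometric polynomials $P_n$ cut off outside the support;
    the limit is taken pointwise from the sequence, so it inherits periodicity. *)
Lemma shift_span_multiplier s S g (A B : R) : L2 setT s -> is_fourier s S -> 0 < A -> 0 <= B ->
  bracket S A B -> shift_span s g -> exists C, [/\ L2 I C, periodic1 C,
    forall w, ~ fiber_supp S w -> C w = 0 & is_fourier g (fun w => C w * S w)].
Proof.
move=> s2 sS A0 B0 br /shift_spanP[g2 gs]; have mS := sS.1.1.
have mE := measurable_fiber_supp mS; set E := fiber_supp S in mE *.
have pE w : (w + 1 \in E) = (w \in E).
  by apply/idP/idP; rewrite !inE /E /fiber_supp /= fiber_sq_periodic.
have inv0 n : 0 < (n.+1%:R^-1 : R) by rewrite invr_gt0 ltr0n.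
have /choice[rc Hrc] n : exists q : seq int * (int -> R[i]),
    (sqnorm setT (fun x => g x - combo s q.1 q.2 x)%R < (n.+1%:R^-1)%:E)%E.
  by have [r [c H]] := gs _ (inv0 n); exists (r, c).
pose P n := tpoly (rc n).2 (rc n).1; pose D n w := ind E w * P n w.
have gcv : sqnorm setT (fun x => combo s (rc n).1 (rc n).2 x - g x) @[n --> \oo] --> 0%E.
  apply/cvge0P => [n|e e0]; first exact: sqnorm_ge0.
  exists (Num.truncn e^-1) => // n /= en; rewrite sqnormB_sym; apply: (lt_trans (Hrc n)).
  rewrite lte_fin invf_plt ?posrE//; apply: (lt_le_trans (truncnS_gt _)).
  by rewrite ler_nat.
have mP n : cmeasurable (P n) by apply: trig_cmeasurable; exact: trig_tpoly.
have pP n : periodic1 (P n) by apply: trig_periodic; exact: trig_tpoly.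
have mD n : cmeasurable (D n) by apply: cmeasurableM => //; exact: cmeasurable_ind.
have pD n : periodic1 (D n) by move=> w; rewrite /D !indE pE pP.
have DS n w : D n w * S w = P n w * S w.
  rewrite /D indE; have [wE|] := boolP (w \in E); first by rewrite mul1r.
  by rewrite notin_setE => /fiber_supp_off ->; rewrite !mulr0.
have D2 n : L2 I (D n).
  have [M PM] := trig_bounded (trig_tpoly (rc n).2 (rc n).1).
  apply: (L2_bounded (M := M)) => // w; rewrite /D normcM -[leRHS]mul1r.
  exact: (ler_pM (normc_ge0 _) (normc_ge0 _) (normc_ind _ _) (PM _)).
have D0 n w : ~ E w -> D n w = 0.
  by move=> wE; rewrite /D indE ifN ?mul0r// notin_setE.
have gS n : is_fourier (combo s (rc n).1 (rc n).2) (fun w => D n w * S w).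
  by under eq_fun do rewrite DS; exact: is_fourier_combo.
have dist m n : (A%:E * sqnorm I (fun w => D m w - D n w)%R <=
    sqnorm setT (fun x => combo s (rc m).1 (rc m).2 x - combo s (rc n).1 (rc n).2 x)%R)%E.
  rewrite -(is_fourier_dist (L2_combo _ _ s2) (L2_combo _ _ s2) (gS m) (gS n)).
  under [X in (_ <= sqnorm _ X)%E]eq_fun do rewrite -mulrBl.
  apply: (sqnorm_multiplier_ge _ mS _ (ltW A0) br); first exact: cmeasurableB.
    by move=> w; rewrite !pD.
  by move=> w wE; rewrite !D0// subrr.
have cau (e : R) : 0 < e -> exists N, forall m n, (N <= m)%N -> (N <= n)%N ->
    (sqnorm I (fun w => D m w - D n w)%R < e%:E)%E.
  move=> e0; have e4 : 0 < A * e / 4 by rewrite divr_gt0// mulr_gt0.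
  move/(cvge0P _ (fun n => sqnorm_ge0 _ _)) : (gcv) => /(_ _ e4)[N _ HN].
  exists N => m n Nm Nn; rewrite -(@lte_pmul2l _ A%:E)// -EFinM; apply: (le_lt_trans (dist m n)).
  apply: (le_lt_trans (sqnorm_triangle mT _ g2.1 _)); [exact: (L2_combo _ _ s2).1|exact: (L2_combo _ _ s2).1|].
  by apply: lt_quarters; [exact: HN|rewrite sqnormB_sym; exact: HN].
have [Phi [C2 Ccv]] := L2_complete (@mI R) D2 cau.
set C0 := (fun w => Phi (D^~ w)) in C2 Ccv.
have pC0 : periodic1 C0.
  by move=> w; rewrite /C0; congr (Phi _); apply/funext => n; exact: pD.
have mC : cmeasurable (fun w => ind E w * C0 w).
  by apply: cmeasurableM; [exact: cmeasurable_ind|exact: C2.1].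
have pC : periodic1 (fun w => ind E w * C0 w) by move=> w; rewrite /= !indE pE pC0.
exists (fun w => ind E w * C0 w); split => //.
- apply: (L2M_bnd (M := 1)) => //; first exact: cmeasurable_ind.
  by move=> w _; exact: normc_ind.
- by move=> w wE; rewrite indE ifN ?mul0r// notin_setE.
apply: (is_fourier_lim (F := \oo) _ (fun n => L2_combo _ _ s2) g2 gS _ gcv); first exact: cmeasurableM.
apply: (cvge0_lin (a := B) (b := 0) _ _ _ _ _ _ _ Ccv Ccv) => //.
- by move=> p; exact: sqnorm_ge0.
- by move=> p; exact: sqnorm_ge0.
- by move=> p; exact: sqnorm_ge0.
move=> n; rewrite mul0e adde0; under eq_fun do rewrite -mulrBl.
apply: (le_trans (sqnorm_multiplier_le _ mS _ B0 br)).
- exact: cmeasurableB.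
- by move=> w; rewrite pD pC.
apply: lee_wpmul2l => //; apply: sqnorm_le => //.
- exact: cmeasurableB.
- by apply: cmeasurableB => //; exact: C2.1.
move=> w _; rewrite (_ : D n w - _ = ind E w * (D n w - C0 w)).
  rewrite normcM -[leRHS]mul1r; apply: ler_wpM2r => //; exact: normc_ind.
by rewrite /D indE; case: ifP => _; ring.
Qed.

End Fibers.

(** * Frames of translates *)
Section Frames.
Context {R : realType}.
Local Notation mu := (@lebesgue_measure R).
Local Notation I := (`[0%R, 1%R]%classic : set R).
Implicit Types (f g h s S C P : R -> R[i]) (c : int -> R[i]) (V : set (R -> R[i])).
Let mT := @mTR R.

Lemma trigP P : trig P -> exists r c, P = tpoly c r.
Proof.
elim=> [k a|P1 P2 _ [r [c ->]] _ [r' [c' ->]]].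
  exists [:: - k], (fun _ => a); apply/funext => w.
  by rewrite /tpoly big_seq1 mulrNz mulNr opprK.
have [r'' [c'' E]] := sum_merge r c r' c'; exists r'', c''.
by apply/funext => w; rewrite /tpoly E.
Qed.

Lemma integrable_ge0 (u : R -> R) : measurable_fun setT u -> (forall w, 0 <= u w) ->
  (\int[mu]_(w in I) (u w)%:E < +oo)%E -> mu.-integrable I (EFin \o u).
Proof.
move=> mu_ u0 ulty; apply/integrableP; split.
  by apply/measurable_EFinP; exact: measurable_funTS.
by under eq_integral do rewrite /= ger0_norm//.
Qed.

Lemma trig_le (u v : R -> R) : measurable_fun setT u -> measurable_fun setT v ->
  (forall w, 0 <= u w) -> (forall w, 0 <= v w) ->
  (\int[mu]_(w in I) (u w)%:E < +oo)%E -> (\int[mu]_(w in I) (v w)%:E < +oo)%E ->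
  (forall P, trig P -> \int[mu]_(w in I) (normc (P w) ^+ 2 * u w)%:E <=
                       \int[mu]_(w in I) (normc (P w) ^+ 2 * v w)%:E)%E ->
  {ae mu, forall w, I w -> u w <= v w}.
Proof.
move=> mu_ mv u0 v0 ulty vlty H.
have iu := integrable_ge0 mu_ u0 ulty; have iv := integrable_ge0 mv v0 vlty.
have key (x : R -> R) P : measurable_fun setT x -> (forall w, 0 <= x w) ->
    (\int[mu]_(w in I) (x w)%:E < +oo)%E -> trig P ->
    mu.-integrable I (EFin \o (fun w => normc (P w) ^+ 2 * x w)).
  move=> mx x0 xlty tP; have [M PM] := trig_bounded tP.
  have mPx : measurable_fun setT (fun w => normc (P w) ^+ 2 * x w).
    by apply: measurable_funM => //; apply: measurable_normc2; exact: trig_cmeasurable.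
  apply: integrable_ge0 => // [w|]; first by rewrite mulr_ge0// sqr_ge0.
  apply: (@le_lt_trans _ _ ((M ^+ 2)%:E * \int[mu]_(w in I) (x w)%:E)%E).
    rewrite -ge0_integralZl ?lee_fin ?sqr_ge0//; last 2 first.
    - by apply/measurable_EFinP; exact: measurable_funTS.
    - by move=> w _; rewrite lee_fin.
    apply: ge0_le_integral => //.
    - by move=> w _; rewrite lee_fin mulr_ge0// sqr_ge0.
    - by apply/measurable_EFinP; exact: measurable_funTS.
    - apply/measurable_EFinP; apply: measurable_funM => //; exact: measurable_funTS.
    - move=> w _; rewrite -EFinM lee_fin ler_wpM2r// ler_pXn2r ?nnegrE ?normc_ge0//.
      exact: le_trans (PM w).
  by rewrite lte_mul_pinfty// ?lee_fin ?sqr_ge0.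
have mvu : measurable_fun setT (fun w => v w - u w) by exact: measurable_funB.
have ivu : mu.-integrable I (EFin \o (fun w => v w - u w)) 
  by rewrite (_ : EFin \o _ = (EFin \o v) \- (EFin \o u))%E; [exact: integrableB|].
have := trig_positive mvu ivu; case=> [P tP|].
  have kv := key v P mv v0 vlty tP; have ku := key u P mu_ u0 ulty tP.
  under [X in Rintegral _ _ X]eq_fun do rewrite mulrBr.
  rewrite RintegralB// subr_ge0 /Rintegral fine_le//; [exact: integrable_fin_num|exact: integrable_fin_num|exact: H].
by move=> N HN; exists N; move: HN => [? ? sN]; split => // w /= Hw; apply: sN => /= Hw';
  apply: Hw => Iw; rewrite -subr_ge0; exact: Hw'.
Qed.

(** With $g$ and $s$ on the Fourier side, $\langle g, s(\cdot-k)\rangle$ is a Fourier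
    coefficient of the periodization of $C|\hat s|^2$, that is of $C$ times the fiber
    norm of $s$. *)
Lemma frame_sum s S g C : L2 setT s -> L2 setT g -> is_fourier s S ->
  is_fourier g (fun w => C w * S w) -> cmeasurable C -> periodic1 C ->
  \esum_(k in [set: int]) (normc (inner g (translate s k)) ^+ 2)%:E =
  (\int[mu]_(w in I) ((normc (C w) ^+ 2)%:E * (fiber_sq S w * fiber_sq S w)))%E.
Proof.
move=> s2 g2 sS gS mC pC; have mS := sS.1.1.
pose W w := S w * conjc (S w); have W1 : L1 setT W by apply: L2M sS.1 (L2_conj sS.1).
pose F w := W w * C w.
have F1 : L1 setT F.
  have := L2M mT gS.1 (L2_conj sS.1); rewrite (_ : (fun x => _) = F)//.
  by apply/funext => w; rewrite /F /W; ring.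
have aW w : abs_per W w = fiber_sq S w.
  by apply: eq_esum => k _; rewrite /W normcM normc_conj -expr2.
have coef k : fcoef (perz F) k = inner g (translate s k).
  rewrite perz_coef// (is_fourier_inner g2 (L2_translate k s2) gS (is_fourier_translate k sS s2.1)).
  apply: eq_cintegral => w _; rewrite conjcM -e2piN opprK /F /W; ring.
have [p1 _] := perz_cintegral F1.
under eq_esum do rewrite -coef; rewrite (parseval p1) /sqnorm.
have mf : measurable_fun I (fiber_sq S) by exact: measurable_fiber_sq.
apply: ge0_ae_eq_integral => //.
- exact: emeasurable_normc2 p1.1.
- by apply: emeasurable_funM; [exact: emeasurable_normc2|exact: emeasurable_funM].
- by move=> w _; rewrite !mule_ge0// fiber_sq_ge0.
apply: (aeS (abs_per_lty W1)) => w fin _; rewrite /F perzM//.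
have -> : perz W w = (fine (fiber_sq S w))%:C.
  rewrite /perz fin (_ : (fun k => _) = fun k : int => (normc (S (w + k%:~R)) ^+ 2)%:C).
    by apply: csum_real => [k|]; [exact: sqr_ge0|rewrite aW in fin].
  by apply/funext => k; rewrite /W mul_conjc.
rewrite aW in fin.
have finS : fiber_sq S w \is a fin_num by rewrite ge0_fin_numE// fiber_sq_ge0.
by rewrite -{2 3}(fineK finS) normcM exprMn sqr_normc_real -!EFinM mulrC -expr2.
Qed.

Lemma bracket_periodic S (A B : R) :
  {ae mu, forall w, I w -> (fiber_sq S w <= B%:E)%E /\
                    (fiber_supp S w -> (A%:E <= fiber_sq S w)%E)} -> bracket S A B.
Proof.
apply: ae_periodic => w k; rewrite /fiber_supp /= fiber_sq_int; exact.
Qed.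

(** Testing the frame inequalities on $\sum_k c_k s(\cdot-k)$ gives
    $A\int|P|^2G \le \int|P|^2G^2 \le B\int|P|^2G$ for all trigonometric polynomials
    $P$, where $G$ is the fiber norm; hence $AG \le G^2 \le BG$. *)
Lemma frame_bracket s V : L2 setT s -> is_frame s V -> (forall r c, V (combo s r c)) ->
  exists A B : R, [/\ 0 < A, 0 < B & bracket (fourier s) A B].
Proof.
move=> s2 [_ [A [B [A0 B0 fr]]]] Vc; exists A, B; split => //.
have sS := fourierP s2; set S := fourier s in sS *; have mS := sS.1.1.
pose G w := fine (fiber_sq S w).
have G0 w : 0 <= G w by apply: fine_ge0; exact: fiber_sq_ge0.
have mG : measurable_fun setT G.
  by apply: measurableT_comp; [exact: fine_measurable|exact: measurable_fiber_sq].
have fin : {ae mu, forall w, fiber_sq S w = (G w)%:E}.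
  pose W w := S w * conjc (S w); have W1 : L1 setT W by apply: L2M sS.1 (L2_conj sS.1).
  apply: (aeS (abs_per_lty W1)) => w H; rewrite /G fineK// ge0_fin_numE ?fiber_sq_ge0//.
  apply: le_lt_trans H; rewrite le_eqVlt; apply/orP; left; apply/eqP.
  by apply: eq_esum => k _; rewrite /W normcM normc_conj -expr2.
have fr1 P : trig P ->
    ((A%:E * \int[mu]_(w in I) (normc (P w) ^+ 2 * G w)%:E <=
       \int[mu]_(w in I) (normc (P w) ^+ 2 * G w ^+ 2)%:E) /\
     (\int[mu]_(w in I) (normc (P w) ^+ 2 * G w ^+ 2)%:E <=
       B%:E * \int[mu]_(w in I) (normc (P w) ^+ 2 * G w)%:E) /\
     \int[mu]_(w in I) (normc (P w) ^+ 2 * G w)%:E < +oo)%E.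
  move=> /[dup] tP /trigP[r [c EP]].
  have mP := trig_cmeasurable tP; have pP : periodic1 P := trig_periodic tP.
  have mP2 : measurable_fun setT (fun w => normc (P w) ^+ 2) by exact: measurable_normc2.
  have c2 := L2_combo r c s2.
  have gS : is_fourier (combo s r c) (fun w => P w * S w) by rewrite EP; exact: is_fourier_combo.
  have E1 : sqnorm setT (combo s r c) = (\int[mu]_(w in I) (normc (P w) ^+ 2 * G w)%:E)%E.
    rewrite -(is_fourier_isometry c2 gS) sqnorm_multiplier//; apply: ge0_ae_eq_integral => //.
    - exact: measurable_multiplier.
    - by apply/measurable_EFinP; apply: measurable_funTS; exact: measurable_funM.
    - by move=> w _; rewrite mule_ge0// fiber_sq_ge0.
    - by move=> w _; rewrite lee_fin mulr_ge0// sqr_ge0.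
    - by apply: (aeS fin) => w -> _; rewrite EFinM.
  have E2 : \esum_(k in [set: int]) (normc (inner (combo s r c) (translate s k)) ^+ 2)%:E =
      (\int[mu]_(w in I) (normc (P w) ^+ 2 * G w ^+ 2)%:E)%E.
    rewrite (frame_sum s2 c2 sS gS mP pP); apply: ge0_ae_eq_integral => //.
    - apply: emeasurable_funM; first exact: emeasurable_normc2.
      by apply: emeasurable_funM; exact: measurable_fiber_sq.
    - apply/measurable_EFinP; apply: measurable_funTS; apply: measurable_funM => //.
      exact: measurable_funX.
    - by move=> w _; rewrite !mule_ge0// fiber_sq_ge0.
    - by move=> w _; rewrite lee_fin mulr_ge0// sqr_ge0.
    - by apply: (aeS fin) => w -> _; rewrite -!EFinM expr2.
  have [f1 f2] := fr _ (Vc r c); rewrite E1 E2 in f1 f2; split => //; split => //.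
  by rewrite -E1; exact: c2.2.
have one w : normc (1 : R[i]) ^+ 2 * w = w :> R by rewrite normc1 expr1n mul1r.
have [l1 [l2 l3]] := fr1 _ (trig_cst 1).
have G1 : (\int[mu]_(w in I) (G w)%:E < +oo)%E.
  by under eq_integral do rewrite -(one (G _)).
have G2 : (\int[mu]_(w in I) (G w ^+ 2)%:E < +oo)%E.
  under eq_integral do rewrite -(one (G _ ^+ 2)).
  by apply: (le_lt_trans l2); rewrite lte_mul_pinfty// lee_fin ltW.
have mG2 : measurable_fun setT (fun w => G w ^+ 2) by exact: measurable_funX.
have intZ (a : R) P : trig P -> 0 < a ->
    (\int[mu]_(w in I) (normc (P w) ^+ 2 * (a * G w))%:E =
     a%:E * \int[mu]_(w in I) (normc (P w) ^+ 2 * G w)%:E)%E.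
  move=> tP a0; rewrite -ge0_integralZl ?lee_fin ?(ltW a0)//.
  - by apply: eq_integral => w _; rewrite -EFinM; congr _%:E; ring.
  - apply/measurable_EFinP; apply: measurable_funTS; apply: measurable_funM => //.
    by apply: measurable_normc2; exact: trig_cmeasurable.
  - by move=> w _; rewrite lee_fin mulr_ge0// sqr_ge0.
have aG (a : R) : 0 < a -> (\int[mu]_(w in I) (a * G w)%:E < +oo)%E.
  move=> a0; under eq_integral do rewrite -(one (a * G _)).
  by rewrite (intZ a _ (trig_cst 1) a0) lte_mul_pinfty// lee_fin ltW.
have mZ (a : R) : measurable_fun setT (fun w => a * G w) by exact: measurable_funM.
have lo : {ae mu, forall w, I w -> A * G w <= G w ^+ 2}.
  apply: trig_le => //; [by move=> w; rewrite mulr_ge0// ltW|by move=> w; rewrite sqr_ge0|exact: aG|].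
  by move=> P tP; rewrite intZ//; case: (fr1 P tP).
have hi : {ae mu, forall w, I w -> G w ^+ 2 <= B * G w}.
  apply: trig_le => //; [by move=> w; rewrite sqr_ge0|by move=> w; rewrite mulr_ge0// ltW|exact: aG|].
  by move=> P tP; rewrite intZ//; case: (fr1 P tP) => _ [].
apply: bracket_periodic; apply: (aeS (aeI fin (aeI lo hi))) => w [fw [lw hw]] Iw.
have {}lw := lw Iw; have {}hw := hw Iw; rewrite /fiber_supp /= fw !lte_fin !lee_fin.
split => [|Gw]; last by move: lw; rewrite expr2 ler_pM2r.
have [->|Gw] := eqVneq (G w) 0; first exact: ltW.
by move: hw; rewrite expr2 ler_pM2r// lt_neqAle eq_sym Gw G0.
Qed.

Lemma frame_bracket_span s phi : L2 setT phi -> L2 setT s -> is_frame s (shift_span phi) ->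
  exists A B : R, [/\ 0 < A, 0 < B & bracket (fourier s) A B].
Proof.
move=> p2 s2 fr; apply: (frame_bracket s2 fr) => r c; apply: shift_span_combo => //.
exact: fr.1.
Qed.

(** Writing $g$ as $C\hat s$ on the Fourier side, the two sides of the frame inequality
    are $\int|C|^2G$ and $\int|C|^2G^2$, and $AG \le G^2 \le BG$ pointwise. *)
Lemma bracket_frame s S (A B : R) : L2 setT s -> is_fourier s S -> 0 < A -> 0 < B ->
  bracket S A B -> is_frame s (shift_span s).
Proof.
move=> s2 sS A0 B0 br; have mS := sS.1.1; split; first by move=> k; exact: shift_span_self.
exists A, B; split => // g gs; have g2 : L2 setT g := gs.1.
have [C [C2 pC C0 gS]] := shift_span_multiplier s2 sS A0 (ltW B0) br gs.
have mC := C2.1; rewrite (frame_sum s2 g2 sS gS mC pC) -(is_fourier_isometry g2 gS) sqnorm_multiplier//.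
have mm : measurable_fun I (fun w => (normc (C w) ^+ 2)%:E * fiber_sq S w)%E.
  exact: measurable_multiplier.
have mf : measurable_fun I (fiber_sq S) by exact: measurable_fiber_sq.
have m0 w : (0 <= (normc (C w) ^+ 2)%:E * fiber_sq S w)%E by exact: mule_ge0 (enormc2_ge0 _) (fiber_sq_ge0 _ _).
under [X in (_ <= X)%E /\ (X <= _)%E]eq_integral do rewrite muleA.
rewrite -!ge0_integralZl ?lee_fin ?(ltW A0) ?(ltW B0)//.
split; apply: ae_ge0_le_integral => //.
- by move=> w _; rewrite mule_ge0// lee_fin ltW.
- exact: emeasurable_funM.
- by move=> w _; rewrite mule_ge0// fiber_sq_ge0.
- exact: emeasurable_funM.
- apply: (aeS br) => w [_ H] _; have [wE|wE] := pselect (fiber_supp S w).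
    by rewrite muleC; apply: lee_wpmul2l => //; exact: H.
  by rewrite C0// normc0 expr0n/= !mul0e mule0.
- by move=> w _; rewrite mule_ge0// fiber_sq_ge0.
- exact: emeasurable_funM.
- by move=> w _; rewrite mule_ge0// lee_fin ltW.
- exact: emeasurable_funM.
- by apply: (aeS br) => w [H _] _; rewrite (muleC B%:E); apply: lee_wpmul2l.
Qed.

End Frames.

(** * Samples and the Zak transform *)
Section Samples.
Context {R : realType}.
Local Notation mu := (@lebesgue_measure R).
Local Notation I := (`[0%R, 1%R]%classic : set R).
Implicit Types (f g h s S C F : R -> R[i]) (c : int -> R[i]).
Let mT := @mTR R.

(** The product $F(\omega)e^{2\pi i x\omega}$, whose periodization is, up to a phase,
    the Zak transform of $F$. *)
Definition modulate F (x : R) : R -> R[i] := fun w => F w * e2pi (x * w).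

Lemma L1_modulate F x : L1 setT F -> L1 setT (modulate F x).
Proof. by move=> F1; apply: L1e2pi => //; exact: measurable_mull. Qed.

Lemma abs_per_modulate F x w : abs_per (modulate F x) w = abs_per F w.
Proof. by apply: eq_esum => k _; rewrite /modulate normcM normc_e2pi mulr1. Qed.

Lemma sample_coef F x n : L1 setT F -> fcoef (perz (modulate F x)) n = inverseF F (x + n%:~R).
Proof.
move=> F1; rewrite perz_coef; last exact: L1_modulate.
rewrite inverseFE//; apply: eq_cintegral => w _.
by rewrite /modulate -mulrA -e2piD; congr (_ * e2pi _); ring.
Qed.

Lemma sample_coef0 F n : L1 setT F -> fcoef (perz F) n = inverseF F n%:~R.
Proof.
move=> F1; rewrite (_ : perz F = perz (modulate F 0)) ?sample_coef ?add0r//.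
congr perz; apply/funext => w; by rewrite /modulate mul0r e2pi0 mulr1.
Qed.

(** Parseval for the periodization of the modulated transform. *)
Lemma sample_sq F x : L1 setT F ->
  \esum_(k in [set: int]) (normc (inverseF F (x + k%:~R)) ^+ 2)%:E = sqnorm I (perz (modulate F x)).
Proof.
move=> F1; have [p1 _] := perz_cintegral (L1_modulate x F1).
by rewrite -(parseval p1); apply: eq_esum => k _; rewrite sample_coef.
Qed.

(** The sums differ by the factor $e^{2\pi ix\omega}$ only. *)
Lemma zak_perz F x w : (abs_per F w < +oo)%E -> normc (zak F w (- x)) = normc (perz (modulate F x) w).
Proof.
move=> fin; rewrite /perz abs_per_modulate fin.
rewrite -[LHS]mul1r -[X in X * _ = _](normc_e2pi (x * w)) -normcM /zak -csumZ; last first.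
  by apply: summable_c_le fin _ => k; rewrite normcM normc_e2pi mulr1.
congr (normc (bilateral_sum _)); apply/funext => k.
by rewrite /modulate mulrCA -e2piD; congr (_ * e2pi _); ring.
Qed.

Lemma zak0P f : memell2 (fun k => f k%:~R) -> is_fourier_series (fun k => f k%:~R) (zak0 f).
Proof. by move=> /fourier_series_exists[z fz]; apply: xgetPex; exists z. Qed.

(** Both have the samples of [f] as Fourier coefficients. *)
Lemma zak0_perz f : classU f -> memell2 (fun k => f k%:~R) ->
  {ae mu, forall w, I w -> zak0 f w = perz (fourier f) w}.
Proof.
move=> fU f2; have F1 : L1 setT (fourier f) by case: fU.
have [p1 _] := perz_cintegral F1.
apply: (fourier_series_ae (zak0P f2) p1) => k.
by rewrite sample_coef0// -classU_inversion.
Qed.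

Lemma perz_ae F G : {ae mu, forall w, F w = G w} -> {ae mu, forall w, perz F w = perz G w}.
Proof.
move=> FG; apply: (aeS (ae_int (fun k => ae_shift k%:~R FG))) => w E.
have Ea : abs_per F w = abs_per G w by apply: eq_esum => k _; rewrite E.
by rewrite /perz Ea; congr (if _ then bilateral_sum _ else _); apply/funext => k; rewrite E.
Qed.

Lemma abs_per_ae F G : {ae mu, forall w, F w = G w} -> {ae mu, forall w, abs_per F w = abs_per G w}.
Proof.
move=> FG; apply: (aeS (ae_int (fun k => ae_shift k%:~R FG))) => w E.
by apply: eq_esum => k _; rewrite E.
Qed.

(** ** Integrals of functions that are measurable up to a null set *)

(** The integral is a supremum over simple functions, so monotonicity needs no
    measurability; it applies to the pointwise Zak transform. *)
Lemma ge0_integral_mono (D : set R) (u v : R -> \bar R) : (forall x, D x -> (0 <= u x)%E) ->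
  (forall x, D x -> (u x <= v x)%E) -> (\int[mu]_(x in D) u x <= \int[mu]_(x in D) v x)%E.
Proof.
move=> u0 uv; rewrite integral_mkcond [leRHS]integral_mkcond.
have ur x : (0 <= (u \_ D) x)%E by rewrite patchE; case: ifPn => // /set_mem/u0.
have uvr x : ((u \_ D) x <= (v \_ D) x)%E by rewrite !patchE; case: ifPn => // /set_mem/uv.
rewrite !ge0_integralTE//; last by move=> x; exact: le_trans (uvr x).
apply: le_ereal_sup => _ [h /= hu <-]; exists h => //= x.
exact: le_trans (hu x) (uvr x).
Qed.

(** [u] lies between two measurable modifications of [v] on the null set: by $0$ below and
    by infinity above. *)
Lemma ge0_integral_ae (D : set R) (u v : R -> \bar R) : measurable D ->
  measurable_fun D v -> (forall x, D x -> (0 <= u x)%E) -> (forall x, D x -> (0 <= v x)%E) ->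
  {ae mu, forall x, D x -> u x = v x} -> (\int[mu]_(x in D) u x = \int[mu]_(x in D) v x)%E.
Proof.
move=> mD mv u0 v0 [N [mN N0 sN]].
have uv x : D x -> ~ N x -> u x = v x.
  by move=> Dx Nx; apply: contrapT => uvx; apply: Nx; apply: sN => /= /(_ Dx).
have m1 (A : set R) : measurable A -> measurable_fun D (fun x : R => (\1_A x : R)%:E).
  by move=> mA; apply/measurable_EFinP; apply: measurable_funTS; exact: measurable_indic.
have aeN : {ae mu, forall x, ~ N x} by exists N; split => // x /= /contrapT.
have lo : (\int[mu]_(x in D) ((\1_(~` N) x : R)%:E * v x) = \int[mu]_(x in D) v x)%E.
  apply: ge0_ae_eq_integral => //.
  - by apply: emeasurable_funM => //; apply: m1; exact: measurableC.
  - by move=> x Dx; rewrite mule_ge0// ?lee_fin ?indicE// v0.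
  - by apply: (aeS aeN) => x Nx Dx; rewrite indicE mem_set// mul1e.
have hi : (\int[mu]_(x in D) (v x + +oo * (\1_N x : R)%:E) = \int[mu]_(x in D) v x)%E.
  apply: ge0_ae_eq_integral => //.
  - by apply: emeasurable_funD => //; apply: emeasurable_funM => //; exact: m1.
  - by move=> x Dx; rewrite adde_ge0 ?v0// mule_ge0// lee_fin indicE.
  - by apply: (aeS aeN) => x Nx Dx; rewrite indicE memNset// mule0 adde0.
apply/eqP; rewrite eq_le; apply/andP; split.
- rewrite -hi; apply: ge0_integral_mono => // x Dx; rewrite indicE.
  have [/set_mem xN|xN] := boolP (x \in N).
    by rewrite mule1 addey ?leey// -ltNye (lt_le_trans _ (v0 x Dx)).
  by rewrite (uv _ Dx); [rewrite mule0 adde0|move=> /mem_set; exact/negP].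
- rewrite -lo; apply: ge0_integral_mono => x Dx; rewrite indicE.
    by rewrite mule_ge0// ?lee_fin// v0.
  have [|xN] := boolP (x \in ~` N); first by rewrite inE => /(uv _ Dx) ->; rewrite mul1e.
  by rewrite mul0e u0.
Qed.

End Samples.

(** * Uniform boundedness *)
Section UniformBoundedness.
Context {R : realType}.
Local Notation mu := (@lebesgue_measure R).
Local Notation I := (`[0%R, 1%R]%classic : set R).
Implicit Types (f g h s C H : R -> R[i]) (c : int -> R[i]).

Local Notation pairing C H := (cintegral I (fun w => C w * H w)).

(** The two pairings on the right differ by twice the one on the left. *)
Lemma pairing_addsub C D H : L2 I C -> L2 I D -> L2 I H ->
  normc (pairing D H) <= normc (pairing (fun w => C w + D w) H) \/
  normc (pairing D H) <= normc (pairing (fun w => C w + (- 1) * D w) H).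
Proof.
move=> C2 D2 H2; have CH := L2M (@mI R) C2 H2; have DH := L2M (@mI R) D2 H2.
have -> : pairing (fun w => C w + D w) H = pairing C H + pairing D H.
  by under eq_cintegral do rewrite mulrDl; exact: cintegralD.
have -> : pairing (fun w => C w + (- 1) * D w) H = pairing C H - pairing D H.
  under eq_cintegral do rewrite mulN1r mulrBl; exact: cintegralB.
set a := pairing C H; set b := pairing D H.
have [|H1] := lerP (normc b) (normc (a + b)); first by left.
right; have [//|H3] := lerP (normc b) (normc (a - b)).
have : normc (b + b) <= normc (a + b) + normc (a - b).
  rewrite (_ : b + b = (a + b) - (a - b)); last by ring.
  by rewrite (le_trans (le_normcD _ _))// normcN.
have -> : normc (b + b) = normc b + normc b.
  by rewrite -mulr2n -mulr_natl normcM -[2%:R](rmorph_nat (real_complex R)) normc_real ger0_norm// mulr_natl.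
by move=> H4; have := lt_le_trans (ltrD H1 H3) (le_refl _); rewrite ltNge H4.
Qed.

(** If the norms were unbounded, pick $H_n$ of norm at least $16^n$ and add to
    $C_n$, up to sign, the multiple of $\overline{H_n}$ of norm $4^{-n}$ so that
    $|\langle C_{n+1}, H_n\rangle| \ge 4^{-n}\|H_n\|$. The later steps move the
    pairing with $H_n$ by less than half of this, and the limit $C$ has
    $|\langle C, H_n\rangle| \ge 4^n/2$. *)
Lemma uniform_boundedness (X : Type) (H : X -> R -> R[i]) : (forall x, L2 I (H x)) ->
  (forall C, L2 I C -> exists M : R, forall x, normc (pairing C (H x)) <= M) ->
  exists L : R, forall x, (sqnorm I (H x) <= L%:E)%E.
Proof.
move=> H2 bnd; apply: contrapT => nL; have mI := @mI R.
(* $256=16^2$: squared norms of [H] against squared steps $16^{-n}$ *)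
have /choice[x_ Hx] n : exists x, ((256 ^+ n)%:E <= sqnorm I (H x))%E.
  apply: contrapT => Hn; apply: nL; exists (256 ^+ n) => x.
  by rewrite leNgt; apply/negP => Hlt; apply: Hn; exists x; exact: ltW.
pose h n := fine (sqnorm I (H (x_ n))).
have hE n : sqnorm I (H (x_ n)) = (h n)%:E := L2_sqnormE (H2 (x_ n)).
have h256 n : 256 ^+ n <= h n by rewrite -lee_fin -hE.
have h0 n : 0 < h n by apply: lt_le_trans (h256 n); apply: exprn_gt0; rewrite ltr0n.
pose eta n := Num.sqrt (h n).
have eta2 n : eta n ^+ 2 = h n by rewrite sqr_sqrtr// ltW.
have eta0 n : 0 < eta n by rewrite sqrtr_gt0.
pose rho n : R := 4^-1 ^+ n.
have rho0 n : 0 < rho n by rewrite exprn_gt0// invr_gt0.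
have er n : 4 ^+ n <= eta n * rho n.
  rewrite /rho -ler_pdivrMr; last by rewrite exprn_gt0// invr_gt0.
  rewrite exprVn invrK -exprMn -(@ler_pXn2r _ 2)// ?nnegrE ?exprn_ge0 ?(ltW (eta0 n))//.
  by rewrite eta2 -exprM mulnC exprM; apply: le_trans (h256 n); rewrite le_eqVlt; apply/orP; left; apply/eqP; congr (_ ^+ n); ring.
pose D n w := (rho n / eta n)%:C * conjc (H (x_ n) w).
have D2 n : L2 I (D n) by apply: L2Z => //; exact: L2_conj.
have nD n : sqnorm I (D n) = (16^-1 ^+ n)%:E.
  rewrite sqnormZ//; last exact: (L2_conj (H2 _)).1.
  rewrite (@eq_sqnorm _ _ _ (H (x_ n))); last by move=> w _; exact: normc_conj.
  rewrite hE -EFinM sqr_normc_real expr_div_n eta2 divfK ?gt_eqF//.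
  by rewrite /rho exprAC (_ : 4^-1 ^+ 2 = 16^-1 :> R)//; field.
have TD n : normc (pairing (D n) (H (x_ n))) = rho n * eta n.
  have -> : pairing (D n) (H (x_ n)) = (rho n / eta n * h n)%:C.
    under eq_cintegral do rewrite /D -mulrA [_^* * _]mulrC.
    rewrite cintegralZ//; last by apply: L2M => //; exact: L2_conj.
    transitivity ((rho n / eta n)%:C * (h n)%:C); last by rewrite -rmorphM.
    congr (_ * _); have := sqnorm_cintegral mI (H2 (x_ n)).
    rewrite hE => -[->]; apply: complex_eqP => //=.
    rewrite /Rintegral integral0_eq// => w _.
    by rewrite mul_conjc.
  by rewrite normc_real -eta2 expr2 mulrA divfK ?gt_eqF// ger0_norm// mulr_ge0 ?(ltW (rho0 n)) ?(ltW (eta0 n)).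
pose next n C : R -> R[i] := if normc (pairing (D n) (H (x_ n))) <= normc (pairing (fun w => C w + D n w) (H (x_ n)))
  then (fun w => C w + D n w) else (fun w => C w + (-1) * D n w).
pose fix Cs n : R -> R[i] := if n is m.+1 then next m (Cs m) else fun _ => 0.
have Cs2 n : L2 I (Cs n).
  elim: n => [|n IH]; first exact: L20.
  by rewrite /= /next; case: ifP => _; apply: L2D => //; exact: L2Z.
have T1 n : rho n * eta n <= normc (pairing (Cs n.+1) (H (x_ n))).
  rewrite -TD /= /next; case: ifPn => // /negP nle.
  by case: (pairing_addsub (Cs2 n) (D2 n) (H2 (x_ n))).
have step n : sqnorm I (fun w => Cs n.+1 w - Cs n w) = (16^-1 ^+ n)%:E.
  rewrite -nD; apply: eq_sqnorm => w _; rewrite /= /next; case: ifP => _.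
    by congr normc; ring.
  by rewrite -[RHS]normcN; congr normc; ring.
have mC n := (Cs2 n).1.
(* $16/7$ solves $c=2+2c/16$, from the quadratic triangle inequality at each step *)
have far j : forall n, (sqnorm I (fun w => Cs (n + j)%N w - Cs n w)%R <= (16 / 7 * 16^-1 ^+ n)%:E)%E.
  elim: j => [|j IH] n.
    rewrite addn0 (@eq_sqnorm _ _ _ (fun _ => 0)); last by move=> w _; rewrite subrr.
    by rewrite sqnorm0 lee_fin mulr_ge0 ?exprn_ge0// ?invr_ge0.
  apply: (le_trans (sqnorm_triangle mI (mC (n + j.+1)%N) (mC n.+1) (mC n))).
  rewrite step -addSnnS; apply: (le_trans (leeD (lee_wpmul2l _ (IH n.+1)) (le_refl _))) => //.
  rewrite -!EFinM -EFinD lee_fin exprS; set q := 16^-1 ^+ n.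
  by have : 0 <= q :> R by [rewrite exprn_ge0// invr_ge0|]; lra.
have cau (e : R) : 0 < e -> exists N, forall m n, (N <= m)%N -> (N <= n)%N ->
    (sqnorm I (fun w => Cs m w - Cs n w)%R < e%:E)%E.
  move=> e0.
  have q0 n : 0 <= 16^-1 ^+ n :> R by rewrite exprn_ge0// invr_ge0.
  have : (fun n => 16^-1 ^+ n : R) @ \oo --> (0 : R).
    by apply: cvg_expr; rewrite ger0_norm ?invf_lt1 ?ltr1n// invr_ge0.
  have e10 : 0 < e / 10 by rewrite divr_gt0.
  move=> /(cvgr0P _ q0)/(_ _ e10)[N _ HN].
  have small m : (N <= m)%N -> (sqnorm I (fun w => Cs m w - Cs N w)%R < (e / 4)%:E)%E.
    move=> Nm; rewrite -(subnKC Nm); apply: (le_lt_trans (far _ _)).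
    by rewrite lte_fin; have := HN N (leqnn N); rewrite /=; move: (16^-1 ^+ N) => q; lra.
  exists N => m n Nm Nn; apply: (le_lt_trans (sqnorm_triangle mI (mC m) (mC N) (mC n))).
  by apply: lt_quarters; [exact: small|rewrite sqnormB_sym; exact: small].
have [C C2 Ccv] : exists2 C, L2 I C & sqnorm I (fun w => Cs n w - C w) @[n --> \oo] --> 0%E.
  by have [Phi [P2 Pcv]] := L2_complete mI Cs2 cau; eexists; [exact: P2|exact: Pcv].
have farC n : (sqnorm I (fun w => C w - Cs n w)%R <= (16 / 7 * 16^-1 ^+ n)%:E)%E.
  apply: (@sqnorm_lim_le _ _ \oo _ _ (fun p w => Cs (n + p)%N w - Cs n w)) => //.
  - by move=> p; exact: cmeasurableB.
  - by apply: cmeasurableB => //; exact: C2.1.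
  - rewrite (_ : (fun p => _) = fun p => sqnorm I (fun w => Cs (n + p)%N w - C w)); last first.
      by apply/funext => p; apply: eq_sqnorm => w _; congr normc; ring.
    apply/cvge0P => [p|e e0]; first exact: sqnorm_ge0.
    move/(cvge0P _ (fun n => sqnorm_ge0 _ _)) : Ccv => /(_ _ e0)[N _ HN].
    by exists N => // p /= Np; apply: HN => /=; rewrite (leq_trans Np)// leq_addl.
have TC n : 4 ^+ n / 2 <= normc (pairing C (H (x_ n))).
  have E2 : L2 I (fun w => C w - Cs n.+1 w) by exact: L2B.
  have r0 := rho0 n; have n0 := eta0 n.
  (* with this weight the bound on the pairing is $\frac12(\frac5{14}+\frac25)<\frac12$
     of [eta n * rho n] *)
  have t0 : 0 < 5 / 2 * (eta n / rho n) by rewrite mulr_gt0 ?divr_gt0.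
  have := normc_cintegralM_le mI t0 E2 (H2 (x_ n)); rewrite hE -EFinM => bE.
  have {}bE := le_trans bE (leeD (lee_wpmul2l (ltW t0 : (0 <= _%:E)%E) (farC n.+1)) (le_refl _)).
  move: bE; rewrite -EFinM -EFinD lee_fin.
  have -> : 5 / 2 * (eta n / rho n) * (16 / 7 * 16^-1 ^+ n.+1) = 5 / 14 * (eta n * rho n).
    have -> : 16^-1 ^+ n.+1 = 16^-1 * rho n ^+ 2.
      by rewrite exprS /rho exprAC (_ : 4^-1 ^+ 2 = 16^-1 :> R)//; field.
    by field; rewrite gt_eqF.
  have -> : (5 / 2 * (eta n / rho n))^-1 * h n = 2 / 5 * (eta n * rho n).
    by rewrite -eta2; field; rewrite !gt_eqF.
  set TE := pairing (fun w => C w - Cs n.+1 w) _ => bE.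
  have sum : pairing (Cs n.+1) (H (x_ n)) = pairing C (H (x_ n)) - TE.
    rewrite /TE -cintegralB//; [|exact: L2M|exact: L2M].
    by apply: eq_cintegral => w _; ring.
  have := T1 n; rewrite sum => /le_trans/(_ (le_normcD _ _)); rewrite normcN.
  have := er n; move: bE; rewrite [rho n * eta n]mulrC.
  have : 0 < eta n * rho n by rewrite mulr_gt0.
  move: (normc _) (normc _) (eta n * rho n) (4 ^+ n) => a b c d; lra.
have [M CM] := bnd C C2.
pose n := (Num.truncn (2 * M)).+1.
have := le_trans (TC n) (CM (x_ n)); rewrite ler_pdivrMr// mulrC leNgt => /negP; apply.
apply: (lt_le_trans (truncnS_gt _)); rewrite -natrX ler_nat.
by apply: ltnW; exact: ltn_expl.
Qed.

(** The partial sums are the pairings of the function with coefficients [c] with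
    trigonometric polynomials of norms the partial norms of [b], so uniform boundedness
    bounds these norms. *)
Lemma l2_of_convergence (b : int -> R[i]) :
  (forall c, memell2 c -> exists l, bilateral_cvg (fun k => c k * b k) l) -> memell2 b.
Proof.
move=> conv; have mI := @mI R.
pose bw n := bwin (n, n).
pose H (n : nat) w := conjc (tpoly (fun k => conjc (b k)) (bw n) w).
have t2 n : L2 I (tpoly (fun k => conjc (b k)) (bw n)) by apply: L2_trig; exact: trig_tpoly.
have [L HL] : exists L : R, forall n, (sqnorm I (H n) <= L%:E)%E.
  apply: uniform_boundedness => [n|C C2]; first exact: L2_conj.
  have [l cl] := conv _ (parseval_l2 C2).
  have E n : cintegral I (fun w => C w * H n w) = bilateral_psum (fun k => fcoef C k * b k) (n, n).
    rewrite cintegral_conj_tpoly; last exact: L2_I_L1.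
    by rewrite bilateral_psumE; apply: eq_bigr => k _; rewrite conjcK mulrC.
  move/bilateral_cvgP : cl => /(_ _ ltr01)/bilateral_diag[N _ HN].
  exists (\sum_(n < N) normc (cintegral I (fun w => C w * H n w)) + (normc l + 1)) => n.
  have [nN|Nn] := ltnP n N.
    rewrite (bigD1 (Ordinal nN))//= -addrA lerDl addr_ge0 ?addr_ge0 ?normc_ge0//.
    by apply: sumr_ge0.
  rewrite -[leLHS]add0r lerD ?sumr_ge0//; rewrite E.
  set p := bilateral_psum _ _; rewrite (_ : p = l + (p - l)); last by ring.
  by rewrite (le_trans (le_normcD _ _))// lerD2l ltW//; exact: (HN n).
rewrite /memell2; apply: (@le_lt_trans _ _ L%:E); last exact: ltry.
apply: esum_le_sup => r ur.
have /bilateral_diag/filter_ex[n rn] := seq_sub_bwin r.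
apply: le_trans (HL n); rewrite (@eq_sqnorm _ _ _ (tpoly (fun k => conjc (b k)) (bw n))); last first.
  by move=> w _; rewrite normc_conj.
rewrite sqnorm_tpoly ?uniq_bwin// sumEFin lee_fin.
rewrite [leRHS](eq_bigr (fun k => normc (b k) ^+ 2)); last by move=> k _; rewrite normc_conj.
rewrite [leRHS](bigID (mem r))/= -[X in _ <= X + _]big_filter -[leLHS]addr0.
apply: lerD; last by apply: sumr_ge0 => k _; exact: sqr_ge0.
rewrite le_eqVlt; apply/orP; left; apply/eqP; apply: perm_big; apply: uniq_perm => //.
  by rewrite filter_uniq// uniq_bwin.
move=> k; rewrite mem_filter; apply/idP/andP => [kr|[]//].
by split => //; exact: rn.
Qed.

(** The series are pairings with the functions of Fourier coefficients
    $\overline{b_x}$. *)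
Lemma l2_uniform_boundedness (X : Type) (b : X -> int -> R[i]) (hs : (int -> R[i]) -> X -> R[i]) :
  (forall c, memell2 c -> forall x, bilateral_cvg (fun k => c k * b x k) (hs c x)) ->
  (forall c, memell2 c -> exists M : R, forall x, normc (hs c x) <= M) ->
  exists L : R, forall x, (\esum_(k in [set: int]) (normc (b x k) ^+ 2)%:E <= L%:E)%E.
Proof.
move=> conv bnd; have mI := @mI R.
have b2 x : memell2 (fun k => conjc (b x k)).
  have : memell2 (b x) by apply: l2_of_convergence => c c2; exists (hs c x); exact: conv.
  by rewrite /memell2; under eq_esum do rewrite -normc_conj.
have /choice[z_ Hz] x : exists z, is_fourier_series (fun k => conjc (b x k)) z.
  exact: fourier_series_exists.
have z2 x : L2 I (z_ x) := fourier_series_L2 (Hz x).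
have [L HL] : exists L : R, forall x, (sqnorm I (fun w => conjc (z_ x w)) <= L%:E)%E.
  apply: uniform_boundedness => [x|C C2]; first exact: L2_conj.
  have [M CM] := bnd _ (parseval_l2 C2); exists M => x.
  rewrite (_ : cintegral I _ = hs (fcoef C) x)//; apply/eqP.
  rewrite -subr_eq0 -normc_eq0 eq_le normc_ge0 andbT; apply/ler_addgt0Pr => e e0; rewrite add0r.
  have e2 : 0 < e / 2 by rewrite divr_gt0.
  have t2 p : L2 I (fun w => conjc (tpoly (fun k => conjc (b x k)) (bwin p) w)).
    by apply: L2_conj; apply: L2_trig; exact: trig_tpoly.
  have cv : sqnorm I (fun w => conjc (tpoly (fun k => conjc (b x k)) (bwin p) w) - conjc (z_ x w))
      @[p --> (\oo, \oo)] --> 0%E.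
    rewrite (_ : (fun p => _) = fun p => sqnorm I (fun w => tpoly (fun k => conjc (b x k)) (bwin p) w - z_ x w)).
      exact: fourier_series_tpoly.
    by apply/funext => p; apply: eq_sqnorm => w _; rewrite -rmorphB normc_conj.
  have A := cvg_cintegralM _ mI t2 (L2_conj (z2 x)) C2 cv e2.
  have /bilateral_cvgP/(_ _ e2) B := conv _ (parseval_l2 C2) x.
  have [p [Ap Bp]] := filter_ex (filterI (A _) B).
  have Ep : cintegral I (fun w => conjc (tpoly (fun k => conjc (b x k)) (bwin p) w) * C w) =
      bilateral_psum (fun k => fcoef C k * b x k) p.
    under eq_cintegral do rewrite mulrC.
    rewrite cintegral_conj_tpoly; last exact: L2_I_L1.
    by rewrite bilateral_psumE; apply: eq_bigr => k _; rewrite conjcK mulrC.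
  rewrite Ep in Ap; under eq_cintegral do rewrite mulrC.
  apply: ltW; rewrite [e]splitr; move: Ap Bp.
  set u := bilateral_psum _ _; set v := cintegral _ _; set y := hs _ _ => Ap Bp.
  rewrite (_ : v - y = (u - y) - (u - v)); last by ring.
  by apply: (le_lt_trans (le_normcD _ _)); rewrite normcN ltrD.
exists L => x; apply: le_trans (HL x).
rewrite (@eq_sqnorm _ _ _ (z_ x)); last by move=> w _; rewrite normc_conj.
by rewrite (parseval_series (b2 x) (Hz x)); under eq_esum do rewrite -normc_conj.
Qed.

End UniformBoundedness.

(** * Series of translates with square-summable coefficients *)
Section TranslateSeries.
Context {R : realType}.
Local Notation mu := (@lebesgue_measure R).
Local Notation I := (`[0%R, 1%R]%classic : set R).
Implicit Types (f g h s S C F : R -> R[i]) (c : int -> R[i]).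
Let mT := @mTR R.

Lemma ccontinuousD f g : ccontinuous f -> ccontinuous g -> ccontinuous (fun x => f x + g x).
Proof. by move=> cf cg x; exact: cvgD (cf x) (cg x). Qed.

Lemma ccontinuousZ f (a : R[i]) : ccontinuous f -> ccontinuous (fun x => a * f x).
Proof.
move=> cf x; apply/cvgcP => e e0; have a1 : 0 < normc a + 1 by rewrite ltr_wpDl.
have /cvgcP/(_ _ (divr_gt0 e0 a1)) := cf x; apply: filterS => y yx.
rewrite -mulrBr normcM; apply: (@le_lt_trans _ _ ((normc a + 1) * normc (f y - f x))).
  by rewrite ler_wpM2r// lerDl.
by rewrite mulrC -ltr_pdivlMr.
Qed.

Lemma ccontinuous_cst (a : R[i]) : ccontinuous (fun _ : R => a).
Proof. by move=> x; exact: cvg_cst. Qed.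

Lemma ccontinuous_translate s k : ccontinuous s -> ccontinuous (translate s k).
Proof.
move=> cs x; have sx := cs (x - k%:~R).
have t : (fun y : R => y - k%:~R) @ x --> x - k%:~R.
  by apply: cvgB; [exact: cvg_id|exact: cvg_cst].
exact: (cvg_comp _ _ t sx).
Qed.

Lemma ccontinuous_combo s r c : ccontinuous s -> ccontinuous (combo s r c).
Proof.
move=> cs; elim: r => [|k r IH].
  rewrite (_ : combo _ _ _ = fun _ => 0); first exact: ccontinuous_cst.
  by apply/funext => x; rewrite /combo big_nil.
rewrite (_ : combo _ _ _ = fun x => c k * translate s k x + combo s r c x).
  exact: (ccontinuousD (@ccontinuousZ _ (c k) (@ccontinuous_translate s k cs)) IH).
by apply/funext => x; rewrite /combo big_cons.
Qed.

Lemma ccontinuous_bounded h : ccontinuous h -> exists M : R, forall x, I x -> normc (h x) <= M.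
Proof.
move=> /ccontinuousP[cr ci].
have cq : continuous (fun x => complex.Re (h x) ^+ 2 + complex.Im (h x) ^+ 2).
  by move=> x; apply: cvgD; apply: cvgM; (exact: cr || exact: ci).
have [t _ tM] := EVT_max ler01 (continuous_subspaceT cq).
exists (normc (h t)) => x Ix; rewrite -(@ler_pXn2r _ 2)// ?nnegrE ?normc_ge0//.
by rewrite !normc2E; exact: tM.
Qed.

Lemma esum_translate s x :
  \esum_(k in [set: int]) (normc (translate s k x) ^+ 2)%:E =
  \esum_(k in [set: int]) (normc (s (x + k%:~R)) ^+ 2)%:E.
Proof.
rewrite -[RHS]esum_opp; apply: eq_esum => k _; by rewrite /translate mulrNz.
Qed.

(** The bound on the sampled translates makes the convergence uniform, whence a
    continuous sum. *)
Lemma translate_series s (L : R) c : ccontinuous s ->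
  (forall x, \esum_(k in [set: int]) (normc (s (x + k%:~R)) ^+ 2)%:E <= L%:E)%E ->
  memell2 c -> let h x := bilateral_sum (fun k => c k * translate s k x) in
  [/\ ccontinuous h, forall x, bilateral_cvg (fun k => c k * translate s k x) (h x) &
      forall e : R, 0 < e -> \forall p \near (\oo, \oo), forall x,
        normc (bilateral_psum (fun k => c k * translate s k x) p - h x) < e].
Proof.
move=> cs sL c2 h.
have t2 x : (\esum_(k in [set: int]) (normc (translate s k x) ^+ 2)%:E <= L%:E)%E.
  by rewrite esum_translate.
have unif (e : R) : 0 < e -> \forall p \near (\oo, \oo), forall x,
    normc (bilateral_psum (fun k => c k * translate s k x) p - h x) < e.
  move=> e0; have e2 : 0 < e / 2 by rewrite divr_gt0.
  apply: filterS (l2M_psum_dist L c2 e2) => p H x.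
  apply: (le_lt_trans (H (fun k => translate s k x) (t2 x))).
  by rewrite ltr_pdivrMr// ltr_pMr// ltr1n.
split; last exact: unif.
- move=> x; apply/cvgcP => e e0; have e4 : 0 < e / 4 by rewrite divr_gt0.
  have [p Hp] := filter_ex (unif _ e4).
  have /cvgcP/(_ _ e4) := @ccontinuous_combo s (bwin p) c cs x.
  apply: filterS => y; rewrite -[X in normc (X - _)]/(combo s (bwin p) c y) => yx.
  have := Hp x; have := Hp y; rewrite !combo_psum.
  move: (combo s (bwin p) c x) (combo s (bwin p) c y) yx => a b ba hb ha.
  rewrite (_ : h y - h x = - (b - h y) + ((b - a) + (a - h x))); last by ring.
  apply: (le_lt_trans (le_normcD _ _)); rewrite normcN.
  apply: (le_lt_trans (lerD (le_refl _) (le_normcD _ _))).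
  by move: ba hb ha; move: (normc _) (normc _) (normc _) => u v w; lra.
- move=> x; apply: summable_csum; apply: summable_l2M => //.
  exact: le_lt_trans (t2 x) (ltry _).
Qed.

(** Fatou along the diagonal of the windows. *)
Lemma L2_pointwise_lim (S_ : nat * nat -> R -> R[i]) g h : (forall p, cmeasurable (S_ p)) ->
  cmeasurable g -> cmeasurable h ->
  sqnorm setT (fun x => S_ p x - g x) @[p --> (\oo, \oo)] --> 0%E ->
  (forall e : R, 0 < e -> \forall p \near (\oo, \oo), forall x, normc (S_ p x - h x) < e) ->
  {ae mu, forall x, g x = h x}.
Proof.
move=> mS mg mh Sg Sh; apply/(sqnormB_eq0P mg mh); rewrite sqnormB_sym.
apply/eqP; rewrite eq_le sqnorm_ge0 andbT.
apply/lee_addgt0Pr => e e0; rewrite add0e.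
move/(cvge0P _ (fun p => sqnorm_ge0 _ _)) : Sg => /(_ _ e0)/bilateral_diag[N _ HN].
apply: (sqnorm_fatou (u := fun j x => S_ (N + j, N + j)%N x - g x)) => //.
- by move=> j; exact: cmeasurableB.
- move=> x; apply/cvgr0P => [j|d d0]; first exact: normc_ge0.
  have /bilateral_diag[M _ HM] := Sh _ d0; exists M => // j /= Mj.
  rewrite (_ : _ - _ - _ = S_ (N + j, N + j)%N x - h x); last by ring.
  by apply: HM; rewrite /= (leq_trans Mj)// leq_addl.
- by move=> j; apply/ltW/HN; rewrite /= leq_addr.
Qed.

Lemma perz_eq0 F w : (forall k : int, F (w + k%:~R) = 0) -> perz F w = 0 /\ abs_per F w = 0%E.
Proof.
move=> F0; have E : abs_per F w = 0%E.
  by rewrite /abs_per esum1// => k _; rewrite F0 normc0.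
split=> //; apply/eqP; rewrite -normc_eq0 eq_le normc_ge0 andbT -lee_fin.
by have := perz_norm_le F w; rewrite E.
Qed.

Lemma abs_perM C F w : periodic1 C ->
  abs_per (fun w => C w * F w) w = ((normc (C w))%:E * abs_per F w)%E.
Proof.
move=> pC; rewrite /abs_per -esumZ ?normc_ge0//; apply: eq_esum => k _.
by rewrite normcM (periodic_int pC) EFinM.
Qed.

Lemma perzMl C F w : periodic1 C -> (abs_per F w < +oo)%E ->
  perz (fun w => C w * F w) w = C w * perz F w.
Proof.
move=> pC fin; rewrite [RHS]mulrC -(perzM pC fin); congr (perz _ w).
by apply/funext => y; rewrite mulrC.
Qed.

Lemma modulateM C F x : modulate (fun w => C w * F w) x = fun w => C w * modulate F x w.
Proof. by apply/funext => w; rewrite /modulate mulrA. Qed.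

Lemma L2_fourier_series C : L2 I C -> periodic1 C -> is_fourier_series (fcoef C) C.
Proof.
move=> C2 pC; have c2 := parseval_l2 C2; have [z cz] := fourier_series_exists c2.
have zC := fourier_series_ae cz (L2_I_L1 C2) (fun k => erefl).
split=> //; first exact: C2.1.
apply: cvg_trans (fourier_series_tpoly cz).
rewrite (_ : (fun p => _) = fun p => sqnorm I (fun w => tpoly (fcoef C) (bwin p) w - z w))//.
apply/funext => p; transitivity (sqnorm I (fun w => tpoly (fcoef C) (bwin p) w - C w)).
  by congr sqnorm; apply/funext => w; rewrite tpolyE.
have mt : cmeasurable (tpoly (fcoef C) (bwin p)) by apply: trig_cmeasurable; exact: trig_tpoly.
apply: sqnorm_ae => //; [exact: cmeasurableB mt C2.1|exact: cmeasurableB mt (fourier_series_L2 cz).1|].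
by apply: (aeS zC) => w H /H ->.
Qed.

End TranslateSeries.

(** * Sufficiency of the conditions *)
Section Sufficiency.
Context {R : realType}.
Local Notation mu := (@lebesgue_measure R).
Local Notation I := (`[0%R, 1%R]%classic : set R).
Implicit Types (f g h s S C F z : R -> R[i]) (c : int -> R[i]).
Let mT := @mTR R.

(** A generator $s$ whose periodized transform is the indicator of the support $E$ of its
    fibers interpolates: the sample at $n$ of $\sum_k c_k s(\cdot-k)$ is the $n$-th
    Fourier coefficient of $C\,1_E = C$. *)
Lemma interpolation S C n : L1 setT S ->
  {ae mu, forall w, I w -> perz S w = ind (fiber_supp S) w} ->
  L2 I C -> periodic1 C -> (forall w, ~ fiber_supp S w -> C w = 0) ->
  bilateral_cvg (fun k => fcoef C k * translate (inverseF S) k n%:~R) (fcoef C n).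
Proof.
move=> S1 pS C2 pC C0; have mI := @mI R; have mS := S1.1.
have mE := measurable_fiber_supp mS; set E := fiber_supp S in mE pS C0.
have miE := cmeasurable_ind mE.
have iE2 : L2 I (ind E) by apply: (L2_bounded (M := 1)) => // w; exact: normc_ind.
have [p1 _] := perz_cintegral S1.
have sE j : inverseF S j%:~R = fcoef (ind E) j.
  by rewrite -sample_coef0//; apply: fcoef_ae => //; exact: p1.1.
pose H w := ind E w * e2pi (n%:~R * w).
have H2 : L2 I H by apply: L2_e2pi => //; exact: measurable_mull.
have t2 p : L2 I (tpoly (fcoef C) (bwin p)) by apply: L2_trig; exact: trig_tpoly.
have Ep p : bilateral_psum (fun k => fcoef C k * translate (inverseF S) k n%:~R) p =
    cintegral I (fun w => tpoly (fcoef C) (bwin p) w * H w).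
  rewrite bilateral_psumE (_ : (fun w => _) = (fun w => \sum_(k <- bwin p)
      fcoef C k * (ind E w * e2pi ((n - k)%:~R * w)))); last first.
    apply/funext => w; rewrite /tpoly mulr_suml; apply: eq_bigr => k _.
    rewrite /H -mulrA; congr (_ * _); rewrite mulrCA -e2piD; congr (_ * e2pi _).
    by rewrite intrD mulrNz; ring.
  have L1k k : L1 I (fun w => ind E w * e2pi ((n - k)%:~R * w)).
    by apply: L1_fcoef; exact: L2_I_L1.
  rewrite cintegral_sum//; last by move=> k; exact: L1Z.
  apply: eq_bigr => k _; rewrite cintegralZ//; congr (_ * _).
  by rewrite -[RHS]sE /translate intrD mulrNz.
have CH : cintegral I (fun w => C w * H w) = fcoef C n.
  apply: eq_cintegral => w _; rewrite /H mulrA indE.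
  by have [_|] := boolP (w \in E); rewrite ?mulr1// notin_setE => /C0 ->; rewrite !mul0r.
apply/bilateral_cvgP => e e0.
have := cvg_cintegralM _ mI t2 C2 H2 (fourier_series_tpoly (L2_fourier_series C2 pC)) e0.
by move=> /(_ _); apply: filterS => p; rewrite -Ep CH.
Qed.

(** The generator of the sampling space is $s$ with $\hat s = \hat f/Z_f(0,\cdot)$. *)
Lemma sufficiency f (A B L : R) : classU f -> memell2 (fun k => f k%:~R) -> 0 < A -> 0 < B ->
  {ae mu, forall w, ((A * normc (zak0 f w) ^+ 2)%:E <= gram f w)%E /\
                    (gram f w <= (B * normc (zak0 f w) ^+ 2)%:E)%E} ->
  (\int[mu]_(w in `[0%R, 1%R] `&` gram_supp f)
     ((\esum_(k in [set: int]) (normc (fourier f (w + k%:~R)))%:E)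
        * ((normc (zak0 f w))^-1)%:E) < +oo)%E ->
  (forall x : R, (\int[mu]_(w in `[0%R, 1%R] `&` gram_supp f)
       (normc (zak (fourier f) w (- x) / zak0 f w) ^+ 2)%:E < L%:E)%E) ->
  exists phi : R -> R[i], [/\ classU phi, is_frame phi (shift_span phi),
     sampling_space (shift_span phi) & shift_span phi f].
Proof.
move=> fU f2 A0 B0 hb hc hd; have mI := @mI R.
have [cf fL2 F1'] := fU; have F1 : L1 setT (fourier f) := F1'.
have fF := fourierP fL2; set F := fourier f in F1 fF hc hd *; have mF := F1.1.
have hz := zak0P f2; have zF := zak0_perz fU f2; rewrite -/F in zF.
set z := zak0 f in hz zF hb hc hd; have [mz pz _] := hz.
pose u w := (z w)^-1; have mu_ : cmeasurable u by exact: cmeasurableV.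
have pu : periodic1 u by move=> w; rewrite /u pz.
pose S w := u w * F w; have mS : cmeasurable S by exact: cmeasurableM.
have fS w : fiber_sq S w = ((normc (u w) ^+ 2)%:E * fiber_sq F w)%E by exact: fiber_sqM.
have hz0 : {ae mu, forall w, z w = 0 -> F w = 0}.
  apply: (aeS hb) => w [_ +] zw; rewrite zw normc0 expr0n mulr0 => F0.
  have {}F0 : fiber_sq F w = 0%E by apply/eqP; rewrite eq_le F0 fiber_sq_ge0.
  by have := fiber_sq_eq0 0 F0; rewrite addr0.
have FS : {ae mu, forall w, F w = z w * S w}.
  apply: (aeS hz0) => w Hw; have [zw|zw] := eqVneq (z w) 0; first by rewrite zw mul0r Hw.
  by rewrite /S /u mulrA divff// mul1r.
have Sb : {ae mu, forall w, (fiber_sq S w <= B%:E)%E /\ (z w != 0 -> (A%:E <= fiber_sq S w)%E) /\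
    (z w = 0 -> fiber_sq S w = 0%E)}.
  apply: (aeS hb) => w [Hl Hu]; rewrite fS; have [zw|zw] := eqVneq (z w) 0.
    by rewrite /u zw invr0 normc0 expr0n mul0e lee_fin (ltW B0).
  have n0 : 0 < normc (z w) ^+ 2.
    by rewrite exprn_gt0// lt_neqAle normc_ge0 eq_sym normc_eq0 zw.
  rewrite /u normcV exprVn; split; [|split => //].
    by rewrite muleC lee_pdivrMr.
    by move=> _; rewrite muleC lee_pdivlMr.
  by move=> z0; rewrite z0 eqxx in zw.
have br : bracket S A B.
  apply: (aeS Sb) => w [H1 [H2 H3]]; split => // wE; apply: H2; apply/eqP => /H3 E0.
  by move: wE; rewrite /fiber_supp /= E0 ltxx.
have S2 : L2 setT S.
  split => //; rewrite sqnorm_fiber//; apply: (@le_lt_trans _ _ (\int[mu]_(w in I) B%:E)%E).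
    apply: ae_ge0_le_integral => //.
    - by move=> w _; exact: fiber_sq_ge0.
    - exact: measurable_fiber_sq.
    - by move=> w _; rewrite lee_fin ltW.
    - by apply: (aeS Sb) => w [].
  by rewrite integral_cst_I ltry.
have off w : ~ gram_supp f w -> forall k : int, F (w + k%:~R) = 0.
  by move=> wE k; apply: fiber_sq_eq0; exact: fiber_suppPn.
have S1 : L1 setT S.
  split => //; rewrite integral_abs_per//; apply: le_lt_trans hc.
  rewrite integral_mkcondr le_eqVlt; apply/orP; left; apply/eqP; apply: eq_integral => w _.
  rewrite abs_perM// patchE; case: ifPn => [_|]; first by rewrite /u normcV muleC.
  by rewrite notin_setE => /off/perz_eq0[_ ->]; rewrite mule0.
set s := inverseF S.
have sU : classU s by exact: is_fourier_classU.
have [cs s2 _] := sU.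
have sS : is_fourier s S by exact: is_fourier_inverseF.
have B0' := ltW B0.
have fzS : is_fourier f (fun w => z w * S w).
  by apply: (is_fourier_ae fF _ FS); exact: cmeasurableM.
have ffs := series_L2_cvg s2 fL2 sS fzS B0' br hz.
have frs : is_frame s (shift_span s) by exact: bracket_frame s2 sS A0 B0 br.
(* off the support of the Grammian the fibers of [S] vanish, so the integral over the
   support is the whole of the norm in [sample_sq] *)
have sL x : (\esum_(k in [set: int]) (normc (s (x + k%:~R)) ^+ 2)%:E <= L%:E)%E.
  rewrite sample_sq//; apply: le_trans (ltW (hd x)).
  have [pm _] := perz_cintegral (L1_modulate x S1).
  rewrite (ge0_integral_ae (v := fun w => (normc (perz (modulate S x) w) ^+ 2)%:E)).
  - rewrite integral_mkcondr le_eqVlt; apply/orP; left; apply/eqP; apply: eq_integral => w _.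
    rewrite patchE; case: ifPn => // /negP; rewrite inE => /off Fw.
    have [-> _] : perz (modulate S x) w = 0 /\ abs_per (modulate S x) w = 0%E.
      by apply: perz_eq0 => k; rewrite /modulate /S Fw mulr0 mul0r.
    by rewrite normc0 expr0n.
  - by apply: measurableI => //; exact: measurable_fiber_supp.
  - exact: emeasurable_normc2 pm.1.
  - by [].
  - by [].
  - apply: (aeS (abs_per_lty F1)) => w fin _.
    rewrite normcM zak_perz// modulateM perzMl ?abs_per_modulate// -normcM mulrC.
    by [].
exists s; split => //; last exact: (shift_span_series s2 fL2 ffs).
exists s; split => //.
  move=> c c2; have [ch hcv _] := translate_series cs sL c2.
  by eexists; [exact: ch|exact: hcv].
move=> g gs; have g2 : L2 setT g := gs.1.
have [C [C2 pC C0 gC]] := shift_span_multiplier s2 sS A0 B0' br gs.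
have Cs := L2_fourier_series C2 pC; have c2 := parseval_l2 C2.
have [ch hcv hun] := translate_series cs sL c2; set g0 := (fun x => _) in ch hcv hun.
have pS : {ae mu, forall w, I w -> perz S w = ind (fiber_supp S) w}.
  apply: (aeS (aeI (aeI Sb zF) (abs_per_lty F1))) => w [[[_ [H1 H2]] H3] fin] Iw.
  rewrite perzMl// -H3// /u indE; have [zw|zw] := eqVneq (z w) 0.
    rewrite zw mulr0 ifN// notin_setE /fiber_supp /= H2// ltxx; exact/negP.
  by rewrite mulVf// mem_set// /fiber_supp /=; apply: lt_le_trans (H1 zw); rewrite lte_fin.
have g0n n : g0 n%:~R = fcoef C n.
  by apply: bilateral_cvg_sum; apply: interpolation.
have Sp p x : bilateral_psum (fun k => g0 k%:~R * translate s k x) p =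
    bilateral_psum (fun k => fcoef C k * translate s k x) p.
  by rewrite !bilateral_psumE; apply: eq_bigr => k _; rewrite g0n.
have L2c := series_L2_cvg s2 g2 sS gC B0' br Cs.
have mS_ p : cmeasurable (fun x => bilateral_psum (fun k => fcoef C k * translate s k x) p).
  under eq_fun do rewrite combo_psum; exact: (L2_combo _ _ s2).1.
have gg0 : {ae mu, forall x, g x = g0 x}.
  by apply: (L2_pointwise_lim mS_ g2.1 (ccontinuous_cmeasurable ch) L2c).
exists g0; split => //.
- rewrite (_ : (fun p => _) = fun p => sqnorm setT (fun x =>
    bilateral_psum (fun k => fcoef C k * translate s k x) p - g x))//.
  apply/funext => p; transitivity (sqnorm setT (fun x =>
    bilateral_psum (fun k => fcoef C k * translate s k x) p - g0 x)).
    by congr sqnorm; apply/funext => x; rewrite Sp.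
  apply: sqnorm_ae => //.
  + exact: cmeasurableB (mS_ p) (ccontinuous_cmeasurable ch).
  + exact: cmeasurableB (mS_ p) g2.1.
  + by apply: (aeS gg0) => x ->.
- by move=> e e0; apply: filterS (hun e e0) => p Hp x; rewrite Sp; exact: Hp.
Qed.

End Sufficiency.

(** * Necessity of the conditions *)
Section Necessity.
Context {R : realType}.
Local Notation mu := (@lebesgue_measure R).
Local Notation I := (`[0%R, 1%R]%classic : set R).
Implicit Types (f g h s phi S C F z m : R -> R[i]) (c : int -> R[i]).
Let mT := @mTR R.

Lemma translate0 s : translate s 0 = s.
Proof. by apply/funext => x; rewrite /translate subr0. Qed.

Lemma bilateral_cvg_unique u (l l' : R[i]) : bilateral_cvg u l -> bilateral_cvg u l' -> l = l'.
Proof. by move=> /bilateral_cvg_sum <- /bilateral_cvg_sum. Qed.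

(** Summability against the unit sequence exhibits the generator itself as a
    continuous sum. *)
Lemma generator_continuous s :
  (forall c, memell2 c -> exists2 h, ccontinuous h &
     forall x, bilateral_cvg (fun k => c k * translate s k x) (h x)) -> ccontinuous s.
Proof.
move=> H; pose c (k : int) : R[i] := if k == 0 then 1 else 0.
have E (u : int -> R[i]) (r : seq int) : uniq r -> 0 \in r -> \sum_(k <- r) c k * u k = u 0.
  move=> ur r0; rewrite (bigD1_seq 0)//= /c eqxx mul1r big1 ?addr0// => k /negbTE ->.
  by rewrite mul0r.
have cE k : normc (c k) ^+ 2 = (k == 0)%:R.
  by rewrite /c; case: (k == 0); rewrite ?normc1 ?expr1n ?normc0 ?expr0n.
have c2 : memell2 c.
  apply: (@le_lt_trans _ _ 1%:E); last exact: ltry.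
  apply: esum_le_sup => r ur; rewrite sumEFin lee_fin.
  under eq_bigr do rewrite cE.
  have [r0|r0] := boolP (0 \in r).
    by rewrite (bigD1_seq 0)//= big1 ?addr0// => k /negbTE ->.
  rewrite big_seq big1 // => k kr; case: eqP => // k0.
  by rewrite -k0 kr in r0.
have [h ch hcv] := H _ c2; rewrite (_ : s = h)//; apply/funext => x.
apply: bilateral_cvg_unique (hcv x).
apply/bilateral_cvgP => e e0; apply: (near_bilateral (N := 1)) => p _ p2.
rewrite bilateral_psumE (E (fun k => translate s k x)) ?uniq_bwin ?mem_bwin//.
by rewrite translate0 subrr normc0.
Qed.

(** Uniform boundedness on one period: the sums over $k$ are periodic in $x$, and the
    continuous sums of the series are bounded on $[0,1]$. *)
Lemma sampled_translates_bounded s :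
  (forall c, memell2 c -> exists2 h, ccontinuous h &
     forall x, bilateral_cvg (fun k => c k * translate s k x) (h x)) ->
  exists L : R, forall x, (\esum_(k in [set: int]) (normc (s (x + k%:~R)) ^+ 2)%:E <= L%:E)%E.
Proof.
move=> H.
have /choice[hs Hhs] c : exists h : R -> R[i], memell2 c -> ccontinuous h /\
    forall x, bilateral_cvg (fun k => c k * translate s k x) (h x).
  have [/H[h ch hcv]|nc] := pselect (memell2 c); first by exists h.
  by exists (fun _ => 0).
pose fr (x : R) := x - (Num.floor x)%:~R.
have [L HL] : exists L : R, forall x,
    (\esum_(k in [set: int]) (normc (translate s k (fr x)) ^+ 2)%:E <= L%:E)%E.
  apply: (l2_uniform_boundedness (b := fun x k => translate s k (fr x))
    (hs := fun c x => hs c (fr x))) => c /Hhs[ch hcv].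
    by move=> x; exact: hcv.
  have [M HM] := ccontinuous_bounded ch; exists M => x; apply: HM.
  exact: fracpart_itv.
exists L => x; apply: le_trans (HL x); rewrite esum_translate.
rewrite -[leLHS](esum_shift _ (- Num.floor x)) le_eqVlt; apply/orP; left; apply/eqP.
apply: eq_esum => k _; rewrite /fr; congr ((normc (s _) ^+ 2)%:E).
by rewrite intrD mulrNz; ring.
Qed.

(** A generator in the span of another one has a transform dominated by that of the
    other: the multiplier is bounded by the ratio of the fiber norms. *)
Lemma L1_fourier_generator phi s (A B A' B' : R) : classU phi -> L2 setT s -> 0 < A -> 0 < B ->
  bracket (fourier phi) A B -> 0 <= B' -> bracket (fourier s) A' B' -> shift_span phi s ->
  L1 setT (fourier s).
Proof.
move=> [_ p2 P1] s2 A0 B0 bp B0' bs ps.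
have pP := fourierP p2; have sS := fourierP s2; set P := fourier phi in P1 bp pP *.
set S := fourier s in bs sS *.
have [m [m2 pm m0 sm]] := shift_span_multiplier p2 pP A0 (ltW B0) bp ps.
have mP : cmeasurable P := pP.1.1; have mS : cmeasurable S := sS.1.1; have mm := m2.1.
have E := is_fourier_unique s2 sS sm.
pose K := Num.sqrt (B' / A).
have mb : {ae mu, forall w, normc (m w) <= K}.
  apply: (aeS (aeI (aeI bp bs) (fiber_sq_ae E))) => w [[[_ H1] [H2 _]] H3].
  have [wE|wE] := pselect (fiber_supp P w); last first.
    by rewrite m0// normc0 sqrtr_ge0.
  rewrite -[normc _]ger0_norm// -sqrtr_sqr ler_wsqrtr// ler_pdivlMr// -lee_fin.
  apply: le_trans H2; rewrite H3 fiber_sqM// EFinM.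
  exact: (lee_wpmul2l (enormc2_ge0 _) (H1 wE)).
split => //; apply: (@le_lt_trans _ _ (\int[mu]_w (K%:E * (normc (P w))%:E))%E).
  apply: ae_ge0_le_integral => //.
  - exact: emeasurable_normc.
  - by move=> w _; rewrite mule_ge0// lee_fin sqrtr_ge0.
  - by apply: emeasurable_funM => //; exact: emeasurable_normc.
  - apply: (aeS (aeI mb E)) => w [Hm ->] _.
    rewrite normcM -EFinM lee_fin; exact: (ler_wpM2r (normc_ge0 _) Hm).
rewrite ge0_integralZl ?lee_fin ?sqrtr_ge0//; last exact: emeasurable_normc.
by rewrite lte_mul_pinfty// ?lee_fin ?sqrtr_ge0//; exact: P1.2.
Qed.

(** On the Fourier side the sampling formula for $s$ itself reads
    $Z_s(0,\cdot)\,\hat s = \hat s$, in particular on every fiber. *)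
Lemma generator_zak s (A B : R) : classU s -> memell2 (fun k => s k%:~R) -> 0 <= B ->
  bracket (fourier s) A B ->
  sqnorm setT (fun x => bilateral_psum (fun k => s k%:~R * translate s k x) p - s x)
    @[p --> (\oo, \oo)] --> 0%E ->
  {ae mu, forall w, I w -> fiber_supp (fourier s) w -> perz (fourier s) w = 1}.
Proof.
move=> sU c2 B0 br cv; have [_ s2 _] := sU; have sS := fourierP s2.
have cz := zak0P c2; have zP := zak0_perz sU c2; set z := zak0 s in cz zP.
set S := fourier s in br sS zP *; have mS : cmeasurable S := sS.1.1; have [mz pz _] := cz.
have c1 := tpoly_multiplier_cvg mS B0 br cz.
have c2' : sqnorm setT (fun w => tpoly (fun k => s k%:~R) (bwin p) w * S w - S w)
    @[p --> (\oo, \oo)] --> 0%E.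
  under eq_fun do rewrite (is_fourier_dist (L2_combo _ _ s2) s2 (is_fourier_combo _ _ s2 sS) sS).
  by under eq_fun do under [X in sqnorm _ X]eq_fun do rewrite -combo_psum.
have mzS : cmeasurable (fun w => z w * S w) by exact: cmeasurableM.
have mt p : cmeasurable (fun w => tpoly (fun k => s k%:~R) (bwin p) w * S w).
  by apply: cmeasurableM => //; apply: trig_cmeasurable; exact: trig_tpoly.
have zS : {ae mu, forall w, z w * S w = S w}.
  by apply/(sqnormB_eq0P mzS mS); exact: (sqnorm_lim_unique _ mT mt mzS mS c1 c2').
apply: (aeS (aeI (ae_int (fun k => ae_shift k%:~R zS)) zP)) => w [H zw] Iw wE.
rewrite -zw//; apply: contrapT => z1.
have : fiber_sq S w = 0%E.
  apply: esum1 => k _; have := H k; rewrite (periodic_int pz) => Hk.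
  have [->|Sk] := eqVneq (S (w + k%:~R)) 0; first by rewrite normc0 expr0n.
  by case: z1; apply: (mulIf Sk); rewrite mul1r.
by move=> w0; move: wE; rewrite /fiber_supp /= w0 ltxx.
Qed.

Lemma necessity f phi : classU f -> classU phi -> is_frame phi (shift_span phi) ->
  sampling_space (shift_span phi) -> shift_span phi f ->
  [/\ memell2 (fun k => f k%:~R),
      exists A B : R, [/\ 0 < A, 0 < B &
        {ae mu, forall w,
           ((A * normc (zak0 f w) ^+ 2)%:E <= gram f w)%E /\
           (gram f w <= (B * normc (zak0 f w) ^+ 2)%:E)%E}],
      (\int[mu]_(w in `[0%R, 1%R] `&` gram_supp f)
         ((\esum_(k in [set: int]) (normc (fourier f (w + k%:~R)))%:E)
            * ((normc (zak0 f w))^-1)%:E) < +oo)%E &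
      exists2 L : R, 0 < L & forall x : R,
        (\int[mu]_(w in `[0%R, 1%R] `&` gram_supp f)
           (normc (zak (fourier f) w (- x) / zak0 f w) ^+ 2)%:E < L%:E)%E].
Proof.
move=> fU pU pfr [s [sfr scv srec]] pf; have mI := @mI R.
have [cf f2 F1'] := fU; have [_ p2 _] := pU.
have ps : shift_span phi s by rewrite -(translate0 s); exact: sfr.1.
have s2 : L2 setT s := ps.1.
have [Ap [Bp [Ap0 Bp0 bp]]] := frame_bracket_span p2 p2 pfr.
have [A [B [A0 B0 bs]]] := frame_bracket_span p2 s2 sfr.
have cs : ccontinuous s by exact: generator_continuous.
have S1 := L1_fourier_generator pU s2 Ap0 Bp0 bp (ltW B0) bs ps.
have sU : classU s by split.
have [L sL] := sampled_translates_bounded scv.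
have cs2 : memell2 (fun k => s k%:~R).
  apply: (@le_lt_trans _ _ L%:E); last exact: ltry.
  by apply: le_trans (sL 0); under [leRHS]eq_esum do rewrite add0r.
have sE : s = inverseF (fourier s) by apply/funext; exact: classU_inversion.
have P1 : {ae mu, forall w, I w -> fiber_supp (fourier s) w -> perz (fourier s) w = 1}.
  have [s0 [cs0 ss0 cv _]] := srec s ps.
  have Es : s0 = s by apply/funext => x; rewrite -(ccontinuous_ae_eq cs cs0 ss0).
  by apply: (generator_zak sU cs2 (ltW B0) bs); rewrite Es in cv.
have sS := fourierP s2; set S := fourier s in S1 sE P1 sS bs; have mS : cmeasurable S := S1.1.
(* by the sampling formula [f] is a series of translates of [s] *)
have sf : shift_span s f.
  have [f0 [cf0 ff0 cv _]] := srec f pf.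
  have Ef : f0 = f by apply/funext => x; rewrite -(ccontinuous_ae_eq cf cf0 ff0).
  by rewrite Ef in cv; exact: shift_span_series s2 f2 cv.
have [C [C2 pC C0 fC]] := shift_span_multiplier s2 sS A0 (ltW B0) bs sf; have mC := C2.1.
have fF := fourierP f2; have FC := is_fourier_unique f2 fF fC.
have F1 : L1 setT (fourier f) := F1'; set F := fourier f in F1 fF FC *; have mF := F1.1.
have PF : {ae mu, forall w, I w -> perz F w = C w}.
  apply: (aeS (aeI (aeI (perz_ae FC) P1) (abs_per_lty S1))) => w [[-> H] fin] Iw.
  rewrite perzMl//; have [wE|wE] := pselect (fiber_supp S w); first by rewrite H// mulr1.
  by rewrite C0// mul0r.
have cf2 : memell2 (fun k => f k%:~R).
  have -> : (fun k : int => f k%:~R) = fcoef C.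
    apply/funext => k; rewrite [LHS]classU_inversion// -sample_coef0//.
    by apply: fcoef_ae => //; exact: (cmeasurable_perz mF).
  exact: parseval_l2.
have [mz pz _] := zak0P cf2.
have zC : {ae mu, forall w, I w -> zak0 f w = C w}.
  apply: (aeS (aeI (zak0_perz fU cf2) PF)) => w [H1 H2] Iw; rewrite H1//; exact: H2.
have mD : measurable (I `&` gram_supp f) by apply: measurableI => //; exact: measurable_fiber_supp.
have suppC : {ae mu, forall w, gram_supp f w -> C w != 0}.
  apply: (aeS (fiber_sq_ae FC)) => w E wE; apply/eqP => Cw; move: wE.
  by rewrite /gram_supp /= -[gram f w]/(fiber_sq F w) E fiber_sqM// Cw normc0 expr0n mul0e ltxx.
split => //.
- exists A, B; split => //; apply: ae_periodic.
    move=> w k; rewrite -![gram f _]/(fiber_sq F _) fiber_sq_int.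
    by rewrite (periodic_int pz).
  apply: (aeS (aeI (aeI zC bs) (fiber_sq_ae FC))) => w [[zw [H1 H2]] E] Iw.
  rewrite zw// -[gram f w]/(fiber_sq F w) E fiber_sqM//.
  have [wE|wE] := pselect (fiber_supp S w); last by rewrite C0// normc0 expr0n !mulr0 mul0e.
  rewrite ![_ * normc _ ^+ 2]mulrC !(EFinM (normc (C w) ^+ 2)).
  by split; apply: (lee_wpmul2l (enormc2_ge0 _)); [exact: H2|].
- apply: (@le_lt_trans _ _ (\int[mu]_(w in I `&` gram_supp f) abs_per S w)%E).
    have ma : measurable_fun (I `&` gram_supp f) (abs_per F) by exact: measurable_abs_per.
    have mn : measurable_fun (I `&` gram_supp f) (fun w => ((normc (zak0 f w))^-1)%:E).
      rewrite (_ : (fun w => _) = fun w => (normc (zak0 f w)^-1)%:E).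
        by apply: emeasurable_normc; exact: cmeasurableV.
      by apply/funext => w; rewrite normcV.
    have mS1 : measurable_fun (I `&` gram_supp f) (abs_per S) by exact: measurable_abs_per.
    have p1 w : (I `&` gram_supp f) w -> (0 <= abs_per F w * ((normc (zak0 f w))^-1)%:E)%E.
      by move=> _; apply: mule_ge0; [exact: abs_per_ge0|rewrite lee_fin invr_ge0 normc_ge0].
    have p2' w : (I `&` gram_supp f) w -> (0 <= abs_per S w)%E by move=> _; exact: abs_per_ge0.
    have mq := emeasurable_funM ma mn.
    suff : (\int[mu]_(w in I `&` gram_supp f) (abs_per F w * ((normc (zak0 f w))^-1)%:E) <=
      \int[mu]_(w in I `&` gram_supp f) abs_per S w)%E by [].
    apply: ae_ge0_le_integral; [exact: mD|exact: p1|exact: mq|exact: p2'|exact: mS1|].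
    apply: (aeS (aeI (aeI zC suppC) (abs_per_ae FC))) => w [[zw Cw] E] [Iw wE].
    rewrite (zw Iw) E (abs_perM _ _ pC) muleAC -EFinM divff; first by rewrite mul1e.
    by rewrite normc_eq0; exact: Cw.
  apply: (@le_lt_trans _ _ (\int[mu]_(w in I) abs_per S w)%E).
    by apply: ge0_subset_integral => //; [exact: measurable_abs_per|move=> w _; exact: abs_per_ge0].
  by rewrite -integral_abs_per//; exact: S1.2.
exists (`|L| + 1); first by rewrite ltr_wpDl.
move=> x; apply: (@le_lt_trans _ _ L%:E); last first.
  by rewrite lte_fin; apply: (le_lt_trans (ler_norm L)); rewrite ltrDl.
have [pm _] := perz_cintegral (L1_modulate x S1).
rewrite (ge0_integral_ae (v := fun w => (normc (perz (modulate S x) w) ^+ 2)%:E)) //.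
- apply: le_trans (sL x); rewrite [in leRHS]sE sample_sq//.
  by apply: ge0_subset_integral => //; exact: emeasurable_normc2 pm.1.
- exact: emeasurable_normc2 pm.1.
have FCx : {ae mu, forall w, modulate F x w = C w * modulate S x w}.
  by apply: (aeS FC) => w E; rewrite /modulate E mulrA.
apply: (aeS (aeI (aeI (aeI zC suppC) (abs_per_lty F1)) (aeI (abs_per_lty S1) (perz_ae FCx)))).
move=> w [[[zw Cw] finF] [finS E]] [Iw wE].
rewrite normcM (zak_perz _ finF) E perzMl ?abs_per_modulate// (zw Iw) -normcM mulrAC.
by rewrite divff; [rewrite mul1r|exact: Cw].
Qed.

End Necessity.

Theorem theorem4 (R : realType) (f : R -> R[i]) (hf : classU f) :
  (exists phi : R -> R[i],
     [/\ classU phi, is_frame phi (shift_span phi),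
         sampling_space (shift_span phi) & shift_span phi f])
  <->
  [/\ memell2 (fun k => f k%:~R),
      exists A B : R, [/\ 0 < A, 0 < B &
        {ae @lebesgue_measure R, forall w,
           ((A * normc (zak0 f w) ^+ 2)%:E <= gram f w)%E /\
           (gram f w <= (B * normc (zak0 f w) ^+ 2)%:E)%E}],
      (\int[@lebesgue_measure R]_(w in `[0%R, 1%R] `&` gram_supp f)
         ((\esum_(k in [set: int]) (normc (fourier f (w + k%:~R)))%:E)
            * ((normc (zak0 f w))^-1)%:E) < +oo)%E &
      exists2 L : R, 0 < L & forall x : R,
        (\int[@lebesgue_measure R]_(w in `[0%R, 1%R] `&` gram_supp f)
           (normc (zak (fourier f) w (- x) / zak0 f w) ^+ 2)%:E < L%:E)%E].
Proof.
split => [[phi [pU pfr psamp pf]]|[f2 [A [B [A0 B0 hb]]] hc [L _ hd]]].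
  exact: (necessity hf pU pfr psamp pf).
exact: (sufficiency hf f2 A0 B0 hb hc hd).
Qed.
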